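(* There exist absolute constants $c, C>0$ such that the following holds. Let $\mathbf M_0\in\mathbb C^{d_1\times d_2}$ have rank $r\ge1$ and low-rank condition number $\kappa$, let $\delta\in(0,1)$, and let $t\ge2$ be an integer. Let $\{(\mathbf w_j,p_j)\}_{j=1}^{N_1}$ be a weighted complex projective $t$-design in $\mathbb C^{d_1}$ and $\{(\mathbf w'_j,p'_j)\}_{j=1}^{N_2}$ a weighted complex projective $t$-design in $\mathbb C^{d_2}$. Let $\mathbf a$ and $\mathbf b$ be independent random vectors with $\mathbb P\{\mathbf a=\sqrt{d_1}\,\mathbf w_j\}=p_j$ for $j=1,\dots,N_1$ and $\mathbb P\{\mathbf b=\sqrt{d_2}\,\mathbf w'_j\}=p'_j$ for $j=1,\dots,N_2$. Let $([\mathbf a_i;\mathbf b_i])_{i=1}^n$ be independent copies of $[\mathbf a;\mathbf b]$ and $m_i=\mathbf a_i^*\mathbf M_0\mathbf b_i$. Let $\tilde{\mathbf X}_0\in\mathbb C^{d_1\times r}$ and $\tilde{\mathbf Y}_0\in\mathbb C^{d_2\times r}$ satisfy $\tilde{\mathbf X}_0^*\tilde{\mathbf X}_0=\tilde{\mathbf Y}_0^*\tilde{\mathbf Y}_0$ and $$\|\tilde{\mathbf X}_0\tilde{\mathbf Y}_0^*-\mathbf M_0\|\le c\,r^{-1/2}\kappa^{-2}\|\mathbf M_0\|.$$ If $$n\ge C\,\kappa r(d_1+d_2)\max\{\log(d_1+d_2),\ \log(1/\delta)\},$$ then with probability at least $1-\delta$ the anchored regression exactly recovers $\mathbf M_0$,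 i.e., its estimates satisfy $\hat{\mathbf X}\hat{\mathbf Y}^*=\mathbf M_0$.
   Context: $\|\cdot\|$ denotes the spectral norm of a matrix (and the Euclidean norm of a vector). $[\mathbf a;\mathbf b]$ denotes vertical concatenation. The low-rank condition number is $\kappa=\sigma_1(\mathbf M_0)/\sigma_r(\mathbf M_0)$, the ratio of the largest and smallest non-zero singular values. The real inner product is $\langle\mathbf U,\mathbf V\rangle=\mathrm{Re}(\mathrm{tr}(\mathbf U^*\mathbf V))$. Weighted complex projective $t$-design in $\mathbb C^d$: unit vectors $\mathbf w_1,\dots,\mathbf w_N\in\mathbb C^d$ with weights $p_j\ge0$, $\sum_jp_j=1$, such that $\sum_{j=1}^Np_j(\mathbf w_j\mathbf w_j^* )^{\otimes t}=\binom{d+t-1}{t}^{-1}P_{\mathrm{Sym}^t}$, where $P_{\mathrm{Sym}^t}$ is the orthogonal projector onto the totally symmetric subspace of $(\mathbb C^d)^{\otimes t}$ (the vectors invariant under every permutation of the $t$ tensor factors). Anchored regression: given $\tilde{\mathbf X}_0,\tilde{\mathbf Y}_0$ and the data $(\mathbf a_i,\mathbf b_i,m_i)_{i=1}^n$, the estimates are $$(\hat{\mathbf X},\hat{\mathbf Y})\in\operatorname*{argmax}_{\mathbf X\in\mathbb C^{d_1\times r},\,\mathbf Y\in\mathbb C^{d_2\times r}}\ \langle\tilde{\mathbf X}_0,\mathbf X\rangle+\langle\tilde{\mathbf Y}_0,\mathbf Y\rangle-\frac1n\sum_{i=1}^n\ell_i(\mathbf X,\mathbf Y),$$ where $\ell_i(\mathbf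 X,\mathbf Y)=\frac12\|\mathbf X^*\mathbf a_i\|^2+\frac12\|\mathbf Y^*\mathbf b_i\|^2+|\mathbf a_i^*\mathbf X\mathbf Y^*\mathbf b_i-m_i|$. *)

(* Defs.v *)
From HB Require Import structures.
From mathcomp Require Import all_boot all_order all_algebra all_fingroup.
From mathcomp Require Import complex.
From mathcomp Require Import all_classical all_reals all_analysis.

Set Implicit Arguments.
Unset Strict Implicit.
Unset Printing Implicit Defensive.

Import Order.TTheory GRing.Theory Num.Theory.

Local Open Scope classical_set_scope.
Local Open Scope ring_scope.
Local Open Scope complex_scope.
Local Open Scope sesquilinear_scope.

(* [R[i]] is the field of complex numbers over [R : realType], [A ^t*] the
   conjugate transpose, [x%:C] the embedding of [R]. *)

Section LinearAlgebra.
Variable R : realType.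
Local Notation C := R[i].

Definition cmod (z : C) : R := complex.Re `|z|.

Definition vec_norm m (v : 'cV[C]_m) : R := Num.sqrt (\sum_i cmod (v i 0) ^+ 2).

Definition spectral_norm m n (A : 'M[C]_(m, n)) : R :=
  sup [set vec_norm (A *m x) | x in [set x | vec_norm x <= 1]].

Definition real_inner m n (U V : 'M[C]_(m, n)) : R :=
  complex.Re (\tr (U ^t* *m V)).

(* The squares of the singular values of [A] are the eigenvalues of
   [A ^t* *m A]. *)
Definition nonzero_singular_values m n (A : 'M[C]_(m, n)) : set R :=
  [set s | 0 < s /\ eigenvalue (A ^t* *m A) (s ^+ 2)%:C].

(* For [A != 0] the set is finite and nonempty, so [sup] and [inf] are its
   maximum and minimum. *)
Definition low_rank_cond m n (A : 'M[C]_(m, n)) : R :=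
  sup (nonzero_singular_values A) / inf (nonzero_singular_values A).

Definition orth_projector_onto m (S : set 'cV[C]_m) (P : 'M[C]_m) : Prop :=
  [/\ P ^t* = P, P *m P = P & range (fun x : 'cV[C]_m => P *m x) = S].

End LinearAlgebra.

(* The canonical basis of the [t]-fold tensor power of [C^d] is indexed by the
   maps from ['I_t] to ['I_d], numbered by [enum_rank]. *)
Section TensorPower.
Variables (R : realType) (d t : nat).
Local Notation C := R[i].

Definition multi_index : finType := {ffun 'I_t -> 'I_d}.

Definition tensor_power (A : 'M[C]_d) : 'M[C]_#|multi_index| :=
  \matrix_(i, j) \prod_(s < t)
    A ((enum_val i : multi_index) s) ((enum_val j : multi_index) s).

Definition permute_factors (s : 'S_t) (x : 'cV[C]_#|multi_index|) :
    'cV[C]_#|multi_index| :=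
  \col_i x (enum_rank
    ([ffun k => (enum_val i : multi_index) (s k)] : multi_index)) 0.

Definition symmetric_subspace : set 'cV[C]_#|multi_index| :=
  [set x | forall s : 'S_t, permute_factors s x = x].

End TensorPower.

(* The orthogonal projector [P] exists and is unique. *)
Definition weighted_projective_design (R : realType) (t d N : nat)
    (w : 'I_N -> 'cV[R[i]]_d) (p : 'I_N -> R) : Prop :=
  [/\ forall j, vec_norm (w j) = 1,
      forall j, 0 <= p j,
      \sum_j p j = 1
    & exists P : 'M[R[i]]_#|multi_index d t|,
        orth_projector_onto (@symmetric_subspace R d t) P /\
        \sum_j (p j)%:C *: tensor_power t (w j *m (w j) ^t*) =
          ('C(d + t - 1, t)%:R)^-1 *: P].

Section RandomVectors.
Context {R : realType} {disp : measure_display} {T : measurableType disp}.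
Variable P : probability T R.
Local Notation C := R[i].

(* The Borel sets of [C^m], generated by the real and imaginary parts of the
   coordinates. *)
Definition borel_cvec m : set (set 'cV[C]_m) :=
  <<s [set A | exists (i : 'I_m) (B : set R), measurable B /\
         (A = (fun v : 'cV[C]_m => complex.Re (v i 0)) @^-1` B \/
          A = (fun v : 'cV[C]_m => complex.Im (v i 0)) @^-1` B)] >>.

Definition random_vector m (X : T -> 'cV[C]_m) : Prop :=
  forall A, borel_cvec A -> measurable (X @^-1` A).

Definition independent m1 m2 (X : T -> 'cV[C]_m1) (Y : T -> 'cV[C]_m2) : Prop :=
  forall A B, borel_cvec A -> borel_cvec B ->
    P (X @^-1` A `&` Y @^-1` B) = (P (X @^-1` A) * P (Y @^-1` B))%E.

(* The product rule for the whole family contains the one for its subfamilies,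
   since some of the [A i] may be the whole space. *)
Definition mutually_independent m n (X : 'I_n -> T -> 'cV[C]_m) : Prop :=
  forall A : 'I_n -> set 'cV[C]_m, (forall i, borel_cvec (A i)) ->
    P (\bigcap_(i in [set: 'I_n]) X i @^-1` A i) =
      (\prod_(i < n) P (X i @^-1` A i))%E.

Definition independent_copies m n (X : T -> 'cV[C]_m)
    (Xs : 'I_n -> T -> 'cV[C]_m) : Prop :=
  [/\ forall i, random_vector (Xs i),
      forall i A, borel_cvec A -> P (Xs i @^-1` A) = P (X @^-1` A)
    & mutually_independent Xs].

(* [X = sqrt m *: w j] with probability [p j]; the weights of coinciding points
   add up. *)
Definition drawn_from_design m N (w : 'I_N -> 'cV[C]_m) (p : 'I_N -> R)
    (X : T -> 'cV[C]_m) : Prop :=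
  random_vector X /\
  forall v : 'cV[C]_m, P (X @^-1` [set v]) =
    (\sum_(j < N | (Num.sqrt m%:R)%:C *: w j == v) p j)%:E.

End RandomVectors.

Section AnchoredRegression.
Context {R : realType} {d1 d2 r n : nat}.
Local Notation C := R[i].

Definition measurement (M : 'M[C]_(d1, d2)) (a : 'cV[C]_d1) (b : 'cV[C]_d2) : C :=
  (a ^t* *m M *m b) 0 0.

Definition loss (a : 'cV[C]_d1) (b : 'cV[C]_d2) (m : C)
    (X : 'M[C]_(d1, r)) (Y : 'M[C]_(d2, r)) : R :=
  2^-1 * vec_norm (X ^t* *m a) ^+ 2 + 2^-1 * vec_norm (Y ^t* *m b) ^+ 2
  + cmod (measurement (X *m Y ^t*) a b - m).

Variables (X0 : 'M[C]_(d1, r)) (Y0 : 'M[C]_(d2, r)).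
Variables (a : 'I_n -> 'cV[C]_d1) (b : 'I_n -> 'cV[C]_d2) (m : 'I_n -> C).

Definition anchored_objective (X : 'M[C]_(d1, r)) (Y : 'M[C]_(d2, r)) : R :=
  real_inner X0 X + real_inner Y0 Y
  - n%:R^-1 * \sum_(i < n) loss (a i) (b i) (m i) X Y.

Definition anchored_estimate (X : 'M[C]_(d1, r)) (Y : 'M[C]_(d2, r)) : Prop :=
  forall X' Y', anchored_objective X' Y' <= anchored_objective X Y.

(* The argmax is nonempty and each of its elements is a factorization of [M0]. *)
Definition exactly_recovers (M0 : 'M[C]_(d1, d2)) : Prop :=
  (exists X Y, anchored_estimate X Y) /\
  (forall X Y, anchored_estimate X Y -> X *m Y ^t* = M0).

End AnchoredRegression.

(* Main.v *)
Require Import Defs.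
From mathcomp Require Import all_boot all_order all_algebra all_fingroup.
From mathcomp Require Import complex.
From mathcomp Require Import all_classical all_reals all_analysis.
From mathcomp Require Import ring lra zify.

Import Order.TTheory GRing.Theory Num.Theory.

Local Open Scope classical_set_scope.
Local Open Scope ring_scope.
Local Open Scope complex_scope.
Local Open Scope sesquilinear_scope.

Set Implicit Arguments.
Unset Strict Implicit.
Unset Printing Implicit Defensive.

(** Let [U], [V] be orthonormal bases of the column and row spaces of [M0].  The
    good event is that the empirical mean of [|a_i^* Z b_i|] is at least
    [|Z|_F / 16] for every [Z] in the tangent space [{H V^* + U K^*}], and that
    the empirical covariances of the [a_i] and of the [b_i] nearly fix [U] and [V].

    On it, the anchor is close to an exact factorization [X Y^* = M0] with [X = U G],
    [Y = V J], so the objective has a small gradient there.  Moving by [(H, K)]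
    loses the empirical modulus of the tangent vector [H Y^* + X K^*], linear in
    the size of the move except along the gauge directions [H = X S], [K = - Y S^*], where
    the quadratic terms take over; hence every maximizer is near [(X, Y)].
    Splitting a maximizer as [(X2 + H2, Y2 + K2)] with [X2 Y2^* = M0] and [H2]
    orthogonal to the range of [X2] removes the gauge, and the linear loss forces
    [H2 = K2 = 0].

    A t-design with [t >= 2] is a 2-design, so [a^* Z b] has second moment
    [|Z|_F^2] and fourth moment at most [4 |Z|_F^4].  This gives a small-ball
    estimate for the empirical modulus at each [Z], made uniform by a grid net of
    the tangent space, while a Bernstein inequality for Hilbert-space valued sums
    controls the covariances.  Since the design has finitely many points, all of
    this takes place on a finite product probability space. *)

(** * Frobenius norm *)

(** For [t = 2] nothing beyond the fourth moment of [a^* Z b] is controlled, so no sharp upper tail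
    is available. The argument therefore asks only for a lower bound on the empirical modulus, and
    only on the one tangent space at [M0]. The second-order residual [H K^*] of a move leaves that
    space; it is absorbed by the quadratic terms of the loss, by the inequality between arithmetic
    and geometric means.

    The condition number enters the sample size through the covariances alone. With [p] and [q] the
    square roots of the extreme singular values, factors of [M0] have size up to [q], while the
    gradient must be a small multiple of [p]. Hence [U] and [V] have to be fixed up to
    [e * (p / q)], that is [e / sqrt kappa], and the Bernstein exponent is quadratic in this
    accuracy.

    The factor [r^(-1/2)] of the anchor condition pays for passing from the spectral to the
    Frobenius norm. The factor [log (d1 + d2)] is the price of the net per real coordinate: its mesh
    is polynomial in [d1 + d2], because the modulus is compared at nearby points by a deterministic
    bound from the lengths of [a] and [b]. *)

Section Modulus.
Variable R : realType.
Implicit Types z : R[i].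

Lemma cReD z1 z2 : complex.Re (z1 + z2) = complex.Re z1 + complex.Re z2.
Proof. by case: z1 z2 => [? ?] []. Qed.

Lemma cImD z1 z2 : complex.Im (z1 + z2) = complex.Im z1 + complex.Im z2.
Proof. by case: z1 z2 => [? ?] []. Qed.

Lemma cReN z : complex.Re (- z) = - complex.Re z.
Proof. by case: z. Qed.

Lemma cImN z : complex.Im (- z) = - complex.Im z.
Proof. by case: z. Qed.

Lemma cReM z1 z2 : complex.Re (z1 * z2) =
  complex.Re z1 * complex.Re z2 - complex.Im z1 * complex.Im z2.
Proof. by case: z1 z2 => [? ?] []. Qed.

Lemma cImM z1 z2 : complex.Im (z1 * z2) =
  complex.Re z1 * complex.Im z2 + complex.Im z1 * complex.Re z2.
Proof. by case: z1 z2 => [? ?] []. Qed.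

Lemma cRe_conj z : complex.Re (Num.conj z) = complex.Re z.
Proof. by case: z. Qed.

Lemma cIm_conj z : complex.Im (Num.conj z) = - complex.Im z.
Proof. by case: z. Qed.

Lemma cRe_sum (I : Type) (s : seq I) (Q : pred I) (F : I -> R[i]) :
  complex.Re (\sum_(i <- s | Q i) F i) = \sum_(i <- s | Q i) complex.Re (F i).
Proof. by apply: (big_morph _ cReD). Qed.

Lemma cmodE z : `|z| = (cmod z)%:C.
Proof. by rewrite /cmod normc_def. Qed.

Lemma cmodEsqrt z : cmod z = Num.sqrt (complex.Re z ^+ 2 + complex.Im z ^+ 2).
Proof. by rewrite /cmod normc_def. Qed.

Lemma cmod_ge0 z : 0 <= cmod z.
Proof. by rewrite cmodEsqrt sqrtr_ge0. Qed.

Lemma sqr_cmod z : cmod z ^+ 2 = complex.Re z ^+ 2 + complex.Im z ^+ 2.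
Proof. by rewrite cmodEsqrt sqr_sqrtr// addr_ge0 ?sqr_ge0. Qed.

Lemma sqr_cmodC z : (cmod z ^+ 2)%:C = z * Num.conj z.
Proof. by rewrite rmorphXn/= -cmodE normCK. Qed.

Lemma cmodM z1 z2 : cmod (z1 * z2) = cmod z1 * cmod z2.
Proof. by apply: complexI; rewrite rmorphM /= -!cmodE normrM. Qed.

Lemma cmodN z : cmod (- z) = cmod z.
Proof. by rewrite !cmodEsqrt cReN cImN !sqrrN. Qed.

Lemma cmod0 : cmod (0 : R[i]) = 0.
Proof. by rewrite /cmod normr0. Qed.

Lemma cmodD z1 z2 : cmod (z1 + z2) <= cmod z1 + cmod z2.
Proof. by rewrite -lecR rmorphD /= -!cmodE ler_normD. Qed.

Lemma cmod_real (x : R) : cmod x%:C = `|x|.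
Proof. by rewrite cmodEsqrt /= expr0n addr0 sqrtr_sqr. Qed.

End Modulus.

Section FrobeniusProduct.
Variable R : realType.
Local Notation C := R[i].

Lemma eq_ler (x y : R) : x = y -> x <= y.
Proof. by move=> ->. Qed.

Lemma sqr_le (x y : R) : 0 <= y -> x ^+ 2 <= y ^+ 2 -> x <= y.
Proof. by move=> y0 xy; nra. Qed.

Lemma le_sqr (x y : R) : 0 <= x -> x <= y -> x ^+ 2 <= y ^+ 2.
Proof. by move=> x0 xy; nra. Qed.

Lemma real_innerE m n (A B : 'M[C]_(m, n)) : real_inner A B =
  \sum_i \sum_j (complex.Re (A i j) * complex.Re (B i j) +
                 complex.Im (A i j) * complex.Im (B i j)).
Proof.
rewrite /real_inner /mxtrace cRe_sum exchange_big /=; apply: eq_bigr => j _.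
rewrite !mxE cRe_sum; apply: eq_bigr => i _.
by rewrite !mxE cReM cRe_conj cIm_conj; ring.
Qed.

Lemma real_innerC m n (A B : 'M[C]_(m, n)) : real_inner A B = real_inner B A.
Proof.
by rewrite !real_innerE; do 2 (apply: eq_bigr => ? _); rewrite mulrC [X in _ + X]mulrC.
Qed.

Lemma real_innerDr m n (A B B' : 'M[C]_(m, n)) :
  real_inner A (B + B') = real_inner A B + real_inner A B'.
Proof. by rewrite /real_inner mulmxDr mxtraceD cReD. Qed.

Lemma real_innerDl m n (A A' B : 'M[C]_(m, n)) :
  real_inner (A + A') B = real_inner A B + real_inner A' B.
Proof. by rewrite ![real_inner _ B]real_innerC real_innerDr. Qed.

Lemma real_innerZr m n (A B : 'M[C]_(m, n)) (x : R) :
  real_inner A (x%:C *: B) = x * real_inner A B.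
Proof. by rewrite /real_inner -scalemxAr mxtraceZ cReM /= mul0r subr0. Qed.

Lemma real_innerZl m n (A B : 'M[C]_(m, n)) (x : R) :
  real_inner (x%:C *: A) B = x * real_inner A B.
Proof. by rewrite ![real_inner _ B]real_innerC real_innerZr. Qed.

Lemma real_innerNr m n (A B : 'M[C]_(m, n)) :
  real_inner A (- B) = - real_inner A B.
Proof. by rewrite /real_inner mulmxN raddfN cReN. Qed.

Lemma real_innerNl m n (A B : 'M[C]_(m, n)) :
  real_inner (- A) B = - real_inner A B.
Proof. by rewrite ![real_inner _ B]real_innerC real_innerNr. Qed.

Lemma real_innerBr m n (A B B' : 'M[C]_(m, n)) :
  real_inner A (B - B') = real_inner A B - real_inner A B'.
Proof. by rewrite real_innerDr real_innerNr. Qed.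

Lemma real_innerBl m n (A A' B : 'M[C]_(m, n)) :
  real_inner (A - A') B = real_inner A B - real_inner A' B.
Proof. by rewrite real_innerDl real_innerNl. Qed.

Lemma real_inner0r m n (A : 'M[C]_(m, n)) : real_inner A 0 = 0.
Proof. by rewrite /real_inner mulmx0 raddf0. Qed.

Lemma real_inner_sumr m n (A : 'M[C]_(m, n)) (I : Type) (s : seq I) (Q : pred I)
    (F : I -> 'M[C]_(m, n)) :
  real_inner A (\sum_(i <- s | Q i) F i) = \sum_(i <- s | Q i) real_inner A (F i).
Proof. by apply: (big_morph _ (real_innerDr A)); exact: real_inner0r. Qed.

Lemma real_inner_ge0 m n (A : 'M[C]_(m, n)) : 0 <= real_inner A A.
Proof.
rewrite real_innerE; do 2 (apply: sumr_ge0 => ? _).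
by rewrite -!expr2 addr_ge0 ?sqr_ge0.
Qed.

Lemma real_inner_eq0 m n (A : 'M[C]_(m, n)) : real_inner A A = 0 -> A = 0.
Proof.
rewrite real_innerE => /eqP; rewrite psumr_eq0 => [/allP A0|i _]; last first.
  by apply: sumr_ge0 => j _; rewrite -!expr2 addr_ge0 ?sqr_ge0.
apply/matrixP => i j; rewrite mxE.
have /implyP/(_ isT) := A0 i (mem_index_enum _).
rewrite psumr_eq0 => [/allP/(_ j (mem_index_enum _))/implyP/(_ isT)|? _]; last first.
  by rewrite -!expr2 addr_ge0 ?sqr_ge0.
rewrite -!expr2 paddr_eq0 ?sqr_ge0// !sqrf_eq0 => /andP[/eqP re0 /eqP im0].
by case: (A i j) re0 im0 => ? ? /= -> ->.
Qed.

Lemma ctmxM m n p (A : 'M[C]_(m, n)) (B : 'M[C]_(n, p)) :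
  (A *m B) ^t* = B ^t* *m A ^t*.
Proof. by rewrite trmx_mul map_mxM. Qed.

Lemma ctmxD m n (A B : 'M[C]_(m, n)) : (A + B) ^t* = A ^t* + B ^t*.
Proof. by rewrite linearD /= map_mxD. Qed.

Lemma ctmxN m n (A : 'M[C]_(m, n)) : (- A) ^t* = - A ^t*.
Proof. by rewrite linearN /= map_mxN. Qed.

Lemma ctmxB m n (A B : 'M[C]_(m, n)) : (A - B) ^t* = A ^t* - B ^t*.
Proof. by rewrite ctmxD ctmxN. Qed.

Lemma ctmx1 n : (1%:M : 'M[C]_n) ^t* = 1%:M.
Proof. by rewrite trmx1 map_mx1. Qed.

Lemma real_inner_ct m n (A B : 'M[C]_(m, n)) :
  real_inner (A ^t*) (B ^t*) = real_inner A B.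
Proof.
rewrite !real_innerE exchange_big; do 2 (apply: eq_bigr => ? _).
by rewrite !mxE !cRe_conj !cIm_conj mulrNN.
Qed.

Lemma real_inner_mull m n p (A : 'M[C]_(m, n)) (B : 'M[C]_(n, p)) (D : 'M[C]_(m, p)) :
  real_inner (A *m B) D = real_inner B (A ^t* *m D).
Proof. by rewrite /real_inner ctmxM mulmxA. Qed.

Lemma real_inner_mulr m n p (A : 'M[C]_(m, n)) (B : 'M[C]_(n, p)) (D : 'M[C]_(m, p)) :
  real_inner (A *m B) D = real_inner A (D *m B ^t*).
Proof. by rewrite -real_inner_ct ctmxM real_inner_mull -real_inner_ct !ctmxM !trmxCK. Qed.

Lemma real_inner_sqr_le m n (A B : 'M[C]_(m, n)) :
  real_inner A B ^+ 2 <= real_inner A A * real_inner B B.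
Proof.
have [/eqP/real_inner_eq0 ->|BB0] := boolP (real_inner B B == 0).
  by rewrite !real_inner0r expr0n mulr0.
have BBp : 0 < real_inner B B by rewrite lt_neqAle eq_sym BB0 real_inner_ge0.
have := real_inner_ge0 ((real_inner B B)%:C *: A - (real_inner A B)%:C *: B).
rewrite !(real_innerBl, real_innerBr, real_innerZl, real_innerZr).
rewrite (real_innerC B A).
move: (real_inner A A) (real_inner A B) (real_inner B B) BBp => x y z z0 {BB0}.
have -> : z * (z * x - y * y) - y * (z * y - y * z) = z * (x * z - y ^+ 2) by ring.
by rewrite pmulr_rge0// subr_ge0.
Qed.

Definition fnorm m n (A : 'M[C]_(m, n)) : R := Num.sqrt (real_inner A A).

Lemma fnorm_ge0 m n (A : 'M[C]_(m, n)) : 0 <= fnorm A.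
Proof. exact: sqrtr_ge0. Qed.

Lemma sqr_fnorm m n (A : 'M[C]_(m, n)) : fnorm A ^+ 2 = real_inner A A.
Proof. by rewrite sqr_sqrtr ?real_inner_ge0. Qed.

Lemma fnorm0 m n : fnorm (0 : 'M[C]_(m, n)) = 0.
Proof. by rewrite /fnorm real_inner0r sqrtr0. Qed.

Lemma fnorm_eq0 m n (A : 'M[C]_(m, n)) : fnorm A = 0 -> A = 0.
Proof. by move=> A0; apply: real_inner_eq0; rewrite -sqr_fnorm A0 expr0n. Qed.

Lemma fnorm_ct m n (A : 'M[C]_(m, n)) : fnorm (A ^t*) = fnorm A.
Proof. by rewrite /fnorm real_inner_ct. Qed.

Lemma fnormZ m n (A : 'M[C]_(m, n)) (x : R) : fnorm (x%:C *: A) = `|x| * fnorm A.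
Proof.
by rewrite /fnorm real_innerZl real_innerZr mulrA -expr2 sqrtrM ?sqr_ge0// sqrtr_sqr.
Qed.

Lemma fnormN m n (A : 'M[C]_(m, n)) : fnorm (- A) = fnorm A.
Proof. by rewrite /fnorm real_innerNl real_innerNr opprK. Qed.

Lemma real_inner_norm_le m n (A B : 'M[C]_(m, n)) :
  `|real_inner A B| <= fnorm A * fnorm B.
Proof.
apply: sqr_le; first by rewrite mulr_ge0 ?fnorm_ge0.
by rewrite real_normK ?num_real// exprMn !sqr_fnorm real_inner_sqr_le.
Qed.

Lemma real_inner_le m n (A B : 'M[C]_(m, n)) : real_inner A B <= fnorm A * fnorm B.
Proof. exact: le_trans (ler_norm _) (real_inner_norm_le _ _). Qed.

(** The extremal [B] is [A] itself. Covariance and anchor bounds are passed around in this paired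
    form. *)
Lemma fnorm_dual m n (A : 'M[C]_(m, n)) (t : R) : 0 <= t ->
  (forall B : 'M[C]_(m, n), real_inner A B <= t * fnorm B) <-> fnorm A <= t.
Proof.
move=> t0; split=> [At|At B]; last first.
  apply: le_trans (real_inner_le A B) _.
  by apply: ler_wpM2r At; exact: fnorm_ge0.
have := At A; rewrite -sqr_fnorm; move: (fnorm A) (fnorm_ge0 A) => x.
rewrite le_eqVlt => /predU1P[<-//|x0]; by rewrite expr2 ler_pM2r.
Qed.

Lemma fnormD m n (A B : 'M[C]_(m, n)) : fnorm (A + B) <= fnorm A + fnorm B.
Proof.
apply: sqr_le; first by rewrite addr_ge0 ?fnorm_ge0.
rewrite sqr_fnorm sqrrD !sqr_fnorm !(real_innerDl, real_innerDr) (real_innerC B A).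
have := real_inner_le A B.
by move: (real_inner A A) (real_inner A B) (real_inner B B) (_ * _) => a b c d; lra.
Qed.

Lemma fnormB m n (A B : 'M[C]_(m, n)) : fnorm (A - B) <= fnorm A + fnorm B.
Proof. by rewrite -(fnormN B) fnormD. Qed.

Lemma fnormBC m n (A B : 'M[C]_(m, n)) : fnorm (A - B) = fnorm (B - A).
Proof. by rewrite -fnormN opprB. Qed.

Lemma fnorm_subr m n (A B : 'M[C]_(m, n)) : fnorm A - fnorm B <= fnorm (A - B).
Proof. by have := fnormD (A - B) B; rewrite subrK; lra. Qed.

Lemma fnorm_ge_sub m n (A B : 'M[C]_(m, n)) : fnorm A - fnorm (A - B) <= fnorm B.
Proof. by have := fnormD (A - B) B; rewrite subrK; lra. Qed.

Lemma fnorm_pyth m n (A B : 'M[C]_(m, n)) : real_inner A B = 0 ->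
  fnorm (A + B) ^+ 2 = fnorm A ^+ 2 + fnorm B ^+ 2.
Proof.
move=> AB0; rewrite !sqr_fnorm !(real_innerDl, real_innerDr) (real_innerC B A) AB0.
by rewrite addr0 add0r.
Qed.

Lemma vec_normE m (v : 'cV[C]_m) : vec_norm v = fnorm v.
Proof.
rewrite /vec_norm /fnorm real_innerE; congr Num.sqrt.
by apply: eq_bigr => i _; rewrite big_ord1 sqr_cmod !expr2.
Qed.

Lemma fnorm11 (A : 'M[C]_1) : fnorm A = cmod (A 0 0).
Proof. by rewrite /fnorm real_innerE !big_ord1 cmodEsqrt !expr2. Qed.

Lemma sqr_fnorm_col m n (A : 'M[C]_(m, n)) :
  fnorm A ^+ 2 = \sum_j fnorm (col j A) ^+ 2.
Proof.
rewrite sqr_fnorm real_innerE exchange_big; apply: eq_bigr => j _.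
by rewrite sqr_fnorm real_innerE; apply: eq_bigr => i _; rewrite big_ord1 !mxE.
Qed.

(** Spectral-norm bounds appear throughout as inequalities over all vectors [x]; applied column by
    column, they extend to products in the Frobenius norm. *)
Lemma fnorm_mull_le m n p (A : 'M[C]_(m, n)) (B : 'M[C]_(n, p)) (t : R) : 0 <= t ->
  (forall x : 'cV_n, fnorm (A *m x) <= t * fnorm x) ->
  fnorm (A *m B) <= t * fnorm B.
Proof.
move=> t0 At; apply: sqr_le; first by rewrite ?mulr_ge0 ?fnorm_ge0.
rewrite exprMn !sqr_fnorm_col mulr_sumr; apply: ler_sum => j _.
rewrite -exprMn; apply: le_sqr; first exact: fnorm_ge0.
by rewrite !colE -mulmxA At.
Qed.

Lemma fnorm_mull_ge m n p (A : 'M[C]_(m, n)) (B : 'M[C]_(n, p)) (t : R) : 0 <= t ->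
  (forall x : 'cV_n, t * fnorm x <= fnorm (A *m x)) ->
  t * fnorm B <= fnorm (A *m B).
Proof.
move=> t0 At; apply: sqr_le; first by rewrite ?mulr_ge0 ?fnorm_ge0.
rewrite exprMn !sqr_fnorm_col mulr_sumr; apply: ler_sum => j _.
rewrite -exprMn; apply: le_sqr; first by rewrite mulr_ge0 ?fnorm_ge0.
by rewrite !colE -mulmxA At.
Qed.

(** The bound for a product, applied to the identity, whose Frobenius norm is [sqrt n]. With [n = r]
    this is the source of the factor [r^(-1/2)] in the anchor condition. *)
Lemma fnorm_le_col m n (A : 'M[C]_(m, n)) (t : R) : 0 <= t ->
  (forall x : 'cV_n, fnorm (A *m x) <= t * fnorm x) ->
  fnorm A <= t * Num.sqrt n%:R.
Proof.
move=> t0 At; rewrite -[A]mulmx1; apply: le_trans (fnorm_mull_le _ t0 At) _.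
rewrite ler_wpM2l// /fnorm /real_inner ctmx1 mulmx1 mxtrace1.
by rewrite (_ : complex.Re _ = n%:R)// -(@rmorph_nat _ _ (real_complex R)).
Qed.

(** Cauchy-Schwarz against the rank-one matrix [y x^*] with [y = A x]: the inner product with [A] is
    [|y|^2], and the norm of [y x^*] is at most [|y| |x|]. *)
Lemma fnorm_mulmx_vec m n (A : 'M[C]_(m, n)) (x : 'cV[C]_n) :
  fnorm (A *m x) <= fnorm A * fnorm x.
Proof.
have [->|y0] := eqVneq (A *m x) 0; first by rewrite fnorm0 mulr_ge0 ?fnorm_ge0.
have y_gt0 : 0 < fnorm (A *m x).
  by rewrite lt_neqAle fnorm_ge0 andbT eq_sym; apply: contra_neq y0; exact: fnorm_eq0.
set y := A *m x in y0 y_gt0 *.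
have yx : fnorm (y *m x ^t*) <= fnorm y * fnorm x.
  apply: sqr_le; first by rewrite mulr_ge0 ?fnorm_ge0.
  rewrite exprMn !sqr_fnorm.
  rewrite real_inner_mulr trmxCK -mulmxA.
  have -> : x ^t* *m x = ((real_inner x x)%:C)%:M.
    apply/matrixP => i j; rewrite !ord1 [RHS]mxE eqxx mulr1n /real_inner.
    rewrite /mxtrace big_ord1 RRe_real// mxE.
    by apply: rpred_sum => k _; rewrite !mxE mulrC -sqr_cmodC complex_real.
  by rewrite mul_mx_scalar real_innerZr mulrC.
have : fnorm y ^+ 2 <= fnorm A * (fnorm y * fnorm x).
  rewrite sqr_fnorm {1}/y real_inner_mulr (le_trans (real_inner_le _ _))//.
  by rewrite ler_wpM2l ?fnorm_ge0.
by rewrite mulrCA expr2 ler_pM2l.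
Qed.

Lemma fnormM m n p (A : 'M[C]_(m, n)) (B : 'M[C]_(n, p)) :
  fnorm (A *m B) <= fnorm A * fnorm B.
Proof. by apply: fnorm_mull_le => [|x]; rewrite ?fnorm_ge0 ?fnorm_mulmx_vec. Qed.

End FrobeniusProduct.

(** * The objective around a factorization *)

Section Objective.
Variables (R : realType) (d1 d2 r n : nat).
Local Notation C := R[i].

#[local] Opaque real_inner cmod fnorm.

Definition empirical_covariance m (v : 'I_n -> 'cV[C]_m) : 'M[C]_m :=
  (n%:R^-1 : R)%:C *: \sum_i v i *m (v i) ^t*.

Lemma real_inner_covariance m (v : 'I_n -> 'cV[C]_m) (G H : 'M[C]_(m, r)) :
  real_inner G (empirical_covariance v *m H) =
  n%:R^-1 * \sum_i real_inner (G ^t* *m v i) (H ^t* *m v i).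
Proof.
rewrite -scalemxAl real_innerZr mulmx_suml real_inner_sumr; congr (_ * _).
apply: eq_bigr => i _.
by rewrite real_innerC -mulmxA real_inner_mull -real_inner_ct !ctmxM !trmxCK real_innerC.
Qed.

Lemma real_inner_covarianceC m (v : 'I_n -> 'cV[C]_m) (G H : 'M[C]_(m, r)) :
  real_inner G (empirical_covariance v *m H) =
  real_inner H (empirical_covariance v *m G).
Proof.
rewrite (real_inner_covariance v G H) (real_inner_covariance v H G).
by congr (_ * _); apply: eq_bigr => i _; exact: real_innerC.
Qed.

Lemma real_inner_covariance_ge0 m (v : 'I_n -> 'cV[C]_m) (G : 'M[C]_(m, r)) :
  0 <= real_inner G (empirical_covariance v *m G).
Proof.
rewrite real_inner_covariance mulr_ge0 ?invr_ge0 ?ler0n//.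
by apply: sumr_ge0 => i _; exact: real_inner_ge0.
Qed.

Variables (a : 'I_n -> 'cV[C]_d1) (b : 'I_n -> 'cV[C]_d2).

Definition empirical_modulus (Z : 'M[C]_(d1, d2)) : R :=
  n%:R^-1 * \sum_i cmod (measurement Z (a i) (b i)).

Lemma measurementD (Z Z' : 'M[C]_(d1, d2)) u v :
  measurement (Z + Z') u v = measurement Z u v + measurement Z' u v.
Proof. by rewrite /measurement mulmxDr mulmxDl mxE. Qed.

Lemma measurementN (Z : 'M[C]_(d1, d2)) u v :
  measurement (- Z) u v = - measurement Z u v.
Proof. by rewrite /measurement mulmxN mulNmx mxE. Qed.

Lemma cmod_measurement (Z : 'M[C]_(d1, d2)) u v :
  cmod (measurement Z u v) = fnorm (u ^t* *m Z *m v).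
Proof. by rewrite fnorm11. Qed.

Lemma cmod_measurement_le (Z : 'M[C]_(d1, d2)) u v :
  cmod (measurement Z u v) <= fnorm u * fnorm v * fnorm Z.
Proof.
rewrite cmod_measurement; apply: le_trans (fnormM _ _) _.
rewrite mulrAC; apply: ler_wpM2r; first exact: fnorm_ge0.
by apply: le_trans (fnormM _ _) _; rewrite fnorm_ct.
Qed.

#[local] Opaque measurement.

Lemma empirical_modulus_ge0 Z : 0 <= empirical_modulus Z.
Proof.
by rewrite mulr_ge0 ?invr_ge0 ?ler0n// sumr_ge0// => i _; exact: cmod_ge0.
Qed.

Lemma empirical_modulusD Z Z' :
  empirical_modulus (Z + Z') <= empirical_modulus Z + empirical_modulus Z'.
Proof.
rewrite -mulrDr ler_wpM2l ?invr_ge0 ?ler0n// -big_split /=.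
by apply: ler_sum => i _; rewrite measurementD cmodD.
Qed.

Lemma empirical_modulusN Z : empirical_modulus (- Z) = empirical_modulus Z.
Proof.
rewrite /empirical_modulus; congr (_ * _); apply: eq_bigr => i _.
by rewrite measurementN; exact: cmodN.
Qed.

(** Each measurement of [H K^*] is the inner product of [H^* a_i] and [K^* b_i], at most half the
    sum of their squared norms. This is what lets the quadratic part of the loss pay for the part of
    the residual outside the tangent space. *)
Lemma empirical_modulus_factors (H : 'M[C]_(d1, r)) (K : 'M[C]_(d2, r)) :
  empirical_modulus (H *m K ^t*) <=
  2^-1 * real_inner H (empirical_covariance a *m H) +
  2^-1 * real_inner K (empirical_covariance b *m K).
Proof.
rewrite !real_inner_covariance mulrCA [X in _ + X]mulrCA -mulrDr.
rewrite ler_wpM2l ?invr_ge0 ?ler0n// !mulr_sumr -big_split /=.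
apply: ler_sum => i _; rewrite cmod_measurement.
rewrite mulmxA -mulmxA -{1}[H]trmxCK -ctmxM.
apply: le_trans (fnormM _ _) _; rewrite fnorm_ct -!sqr_fnorm.
move: (fnorm _) (fnorm _) => x y.
by have := sqr_ge0 (x - y); rewrite sqrrB; lra.
Qed.

Variables (X0 : 'M[C]_(d1, r)) (Y0 : 'M[C]_(d2, r)) (M0 : 'M[C]_(d1, d2)).

Lemma loss_fnorm (u : 'cV[C]_d1) (v : 'cV[C]_d2) (m z : C)
    (X : 'M[C]_(d1, r)) (Y : 'M[C]_(d2, r)) :
  measurement (X *m Y ^t*) u v - m = z ->
  loss u v m X Y = 2^-1 * real_inner (X ^t* *m u) (X ^t* *m u) +
    2^-1 * real_inner (Y ^t* *m v) (Y ^t* *m v) + cmod z.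
Proof. by move=> <-; rewrite -2!sqr_fnorm -2!vec_normE. Qed.

Local Notation objective := (anchored_objective X0 Y0 a b
  (fun i => measurement M0 (a i) (b i))).

Lemma objective_sum_diff (N x x' y y' : R) (F G p q h k e : 'I_n -> R) :
  (forall i, F i = G i + (p i + q i + 2^-1 * h i + 2^-1 * k i + e i)) ->
  x + x' + (y + y') - N * \sum_i F i - (x + y - N * \sum_i G i) =
  x' - N * \sum_i p i + (y' - N * \sum_i q i) - 2^-1 * (N * \sum_i h i)
  - 2^-1 * (N * \sum_i k i) - N * \sum_i e i.
Proof.
move=> FE; rewrite (eq_bigr _ (fun i _ => FE i)) !big_split /= -!mulr_sumr.
by do 5 move: (bigop _ _ _) => ?; move: (bigop _ _ _) => ?; ring.
Qed.

(** An exact expansion, not one up to a remainder: the residual vanishes at a factorization of [M0],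
    so the modulus at the moved point sees precisely the increment of the product. *)
Lemma objective_diff (X H : 'M[C]_(d1, r)) (Y K : 'M[C]_(d2, r)) :
  X *m Y ^t* = M0 ->
  objective (X + H) (Y + K) - objective X Y =
    real_inner (X0 - empirical_covariance a *m X) H
    + real_inner (Y0 - empirical_covariance b *m Y) K
    - 2^-1 * real_inner H (empirical_covariance a *m H)
    - 2^-1 * real_inner K (empirical_covariance b *m K)
    - empirical_modulus (H *m Y ^t* + X *m K ^t* + H *m K ^t*).
Proof.
move=> XY; rewrite !real_innerBl ![real_inner (_ *m _) _]real_innerC.
rewrite !real_inner_covariance /anchored_objective /empirical_modulus.
have lossE i : loss (a i) (b i) (measurement M0 (a i) (b i)) (X + H) (Y + K) =
    loss (a i) (b i) (measurement M0 (a i) (b i)) X Y +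
    (real_inner (H ^t* *m a i) (X ^t* *m a i) +
     real_inner (K ^t* *m b i) (Y ^t* *m b i) +
     2^-1 * real_inner (H ^t* *m a i) (H ^t* *m a i) +
     2^-1 * real_inner (K ^t* *m b i) (K ^t* *m b i) +
     cmod (measurement (H *m Y ^t* + X *m K ^t* + H *m K ^t*) (a i) (b i))).
  have resE : measurement ((X + H) *m (Y + K) ^t*) (a i) (b i)
      - measurement M0 (a i) (b i) =
      measurement (H *m Y ^t* + X *m K ^t* + H *m K ^t*) (a i) (b i).
    rewrite -XY ctmxD mulmxDl !mulmxDr !measurementD.
    by do 4 move: (measurement _ _ _) => ?; ring.
  have res0 : measurement (X *m Y ^t*) (a i) (b i)
      - measurement M0 (a i) (b i) = 0 by rewrite XY; exact: subrr.
  rewrite (loss_fnorm resE) (loss_fnorm res0) cmod0.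
  rewrite !ctmxD !mulmxDl.
  move: (X ^t* *m a i) (H ^t* *m a i) (Y ^t* *m b i) (K ^t* *m b i) => x h y k.
  rewrite !(real_innerDl, real_innerDr) (real_innerC x h) (real_innerC y k).
  by move: (cmod _); do 6 move: (real_inner _ _) => ?; move=> ?; field.
rewrite !real_innerDr; exact: objective_sum_diff lossE.
Qed.

#[local] Opaque anchored_objective empirical_modulus empirical_covariance.

(** The quadratic terms are spent on [H K^*], leaving the modulus of the tangent vector alone; this
    is sharp enough away from the gauge directions. *)
Lemma objective_diff_linear (X H : 'M[C]_(d1, r)) (Y K : 'M[C]_(d2, r)) :
  X *m Y ^t* = M0 ->
  objective (X + H) (Y + K) - objective X Y <=
    real_inner (X0 - empirical_covariance a *m X) H
    + real_inner (Y0 - empirical_covariance b *m Y) K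
    - empirical_modulus (H *m Y ^t* + X *m K ^t*).
Proof.
move=> XY; rewrite (objective_diff H K XY).
have := empirical_modulus_factors H K.
have := empirical_modulusD (H *m Y ^t* + X *m K ^t* + H *m K ^t*) (- (H *m K ^t*)).
rewrite addrK empirical_modulusN.
do 3 move: (empirical_modulus _) => ?.
by do 4 move: (real_inner _ _) => ?; lra.
Qed.

(** The opposite trade: the modulus is dropped and the quadratic terms are kept, for gauge
    directions along which the tangent vector vanishes. *)
Lemma objective_diff_quadratic (X H : 'M[C]_(d1, r)) (Y K : 'M[C]_(d2, r)) :
  X *m Y ^t* = M0 ->
  objective (X + H) (Y + K) - objective X Y <=
    real_inner (X0 - empirical_covariance a *m X) H
    + real_inner (Y0 - empirical_covariance b *m Y) K
    - 2^-1 * real_inner H (empirical_covariance a *m H)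
    - 2^-1 * real_inner K (empirical_covariance b *m K).
Proof.
move=> XY; rewrite (objective_diff H K XY).
have := empirical_modulus_ge0 (H *m Y ^t* + X *m K ^t* + H *m K ^t*).
move: (empirical_modulus _) => ?.
by do 4 move: (real_inner _ _) => ?; lra.
Qed.

End Objective.

(** * Geometry of factors and tangent vectors *)

Section FactorGeometry.
Variables (R : realType).
Local Notation C := R[i].

#[local] Opaque real_inner cmod fnorm.

Lemma bounded_below_unitmx n (A : 'M[C]_n) (p : R) : 0 < p ->
  (forall x : 'cV_n, p * fnorm x <= fnorm (A *m x)) -> A \in unitmx.
Proof.
move=> p0 Ap; rewrite -unitmx_tr -row_free_unit; apply: inj_row_free => v vA.
suff : fnorm v^T = 0 by move/fnorm_eq0/(congr1 trmx); rewrite trmxK trmx0.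
have := Ap v^T; have -> : A *m v^T = 0 by rewrite -[A]trmxK -trmx_mul vA trmx0.
rewrite fnorm0 pmulr_rle0// => v0; apply/eqP.
by rewrite eq_le v0 fnorm_ge0.
Qed.

Lemma fnorm_ct_mul_le m n (A : 'M[C]_(m, n)) (t : R) : 0 <= t ->
  (forall x : 'cV_n, fnorm (A *m x) <= t * fnorm x) ->
  forall x : 'cV_m, fnorm (A ^t* *m x) <= t * fnorm x.
Proof.
move=> t0 At x.
have : fnorm (A ^t* *m x) ^+ 2 <= t * fnorm (A ^t* *m x) * fnorm x.
  rewrite sqr_fnorm real_inner_mull trmxCK real_innerC.
  apply: le_trans (real_inner_le _ _) _.
  by apply: ler_wpM2r; [exact: fnorm_ge0 | exact: At].
have := fnorm_ge0 (A ^t* *m x); have := fnorm_ge0 x.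
move: (fnorm x) (fnorm (A ^t* *m x)) => y z y0 z0 h.
have [->|zn0] := eqVneq z 0; first by rewrite mulr_ge0.
have z1 : 0 < z by rewrite lt_neqAle eq_sym zn0.
by rewrite -(ler_pM2l z1) -expr2 (le_trans h)// mulrAC mulrC mulrA.
Qed.

Lemma fnorm_isometry m n k (U : 'M[C]_(m, n)) (B : 'M[C]_(n, k)) :
  U ^t* *m U = 1%:M -> fnorm (U *m B) = fnorm B.
Proof.
move=> UU; apply/eqP; rewrite -(eqrXn2 (n := 2))// ?fnorm_ge0//.
by rewrite !sqr_fnorm real_inner_mull mulmxA UU mul1mx.
Qed.

Lemma fnorm_proj_pyth m n k (U : 'M[C]_(m, n)) (B : 'M[C]_(m, k)) :
  U ^t* *m U = 1%:M ->
  fnorm B ^+ 2 = fnorm (U ^t* *m B) ^+ 2 + fnorm (B - U *m (U ^t* *m B)) ^+ 2.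
Proof.
move=> UU; rewrite -(fnorm_isometry (U ^t* *m B) UU) -fnorm_pyth.
  by rewrite addrC subrK.
by rewrite real_inner_mull mulmxBr mulmxA UU mul1mx subrr real_inner0r.
Qed.

Lemma fnorm_adj_isometry_le m n k (U : 'M[C]_(m, n)) (B : 'M[C]_(m, k)) :
  U ^t* *m U = 1%:M -> fnorm (U ^t* *m B) <= fnorm B.
Proof.
move=> UU; apply: sqr_le; first exact: fnorm_ge0.
by rewrite (fnorm_proj_pyth B UU) lerDl sqr_ge0.
Qed.

Lemma fnorm_coproj_le m n k (U : 'M[C]_(m, n)) (B : 'M[C]_(m, k)) :
  U ^t* *m U = 1%:M -> fnorm (B - U *m (U ^t* *m B)) <= fnorm B.
Proof.
move=> UU; apply: sqr_le; first exact: fnorm_ge0.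
by rewrite (fnorm_proj_pyth B UU) lerDr sqr_ge0.
Qed.

(** Since [H] is orthogonal to the range of [X], the two summands are orthogonal and their squared
    norms add. The factor [7 / 10] stands for [1 / sqrt 2], lost in passing from a sum of squares to
    a square of a sum. *)
Lemma fnorm_tangent_ge m n r (X H : 'M[C]_(m, r)) (Y K : 'M[C]_(n, r)) (p : R) :
  0 <= p -> X ^t* *m H = 0 ->
  (forall x : 'cV_r, p * fnorm x <= fnorm (X *m x)) ->
  (forall x : 'cV_r, p * fnorm x <= fnorm (Y *m x)) ->
  p * (7 / 10) * (fnorm H + fnorm K) <= fnorm (H *m Y ^t* + X *m K ^t*).
Proof.
move=> p0 XH Xp Yp; apply: sqr_le; first exact: fnorm_ge0.
rewrite fnorm_pyth; last first.
  by rewrite real_innerC real_inner_mull mulmxA XH mul0mx real_inner0r.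
have hH : p * fnorm H <= fnorm (H *m Y ^t*).
  by rewrite -[fnorm (_ *m _)]fnorm_ct ctmxM trmxCK -(fnorm_ct H) fnorm_mull_ge.
have hK : p * fnorm K <= fnorm (X *m K ^t*) by rewrite -(fnorm_ct K) fnorm_mull_ge.
have := le_sqr (mulr_ge0 p0 (fnorm_ge0 H)) hH.
have := le_sqr (mulr_ge0 p0 (fnorm_ge0 K)) hK.
generalize (fnorm (H *m Y ^t*)) (fnorm (X *m K ^t*)) (fnorm H) (fnorm K).
move=> x y h k hx hy; apply: le_trans (lerD hy hx).
have -> : (p * h) ^+ 2 + (p * k) ^+ 2 =
    ((p * (h + k)) ^+ 2 + (p * (h - k)) ^+ 2) / 2 by field.
rewrite mulrAC exprMn; have := sqr_ge0 (p * (h - k)); have := sqr_ge0 (p * (h + k)).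
by clear; move: ((p * (h + k)) ^+ 2) ((p * (h - k)) ^+ 2) => x1 x2; lra.
Qed.

(** The covariance is close to the identity only on the range of [U]. The term in [H] alone is
    merely nonnegative, and in the cross terms symmetry moves the covariance onto [U *m T], so no
    spectral bound on the whole covariance enters. *)
Lemma covariance_quadratic_ge m n r (v : 'I_n -> 'cV[C]_m) (U : 'M[C]_(m, r))
    (T : 'M[C]_r) (H : 'M[C]_(m, r)) (eps : R) :
  U ^t* *m U = 1%:M ->
  fnorm (empirical_covariance v *m U - U) <= eps ->
  (1 - eps) * fnorm (U *m T) ^+ 2
    - 2 * (1 + eps) * (fnorm (U *m T) * fnorm H) <=
  real_inner (U *m T + H) (empirical_covariance v *m (U *m T + H)).
Proof.
move=> UU AU; rewrite mulmxDr !(real_innerDl, real_innerDr).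
rewrite (real_inner_covarianceC v (U *m T) H).
have -> : empirical_covariance v *m (U *m T) =
    U *m T + (empirical_covariance v *m U - U) *m T.
  by rewrite mulmxBl -mulmxA addrC subrK.
have := real_inner_covariance_ge0 v H.
have ET : fnorm ((empirical_covariance v *m U - U) *m T) <= eps * fnorm (U *m T).
  rewrite (fnorm_isometry T UU); apply: le_trans (fnormM _ _) _.
  by apply: ler_wpM2r AU; exact: fnorm_ge0.
move: (_ *m T) (U *m T) ET => E Z ET; rewrite !real_innerDr.
move: (real_inner_norm_le Z E) (real_inner_norm_le H E) (real_inner_norm_le H Z).
rewrite !ler_norml -sqr_fnorm => /andP[+ _] /andP[+ _] /andP[+ _].
move: (ler_wpM2l (fnorm_ge0 H) ET) (ler_wpM2l (fnorm_ge0 Z) ET); clear.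
move: (fnorm Z) (fnorm H) (fnorm E) => z h e.
by do 4 move: (real_inner _ _) => ?; lra.
Qed.

End FactorGeometry.

(** * Factors of [M0] near the anchor *)

Section Recovery.
Variables (R : realType) (d1 d2 r n : nat).
Local Notation C := R[i].

#[local] Opaque real_inner cmod fnorm anchored_objective empirical_modulus
  empirical_covariance.

Variables (M0 : 'M[C]_(d1, d2)) (U : 'M[C]_(d1, r)) (V : 'M[C]_(d2, r)).
Variables (X0 : 'M[C]_(d1, r)) (Y0 : 'M[C]_(d2, r)).
Variables (p q tau e : R).

Hypotheses (e_ge0 : 0 <= e) (e_small : 64 * (64 * e) <= 1).

(* [p ^+ 2] and [q ^+ 2] stand for the extreme nonzero singular values of [M0]. *)
Hypotheses (p_gt0 : 0 < p) (p_le_q : p <= q).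
Hypotheses (UU : U ^t* *m U = 1%:M) (VV : V ^t* *m V = 1%:M).
Hypotheses (UM : U *m (U ^t* *m M0) = M0) (VM : V *m (V ^t* *m M0 ^t*) = M0 ^t*).
Hypothesis M0_ge : forall y : 'cV_r, p ^+ 2 * fnorm y <= fnorm (M0 *m (V *m y)).
Hypothesis M0_le : forall x : 'cV_d2, fnorm (M0 *m x) <= q ^+ 2 * fnorm x.
Hypothesis gram : X0 ^t* *m X0 = Y0 ^t* *m Y0.
Hypothesis tau_ge0 : 0 <= tau.
Hypothesis anchor : forall x : 'cV_d2,
  fnorm ((X0 *m Y0 ^t* - M0) *m x) <= tau * fnorm x.
Hypothesis tau_le : tau * Num.sqrt r%:R * q ^+ 2 <= e * (p ^+ 2 * p ^+ 2).
Hypothesis r_gt0 : (0 < r)%N.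

Lemma tau_small : tau <= e * p ^+ 2.
Proof.
have r1 : 1 <= Num.sqrt (r%:R : R) by rewrite -[leLHS]sqrtr1 ler_wsqrtr// ler1n.
move: (Num.sqrt _) r1 tau_le => x x1 h.
have q0 : 0 < q := lt_le_trans p_gt0 p_le_q.
have pq : p ^+ 2 <= q ^+ 2 by apply: le_sqr => //; exact: ltW.
have p20 : 0 < p ^+ 2 by rewrite exprn_gt0.
have : tau * q ^+ 2 <= tau * x * q ^+ 2.
  by apply: ler_wpM2r; [exact: sqr_ge0 | exact: ler_peMr].
move=> h1; rewrite -(ler_pM2r p20) -mulrA.
by apply: le_trans (le_trans h1 h); exact: ler_wpM2l.
Qed.

Lemma e_le : e <= 20^-1.
Proof. by move: e_small; lra. Qed.

Lemma tau_le_tenth : tau <= 10^-1 * p ^+ 2.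
Proof.
apply: le_trans tau_small _; apply: ler_wpM2r; first exact: sqr_ge0.
by move: e_le; lra.
Qed.

Lemma fnorm_gram k (x : 'M[C]_(r, k)) : fnorm (X0 *m x) = fnorm (Y0 *m x).
Proof.
apply/eqP; rewrite -(eqrXn2 (n := 2))// ?fnorm_ge0//.
by rewrite !sqr_fnorm !real_inner_mull !mulmxA gram.
Qed.

(** The matrix [X0 Y0^* V] is within [p^2 / 10] of [M0 V], which is bounded below by [p^2]. Hence
    the square matrix [Y0^* V] is injective, and [v] is [V] applied to the solution of
    [Y0^* V y = x]. *)
Lemma anchor_preimage (x : 'cV[C]_r) : exists2 v : 'cV[C]_d2,
  Y0 ^t* *m v = x & 9 / 10 * p ^+ 2 * fnorm v <= fnorm (X0 *m x).
Proof.
have XYV (y : 'cV[C]_r) :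
    9 / 10 * p ^+ 2 * fnorm y <= fnorm (X0 *m (Y0 ^t* *m (V *m y))).
  have h1 : fnorm (M0 *m (V *m y) - X0 *m (Y0 ^t* *m (V *m y))) <= tau * fnorm y.
    rewrite -(fnorm_isometry y VV); apply: le_trans (anchor _).
    by rewrite mulmxBl -(mulmxA X0) fnormBC.
  have h2 := fnorm_ge_sub (M0 *m (V *m y)) (X0 *m (Y0 ^t* *m (V *m y))).
  have h3 := M0_ge y; have h4 := ler_wpM2r (fnorm_ge0 y) tau_le_tenth.
  have h5 : 0 <= p ^+ 2 * fnorm y by rewrite mulr_ge0 ?fnorm_ge0 ?sqr_ge0.
  apply: le_trans h2; rewrite -mulrA; rewrite -mulrA in h4.
  move: (le_trans h1 h4) h3 h5.
  move: {h1 h4} (p ^+ 2 * fnorm y) (fnorm (M0 *m (V *m y))).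
  by move: (fnorm (M0 *m (V *m y) - X0 *m (Y0 ^t* *m (V *m y)))) => *; lra.
have p20 : 0 < p ^+ 2 by rewrite exprn_gt0.
have Q : Y0 ^t* *m V \in unitmx.
  rewrite -unitmx_tr -row_free_unit; apply: inj_row_free => v vA.
  suff : fnorm v^T = 0 by move/fnorm_eq0/(congr1 trmx); rewrite trmxK trmx0.
  have := XYV v^T; rewrite [Y0 ^t* *m _]mulmxA.
  have -> : (Y0 ^t* *m V) *m v^T = 0 by rewrite -[LHS]trmxK trmx_mul trmxK vA trmx0.
  rewrite mulmx0 fnorm0 pmulr_rle0 ?mulr_gt0 ?divr_gt0// => v0; apply/eqP.
  by rewrite eq_le v0 fnorm_ge0.
have vx : Y0 ^t* *m (V *m (invmx (Y0 ^t* *m V) *m x)) = x.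
  by rewrite !mulmxA mulmxV// mul1mx.
exists (V *m (invmx (Y0 ^t* *m V) *m x)) => //.
by have := XYV (invmx (Y0 ^t* *m V) *m x); rewrite vx (fnorm_isometry _ VV).
Qed.

(** The balance of the anchor turns a bound on the product into one on each factor: for
    [x = Y0^* v], one has [|x|^2 = <Y0 x, v>], at most [|X0 x| |v|], and [|v|] is at most [|X0 x|]
    over [9 / 10 * p^2]. *)
Lemma anchor_X_ge (x : 'cV[C]_r) : 9 / 10 * p * fnorm x <= fnorm (X0 *m x).
Proof.
have [v vx hv] := anchor_preimage x.
have : fnorm x ^+ 2 <= fnorm (X0 *m x) * fnorm v.
  have -> : fnorm x ^+ 2 = real_inner (Y0 *m x) v.
    by rewrite sqr_fnorm real_inner_mull vx.
  by rewrite fnorm_gram real_inner_le.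
move: hv (fnorm_ge0 x) (fnorm_ge0 (X0 *m x)).
move: (fnorm x) (fnorm (X0 *m x)) (fnorm v) => a b c hv a0 b0 h.
apply: sqr_le => //; apply: le_trans (_ : 9 / 10 * (p ^+ 2 * a ^+ 2) <= _).
  by rewrite !exprMn; have := mulr_ge0 (sqr_ge0 p) (sqr_ge0 a); lra.
have := ler_wpM2l b0 hv; have := ler_wpM2l (sqr_ge0 p) h; lra.
Qed.

(** By balance [|X0^* X0 x|^2 = <X0 x, X0 Y0^* Y0 x>], at most [(q^2 + tau) |X0 x|^2]; pairing
    [X0^* X0 x] with [x] then extracts the square root. *)
Lemma anchor_X_le (x : 'cV[C]_r) : fnorm (X0 *m x) <= 11 / 10 * q * fnorm x.
Proof.
have h1 : fnorm (X0 ^t* *m X0 *m x) ^+ 2 <=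
    (11 / 10 * q) ^+ 2 * fnorm (X0 *m x) ^+ 2.
  have -> : fnorm (X0 ^t* *m X0 *m x) ^+ 2 =
      real_inner (X0 *m x) ((X0 *m Y0 ^t*) *m (Y0 *m x)).
    by rewrite sqr_fnorm {2}gram -!mulmxA [LHS]real_inner_mull trmxCK.
  apply: le_trans (real_inner_le _ _) _; rewrite [fnorm _ ^+ 2]expr2 mulrCA.
  apply: ler_wpM2l; first exact: fnorm_ge0.
  have -> : fnorm ((X0 *m Y0 ^t*) *m (Y0 *m x)) =
      fnorm ((X0 *m Y0 ^t* - M0) *m (Y0 *m x) + M0 *m (Y0 *m x)).
    by rewrite -mulmxDl subrK.
  apply: le_trans (fnormD _ _) _; apply: le_trans (lerD (anchor _) (M0_le _)) _.
  rewrite -fnorm_gram -mulrDl; apply: ler_wpM2r; first exact: fnorm_ge0.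
  have := tau_le_tenth; have := le_sqr (ltW p_gt0) p_le_q.
  by have := sqr_ge0 q; rewrite exprMn; lra.
have h2 : fnorm (X0 *m x) ^+ 2 <= fnorm x * fnorm (X0 ^t* *m X0 *m x).
  by rewrite sqr_fnorm real_inner_mull -mulmxA real_inner_le.
have q0 : 0 < q := lt_le_trans p_gt0 p_le_q.
move: h1 h2 (fnorm_ge0 x) (fnorm_ge0 (X0 *m x)) (fnorm_ge0 (X0 ^t* *m X0 *m x)).
move: (fnorm x) (fnorm (X0 *m x)) (fnorm (X0 ^t* *m X0 *m x)) => a b c.
rewrite -exprMn => h1 h2 a0 b0 c0.
have k0 : 0 <= 11 / 10 * q by rewrite mulr_ge0// ?ltW//; lra.
have {h1} h1 : c <= 11 / 10 * q * b by apply: sqr_le h1; exact: mulr_ge0.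
have := le_trans h2 (ler_wpM2l a0 h1).
rewrite expr2 mulrA [leRHS]mulrC => h; move: b0; rewrite le_eqVlt => /predU1P[<-|b0].
  by rewrite mulr_ge0.
by move: h; rewrite (ler_pM2l b0) [a * _]mulrC.
Qed.

(** Closeness of the products does not bound the distance between factors until a representative of
    the gauge orbit is chosen. Here the first factor is the projection of [X0] on the column space
    of [M0], and the second one is forced by the product. *)
Lemma anchored_factors : exists G J : 'M[C]_r,
  [/\ (U *m G) *m (V *m J) ^t* = M0,
      forall x : 'cV_r, 7 / 10 * p * fnorm x <= fnorm (U *m G *m x),
      forall x : 'cV_r, 7 / 10 * p * fnorm x <= fnorm (V *m J *m x) &
   [/\ forall x : 'cV_r, fnorm (U *m G *m x) <= 2 * q * fnorm x,
      forall x : 'cV_r, fnorm (V *m J *m x) <= 2 * q * fnorm x,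
      fnorm (X0 - U *m G) <= 2 * e * p & fnorm (Y0 - V *m J) <= 2 * e * p]].
Proof.
have q0 : 0 < q := lt_le_trans p_gt0 p_le_q.
have p0 := p_gt0; have pq := p_le_q.
have q20 : 0 < q ^+ 2 by rewrite exprn_gt0.
have p20 : 0 < p ^+ 2 by rewrite exprn_gt0.
set G := U ^t* *m X0.
have sr0 : 0 <= Num.sqrt (r%:R : R) := sqrtr_ge0 _.
have XG : fnorm (X0 - U *m G) <= 2 * e * p.
  have t0 : 0 <= tau * (11 / 10 * q / (9 / 10 * p ^+ 2)).
    by rewrite mulr_ge0// divr_ge0// mulr_ge0// ltW// divr_gt0.
  apply: le_trans (fnorm_le_col t0 _) _ => [x|].
    have [v vx hv] := anchor_preimage x.
    (* With [x = Y0^* v], the projection orthogonal to [U] kills [M0 v], so only the error of the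
       product survives. *)
    have -> : (X0 - U *m G) *m x = (X0 *m Y0 ^t* - M0) *m v
        - U *m (U ^t* *m ((X0 *m Y0 ^t* - M0) *m v)).
      have Uv : U *m (U ^t* *m (M0 *m v)) = M0 *m v by rewrite -{2}UM !mulmxA.
      rewrite !mulmxBl !mulmxBr -(mulmxA X0) vx Uv /G -!mulmxA.
      by move: (X0 *m x) (M0 *m v) => y1 y2; rewrite opprB addrA subrK.
    apply: le_trans (fnorm_coproj_le _ UU) _; apply: le_trans (anchor _) _.
    rewrite -mulrA; apply: ler_wpM2l => //.
    rewrite mulrAC ler_pdivlMr ?mulr_gt0 ?divr_gt0// mulrC.
    exact: le_trans hv (anchor_X_le _).
  have := tau_le; move: (Num.sqrt _) sr0 => sr sr0 h.
  have -> : tau * (11 / 10 * q / (9 / 10 * p ^+ 2)) * sr =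
      11 / 9 * (tau * sr * q ^+ 2) / (p ^+ 2 * q) by field; rewrite !gt_eqF.
  rewrite ler_pdivrMr ?mulr_gt0//.
  have pp : e * (p ^+ 2 * p ^+ 2) <= e * (p * (p ^+ 2 * q)).
    by rewrite ler_wpM2l// mulrCA ler_pM2l// expr2 ler_pM2l.
  rewrite -[2 * e * p * _]mulrA -[2 * e * _]mulrA.
  have : 0 <= e * (p ^+ 2 * p ^+ 2) by rewrite mulr_ge0// mulr_ge0// ltW.
  move: pp (le_trans h pp).
  by move: {h} (e * _) (e * _) (tau * _ * _) => *; lra.
have ep : 2 * e * p <= 10^-1 * p by rewrite ler_pM2r//; move: e_le; lra.
have XG' := le_trans XG ep.
have X_ge (x : 'cV[C]_r) : 7 / 10 * p * fnorm x <= fnorm (U *m G *m x).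
  have h1 := fnorm_ge_sub (X0 *m x) (U *m G *m x); apply: le_trans h1.
  have := anchor_X_ge x; rewrite -mulmxBl.
  have h2 := fnormM (X0 - U *m G) x.
  have := ler_wpM2r (fnorm_ge0 x) XG'; have := fnorm_ge0 x.
  move=> x0 h3 h4; move: {h2 h3 XG XG'} (le_trans h2 h3) h4.
  have := mulr_ge0 (ltW p0) x0; rewrite -!mulrA {x0}.
  by do 3 move: (fnorm _) => ?; lra.
have X_le (x : 'cV[C]_r) : fnorm (U *m G *m x) <= 2 * q * fnorm x.
  rewrite -mulmxA (fnorm_isometry _ UU) /G -mulmxA.
  apply: le_trans (fnorm_adj_isometry_le _ UU) _.
  apply: le_trans (anchor_X_le x) _; apply: ler_wpM2r; first exact: fnorm_ge0.
  by lra.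
have G_ge (x : 'cV[C]_r) : 7 / 10 * p * fnorm x <= fnorm (G *m x).
  by rewrite -(fnorm_isometry (G *m x) UU) mulmxA.
have Gu : G \in unitmx by apply: bounded_below_unitmx G_ge; rewrite mulr_gt0// divr_gt0.
(* The only [Y] in the row space with [(U *m G) *m Y ^t* = M0]. *)
set Y := M0 ^t* *m (U *m (invmx G) ^t*).
have VJ : V *m (V ^t* *m Y) = Y by rewrite /Y [_ *m (M0 ^t* *m _)]mulmxA mulmxA VM.
have XY : (U *m G) *m Y ^t* = M0.
  rewrite /Y !ctmxM !trmxCK -mulmxA !(mulmxA G) mulmxV// mul1mx.
  exact: UM.
have YY : fnorm (Y0 - Y) <= 2 * e * p.
  have h1 : 7 / 10 * p * fnorm (Y0 - Y) <= fnorm (G *m (Y0 - Y) ^t*).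
    rewrite -(fnorm_ct (Y0 - Y)); apply: fnorm_mull_ge G_ge.
    by rewrite mulr_ge0 ?divr_ge0// ltW.
  (* Since [G Y^* = U^* M0], the error of the second factor, multiplied by [G], is the projected
     error of the product; [U] has [r] orthonormal columns. *)
  have h2 : fnorm (G *m (Y0 - Y) ^t*) <= tau * Num.sqrt r%:R.
    have -> : G *m (Y0 - Y) ^t* = U ^t* *m (X0 *m Y0 ^t* - M0).
      rewrite ctmxB mulmxBr mulmxBr /G -mulmxA; congr (_ - _).
      by rewrite /Y !ctmxM !trmxCK !mulmxA mulmxV// mul1mx.
    rewrite -fnorm_ct ctmxM trmxCK; apply: le_trans (fnorm_mull_le _ tau_ge0 _) _.
      exact: fnorm_ct_mul_le.
    apply: ler_wpM2l => //; rewrite -[U]mulmx1 (fnorm_isometry _ UU).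
    rewrite -[leRHS]mul1r; apply: fnorm_le_col => // x.
    by rewrite mul1mx mul1r.
  move: {h1 h2} (le_trans h1 h2) => h1.
  have := ler_wpM2r (ltW q20) h1 => {}h1.
  have h4 := le_trans h1 tau_le.
  have h5 : e * (p ^+ 2 * p ^+ 2) <= e * (p ^+ 2 * q ^+ 2).
    by rewrite ler_wpM2l// ler_pM2l// le_sqr// ltW.
  rewrite -(ler_pM2l (mulr_gt0 p0 q20)).
  have -> : p * q ^+ 2 * (2 * e * p) = 2 * (e * (p ^+ 2 * q ^+ 2)) by ring.
  have : 0 <= e * (p ^+ 2 * p ^+ 2) by rewrite mulr_ge0// mulr_ge0// ltW.
  move: h4 h5.
  rewrite [7 / 10 * p * _ * _](_ : _ = 7 / 10 * (p * q ^+ 2 * fnorm (Y0 - Y)));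
    last by ring.
  by move: {XG XG' h1} (p * _ * _) (e * _) (e * _) => *; lra.
have YY' := le_trans YY ep.
have Y_ge (x : 'cV[C]_r) : 7 / 10 * p * fnorm x <= fnorm (Y *m x).
  have h1 := fnorm_ge_sub (Y0 *m x) (Y *m x); apply: le_trans h1.
  have := anchor_X_ge x; rewrite fnorm_gram -mulmxBl.
  have h2 := fnormM (Y0 - Y) x.
  have := ler_wpM2r (fnorm_ge0 x) YY'; have := fnorm_ge0 x.
  move=> x0 h3 h4; move: {h2 h3 XG YY XG' YY'} (le_trans h2 h3) h4.
  have := mulr_ge0 (ltW p0) x0; rewrite -!mulrA {x0}.
  by do 3 move: (fnorm _) => ?; lra.
have Y_le (x : 'cV[C]_r) : fnorm (Y *m x) <= 2 * q * fnorm x.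
  have h1 := fnorm_subr (Y *m x) (Y0 *m x); rewrite -mulmxBl in h1.
  have := anchor_X_le x; rewrite fnorm_gram.
  have h2 := fnormM (Y - Y0) x; rewrite [fnorm (Y - Y0)]fnormBC in h2.
  move: (le_trans h1 (le_trans h2 (ler_wpM2r (fnorm_ge0 x) YY'))).
  have := mulr_ge0 (ltW p0) (fnorm_ge0 x).
  have := ler_wpM2r (fnorm_ge0 x) pq.
  move: {h1 h2 XG YY XG' YY'} (fnorm _) (fnorm _) (fnorm _) => y y0 z.
  by rewrite -!mulrA; move: (p * z) (q * z) => ? ?; lra.
by exists G, (V ^t* *m Y); rewrite VJ; split.
Qed.

End Recovery.

(** Here [h1], [h2] are the norms of a move, [P1], [P2] those of its gauge parts, [u1], [u2] those
    of the remainders, [t] that of the tangent vector. The linear loss forces [u1 + u2] below a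
    [25]th of [h1 + h2], so the gauge parts carry nearly all of the move; the quadratic terms are
    then of order [(h1 + h2)^2] against a gain linear in [h1 + h2]. *)
Lemma localization_arith (R : realType) (p e h1 h2 u1 u2 P1 P2 t Q1 Q2 : R) :
  0 <= e -> 64 * (64 * e) <= 1 ->
  0 < p -> 0 <= h1 -> 0 <= h2 -> 0 <= u1 -> 0 <= u2 -> 0 <= P1 -> 0 <= P2 ->
  h1 <= P1 + u1 -> h2 <= P2 + u2 ->
  7 / 10 * p * (7 / 10) * (u1 + u2) <= t ->
  16^-1 * t <= 4 * e * p * (h1 + h2) ->
  (1 - 50^-1) * P1 ^+ 2 - 2 * (1 + 50^-1) * (P1 * u1) <= Q1 ->
  (1 - 50^-1) * P2 ^+ 2 - 2 * (1 + 50^-1) * (P2 * u2) <= Q2 ->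
  2^-1 * Q1 + 2^-1 * Q2 <= 4 * e * p * (h1 + h2) ->
  h1 + h2 <= 32 * e * p.
Proof.
move=> e0 e1 p0 h10 h20 u10 u20 P10 P20 hP1 hP2 ut th.
have h0 : 0 <= h1 + h2 by rewrite addr_ge0.
have {ut th} u : u1 + u2 <= 25^-1 * (h1 + h2).
  rewrite -(ler_pM2l p0).
  move: ut th (ler_wpM2r (mulr_ge0 (ltW p0) h0) e1).
  have -> : 7 / 10 * p * (7 / 10) * (u1 + u2) = 49 / 100 * (p * (u1 + u2)) by field.
  rewrite -[4 * e * p * _]mulrA -[4 * e * _]mulrA [p * (_^-1 * _)]mulrCA.
  rewrite -[64 * (64 * e) * _]mulrA -[64 * e * _]mulrA.
  move: (p * (u1 + u2)) (p * (h1 + h2)) (mulr_ge0 (ltW p0) h0).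
  by move=> x y y0; move: (e * y) => *; lra.
have {hP1 hP2} P_ge : 96 / 100 * (h1 + h2) <= P1 + P2 by lra.
have P0 : 0 <= P1 + P2 by rewrite addr_ge0.
have Pu : P1 * u1 + P2 * u2 <= (P1 + P2) * (u1 + u2).
  rewrite mulrDr !mulrDl; move: (mulr_ge0 P10 u20) (mulr_ge0 P20 u10).
  by move: {u P_ge} (P1 * u1) (P1 * u2) (P2 * u1) (P2 * u2) => *; lra.
have PP : (P1 + P2) ^+ 2 <= 2 * (P1 ^+ 2 + P2 ^+ 2).
  by move: {Pu} (sqr_ge0 (P1 - P2)); lra.
have {Pu u} Puh := le_trans Pu (ler_wpM2l P0 u).
have PPh := ler_wpM2l P0 P_ge.
have {P_ge} Phh := ler_wpM2r h0 P_ge.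
have ep0 : 0 <= 32 * e * p by rewrite mulr_ge0 ?(ltW p0)// mulr_ge0.
have [h_le0 _ _ _|{}h0] := leP (h1 + h2) 0; first exact: le_trans h_le0 ep0.
move=> q1 q2 q; rewrite -(ler_pM2r h0); move: h0 q1 q2 q.
move: (P1 ^+ 2) (P2 ^+ 2) (P1 * u1) (P2 * u2) PP Puh PPh Phh.
rewrite expr2 !(mulrCA (P1 + P2)) -![_ * e * p * _]mulrA -![_ * e * _]mulrA.
rewrite -![96 / 100 * _ * _]mulrA.
have := mulr_ge0 P0 P0.
move: {h10 h20 P10 P20 P0 ep0} (h1 + h2) (P1 + P2) => h P P0 A B D E.
move: (e * (p * h)) (P * P) (P * h) (h * h) P0 => ph PP Ph hh PP0.
move=> {e0 e1} h1' h2' h3' h4' h0 q1 q2 q; lra.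
Qed.

Lemma subr_chain (V : zmodType) (x y z : V) : x - z = x - y - (z - y).
Proof. by rewrite opprB addrA subrK. Qed.

Lemma subr_addKr (V : zmodType) (x y z : V) : x - y = z - (y + z - x).
Proof. by rewrite opprB [RHS]addrC opprD addrA subrK. Qed.

(** Gain and loss are both linear in [h + k]: the slope of the gain is [39 * e * p], at most
    [39 / 4096 * p], below the slope [42 / 1600 * p] of the loss. Only [h + k = 0] remains. *)
Lemma recovery_arith (R : realType) (p e h k x y t m : R) :
  64 * (64 * e) <= 1 -> 0 < p -> 0 <= h + k ->
  x <= (36 * e + e * 3) * p * h -> y <= (36 * e + e * 3) * p * k ->
  6 / 10 * p * (7 / 10) * (h + k) <= t -> 16^-1 * t <= m ->
  0 <= x + y - m -> h + k <= 0.
Proof.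
move=> e1 p0 hk0 xh yk ht tm xym; rewrite -(pmulr_rle0 _ p0).
have := ler_wpM2r (mulr_ge0 (ltW p0) hk0) e1.
have h1 : x + y <= 39 * (e * (p * (h + k))).
  by apply: le_trans (lerD xh yk) _; apply: eq_ler; ring.
have h2 : 42 / 100 * (p * (h + k)) <= t.
  by apply: le_trans ht; apply: eq_ler; field.
rewrite -!mulrA; move: {ht xh yk hk0} h1 h2.
by move: (p * (h + k)) => w; move: (e * w) => z h1 h2 h3; lra.
Qed.

(** * Maximizers factor [M0] *)

Section Localization.
Variables (R : realType) (d1 d2 r n : nat).
Local Notation C := R[i].

#[local] Opaque real_inner cmod fnorm anchored_objective empirical_modulus
  empirical_covariance.

Variables (p q e : R).
Hypotheses (e_ge0 : 0 <= e) (e_small : 64 * (64 * e) <= 1).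
Hypotheses (p_gt0 : 0 < p) (p_le_q : p <= q).

Lemma small_ratio : e * (p / q) <= 50^-1.
Proof.
apply: (@le_trans _ _ e); last by move: e_small; lra.
by rewrite ler_piMr// ler_pdivrMr ?mul1r// (lt_le_trans p_gt0).
Qed.

Lemma move_small : 32 * e * p <= 128^-1 * p.
Proof. by rewrite ler_pM2r//; move: e_small; lra. Qed.

Lemma perturbation_small : 34 * e * p <= 100^-1 * p.
Proof. by rewrite ler_pM2r//; move: e_small; lra. Qed.

Variables (M0 : 'M[C]_(d1, d2)) (U : 'M[C]_(d1, r)) (V : 'M[C]_(d2, r)).
Variables (X0 : 'M[C]_(d1, r)) (Y0 : 'M[C]_(d2, r)).
Variables (a : 'I_n -> 'cV[C]_d1) (b : 'I_n -> 'cV[C]_d2).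
Hypotheses (UU : U ^t* *m U = 1%:M) (VV : V ^t* *m V = 1%:M).
Hypotheses (UM : U *m (U ^t* *m M0) = M0) (VM : V *m (V ^t* *m M0 ^t*) = M0 ^t*).
Hypothesis modulus_ge : forall (H : 'M[C]_(d1, r)) (K : 'M[C]_(d2, r)),
  16^-1 * fnorm (H *m V ^t* + U *m K ^t*) <=
  empirical_modulus a b (H *m V ^t* + U *m K ^t*).
Hypothesis covariance_a : forall B : 'M[C]_(d1, r),
  real_inner (empirical_covariance a *m U - U) B <= e * (p / q) * fnorm B.
Hypothesis covariance_b : forall B : 'M[C]_(d2, r),
  real_inner (empirical_covariance b *m V - V) B <= e * (p / q) * fnorm B.

Local Notation objective := (anchored_objective X0 Y0 a b
  (fun i => measurement M0 (a i) (b i))).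

(** All factorizations [(U G, V J)] share the tangent space of [M0], so a single event serves every
    one of them. *)
Lemma tangent_modulus_ge (G J : 'M[C]_r) (H : 'M[C]_(d1, r)) (K : 'M[C]_(d2, r)) :
  16^-1 * fnorm (H *m (V *m J) ^t* + (U *m G) *m K ^t*) <=
  empirical_modulus a b (H *m (V *m J) ^t* + (U *m G) *m K ^t*).
Proof.
have := modulus_ge (H *m J ^t*) (K *m G ^t*).
by rewrite !ctmxM trmxCK !mulmxA.
Qed.

(** The gradient splits into the distance of [W T] to the anchor and the covariance error applied to
    [T]. The latter is at most [e * (p / q)] times [k * q], and the accuracy [p / q] is chosen for
    this cancellation of [q]. *)
Lemma gradient_le m (v : 'I_n -> 'cV[C]_m) (W Z0 H : 'M[C]_(m, r)) (T : 'M[C]_r)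
    (c k : R) :
  W ^t* *m W = 1%:M ->
  (forall B : 'M[C]_(m, r),
    real_inner (empirical_covariance v *m W - W) B <= e * (p / q) * fnorm B) ->
  0 <= k ->
  (forall x : 'cV_r, fnorm (W *m T *m x) <= k * q * fnorm x) ->
  (forall B : 'M[C]_(m, r), real_inner (Z0 - W *m T) B <= c * p * fnorm B) ->
  real_inner (Z0 - empirical_covariance v *m (W *m T)) H <=
  (c + e * k) * p * fnorm H.
Proof.
move=> WW AW k0 WT Ze; have q0 : 0 < q := lt_le_trans p_gt0 p_le_q.
have -> : Z0 - empirical_covariance v *m (W *m T) =
    Z0 - W *m T - (empirical_covariance v *m W - W) *m T.
  rewrite mulmxBl -mulmxA; move: (W *m T) (_ *m _) => x y.
  by rewrite opprB addrA subrK.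
rewrite real_innerBl mulrDl mulrDl; apply: lerD => //.
rewrite -real_innerNr real_inner_mulr mulNmx real_innerNr -real_innerNl.
have HT : fnorm (H *m T ^t*) <= k * q * fnorm H.
  rewrite -fnorm_ct ctmxM trmxCK -(fnorm_ct H).
  apply: fnorm_mull_le; first by rewrite mulr_ge0// ltW.
  by move=> y; rewrite -(fnorm_isometry (T *m y) WW) mulmxA.
have := AW (- (H *m T ^t*)); rewrite real_innerNr fnormN -real_innerNl.
move=> /le_trans; apply.
have epq : 0 <= e * (p / q) by rewrite mulr_ge0// divr_ge0// ltW.
apply: le_trans (ler_wpM2l epq HT) _.
by apply: eq_ler; field; rewrite gt_eqF.
Qed.

Section Factors.
Variables (G J : 'M[C]_r).
Let X := U *m G.
Let Y := V *m J.
Hypothesis XY : X *m Y ^t* = M0.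
Hypothesis X_ge : forall x : 'cV_r, 7 / 10 * p * fnorm x <= fnorm (X *m x).
Hypothesis Y_ge : forall x : 'cV_r, 7 / 10 * p * fnorm x <= fnorm (Y *m x).
Hypothesis X_le : forall x : 'cV_r, fnorm (X *m x) <= 2 * q * fnorm x.
Hypothesis Y_le : forall x : 'cV_r, fnorm (Y *m x) <= 2 * q * fnorm x.
Hypothesis X0X : forall B : 'M[C]_(d1, r),
  real_inner (X0 - X) B <= 2 * e * p * fnorm B.
Hypothesis Y0Y : forall B : 'M[C]_(d2, r),
  real_inner (Y0 - Y) B <= 2 * e * p * fnorm B.

Lemma linear_term_le (H : 'M[C]_(d1, r)) (K : 'M[C]_(d2, r)) :
  real_inner (X0 - empirical_covariance a *m X) H
    + real_inner (Y0 - empirical_covariance b *m Y) K <=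
  4 * e * p * (fnorm H + fnorm K).
Proof.
rewrite mulrDr; have -> : 4 * e = 2 * e + e * 2 by ring.
apply: lerD.
  exact: (gradient_le H UU covariance_a (ler0n R 2) X_le X0X).
exact: (gradient_le K VV covariance_b (ler0n R 2) Y_le Y0Y).
Qed.

Lemma superlevel_tangent (H : 'M[C]_(d1, r)) (K : 'M[C]_(d2, r)) :
  objective X Y <= objective (X + H) (Y + K) ->
  16^-1 * fnorm (H *m Y ^t* + X *m K ^t*) <= 4 * e * p * (fnorm H + fnorm K).
Proof.
rewrite -subr_ge0 => f0; apply: le_trans (tangent_modulus_ge _ _ _ _) _.
have h1 := le_trans f0 (objective_diff_linear _ _ _ _ H K XY).
rewrite subr_ge0 in h1; exact: le_trans h1 (linear_term_le _ _).
Qed.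

(** Stated for the whole superlevel set and not only for maximizers, because it also supplies the
    compactness from which a maximizer is obtained. *)
Lemma superlevel_bounded (H : 'M[C]_(d1, r)) (K : 'M[C]_(d2, r)) :
  objective X Y <= objective (X + H) (Y + K) ->
  fnorm H + fnorm K <= 32 * e * p.
Proof.
move=> fXY; have htan := superlevel_tangent fXY.
have Gu : G \in unitmx.
  apply: (@bounded_below_unitmx _ _ _ (7 / 10 * p)) => [|x].
    by rewrite mulr_gt0// divr_gt0.
  by rewrite -(fnorm_isometry (G *m x) UU) mulmxA.
(* [X *m S] and [- Y *m S ^t*] are the gauge parts of the moves [H] and [K]. *)
set S := invmx G *m (U ^t* *m H).
set H' := H - U *m (U ^t* *m H); set K' := K + Y *m S ^t*.
have HE : H = X *m S + H'.
  by rewrite /X /S -mulmxA [G *m _]mulmxA mulmxV// mul1mx /H' addrC subrK.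
have KE : K = K' - Y *m S ^t* by rewrite /K' addrK.
have XH' : X ^t* *m H' = 0.
  rewrite /X ctmxM -mulmxA /H' mulmxBr; move: (U ^t* *m H) => x.
  by rewrite mulmxA UU mul1mx subrr mulmx0.
(* The two gauge parts contribute [X S Y^*] with opposite signs. *)
have tanE : H *m Y ^t* + X *m K ^t* = H' *m Y ^t* + X *m K' ^t*.
  rewrite {1}HE {1}KE mulmxDl ctmxB [(Y *m S ^t*) ^t*]ctmxM trmxCK mulmxBr.
  rewrite [X *m (S *m _)]mulmxA.
  move: (X *m S *m _) (H' *m _) (X *m K' ^t*) => x y z.
  by rewrite [LHS]addrC [x + y]addrC addrA addrAC subrK addrC.
have p0 : 0 <= 7 / 10 * p by rewrite mulr_ge0 ?divr_ge0// ltW.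
have htan' := fnorm_tangent_ge K' p0 XH' X_ge Y_ge.
rewrite tanE in htan.
have f0 : 0 <= objective (X + H) (Y + K) - objective X Y by rewrite subr_ge0.
have quad := le_trans f0 (objective_diff_quadratic _ _ _ _ H K XY).
have epq : 0 <= e * (p / q).
  by rewrite mulr_ge0// divr_ge0// ltW// (lt_le_trans p_gt0).
have cA : fnorm (empirical_covariance a *m U - U) <= 50^-1.
  by apply: le_trans small_ratio; apply/fnorm_dual.
have cB : fnorm (empirical_covariance b *m V - V) <= 50^-1.
  by apply: le_trans small_ratio; apply/fnorm_dual.
have qA := covariance_quadratic_ge (G *m S) H' UU cA.
have qB := covariance_quadratic_ge (- (J *m S ^t*)) K' VV cB.
rewrite mulmxA -/X -HE in qA.
rewrite mulmxN mulmxA -/Y [- _ + K']addrC -KE fnormN in qB.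
have lin := linear_term_le H K.
have H1 := fnormD (X *m S) H'; rewrite -HE in H1.
have K1 := fnormB K' (Y *m S ^t*); rewrite -KE in K1.
rewrite addrC in K1.
have quad' : 2^-1 * real_inner H (empirical_covariance a *m H) +
    2^-1 * real_inner K (empirical_covariance b *m K) <=
    4 * e * p * (fnorm H + fnorm K).
  by apply: le_trans lin; rewrite -subr_ge0 opprD addrA.
exact: (localization_arith e_ge0 e_small p_gt0 (fnorm_ge0 H) (fnorm_ge0 K)
  (fnorm_ge0 H') (fnorm_ge0 K') (fnorm_ge0 (X *m S)) (fnorm_ge0 (Y *m S ^t*))
  H1 K1 htan' htan qA qB quad').
Qed.

(** The linear comparison is made at [(X2, Y2)] instead of [(X, Y)], since only there the remaining
    move is free of gauge. For this [(X2, Y2)] must inherit, with worse constants, the bounds known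
    for [(X, Y)]; the delicate one is the distance of [Y2], which is defined through an inverse. *)
Lemma maximizer_factors (H : 'M[C]_(d1, r)) (K : 'M[C]_(d2, r)) :
  anchored_estimate X0 Y0 a b (fun i => measurement M0 (a i) (b i)) (X + H) (Y + K) ->
  (X + H) *m (Y + K) ^t* = M0.
Proof.
move=> est; have HK := superlevel_bounded (est X Y).
have HKt := superlevel_tangent (est X Y).
have ep := move_small.
have pe0 : 0 <= e * p by rewrite mulr_ge0// ltW.
have p0 := ltW p_gt0; have q0 := le_trans p0 p_le_q.
have H_le : fnorm H <= 32 * e * p by apply: le_trans HK; rewrite lerDl fnorm_ge0.
have K_le : fnorm K <= 32 * e * p by apply: le_trans HK; rewrite lerDr fnorm_ge0.
(* [(X2, Y2)] is the exact factorization whose first factor is the projection of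
   [X + H] on the column space of [M0]. *)
set G2 := U ^t* *m (X + H); set X2 := U *m G2.
have X2E : X2 = X + U *m (U ^t* *m H).
  by rewrite /X2 /G2 /X !mulmxDr [U ^t* *m (U *m _)]mulmxA UU mul1mx.
have UH : fnorm (U *m (U ^t* *m H)) <= 32 * e * p.
  rewrite (fnorm_isometry _ UU); exact: le_trans (fnorm_adj_isometry_le _ UU) H_le.
have X2X (x : 'cV[C]_r) : fnorm (X2 *m x - X *m x) <= 128^-1 * p * fnorm x.
  rewrite -mulmxBl X2E addrC addKr; apply: le_trans (fnormM _ _) _.
  by apply: ler_wpM2r (le_trans UH ep); exact: fnorm_ge0.
have X2_ge (x : 'cV[C]_r) : 6 / 10 * p * fnorm x <= fnorm (X2 *m x).
  have := fnorm_ge_sub (X *m x) (X2 *m x); rewrite fnormBC; apply: le_trans.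
  move: (X_ge x) (X2X x) (mulr_ge0 p0 (fnorm_ge0 x)).
  rewrite -![_ * p * _]mulrA; move: {UH HK HKt H_le K_le} (p * _).
  by do 2 move: (fnorm _); move=> *; lra.
have X2_le (x : 'cV[C]_r) : fnorm (X2 *m x) <= 3 * q * fnorm x.
  have := fnorm_subr (X2 *m x) (X *m x).
  move: (X_le x) (X2X x) (mulr_ge0 p0 (fnorm_ge0 x)) (ler_wpM2r (fnorm_ge0 x) p_le_q).
  rewrite -![_ * p * _]mulrA -![_ * q * _]mulrA.
  move: {UH HK HKt H_le K_le} (p * _) (q * _).
  by do 3 move: (fnorm _); move=> *; lra.
have G2u : G2 \in unitmx.
  apply: (@bounded_below_unitmx _ _ _ (6 / 10 * p)) => [|x].
    by rewrite mulr_gt0// divr_gt0.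
  by rewrite -(fnorm_isometry (G2 *m x) UU) mulmxA.
set Y2 := M0 ^t* *m (U *m (invmx G2) ^t*).
have VJ2 : V *m (V ^t* *m Y2) = Y2.
  by rewrite /Y2 [V ^t* *m _]mulmxA [V *m _]mulmxA VM.
have XY2 : X2 *m Y2 ^t* = M0.
  rewrite /Y2 [(M0 ^t* *m _) ^t*]ctmxM [(U *m _) ^t*]ctmxM !trmxCK /X2.
  by rewrite -[U *m G2 *m _]mulmxA [G2 *m _]mulmxA [G2 *m _]mulmxA mulmxV// mul1mx UM.
set H2 := X + H - X2; set K2 := Y + K - Y2.
have XH2 : X2 ^t* *m H2 = 0.
  rewrite /X2 [(U *m G2) ^t*]ctmxM -mulmxA /H2 mulmxBr [U ^t* *m X2]mulmxA UU.
  by rewrite mul1mx subrr mulmx0.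
(* [X2 K2^*] is the projected error of the product [(X + H) (Y + K)^*]. That error is of second
   order: at most [2048 + 1024] times [(e p)^2], hence at most [3 / 4 * e * p^2]. Dividing by the
   lower bound of [X2] costs one factor [p]. *)
have K2_le : fnorm K2 <= 2 * e * p.
  have K2t : fnorm K2 * (6 / 10 * p) <= fnorm (X2 *m K2 ^t*).
    rewrite mulrC -(fnorm_ct K2); apply: fnorm_mull_ge X2_ge.
    by rewrite mulr_ge0 ?divr_ge0.
  have XK2 : X2 *m K2 ^t* =
      U *m (U ^t* *m (H *m Y ^t* + X *m K ^t* + H *m K ^t*)).
    have -> : H *m Y ^t* + X *m K ^t* + H *m K ^t* =
        (X + H) *m (Y + K) ^t* - M0.
      rewrite ctmxD mulmxDl !mulmxDr XY.
      move: (H *m Y ^t*) (X *m K ^t*) (H *m K ^t*) => x y z.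
      by rewrite [RHS]addrAC [M0 + _]addrC addrK addrA [y + x]addrC.
    rewrite /K2 ctmxB mulmxBr XY2 2!mulmxBr UM; congr (_ - _).
    by rewrite /X2 /G2 -!mulmxA.
  have : fnorm (X2 *m K2 ^t*) <= 3 / 4 * (e * p ^+ 2).
    rewrite XK2 (fnorm_isometry _ UU).
    apply: le_trans (fnorm_adj_isometry_le _ UU) _.
    apply: le_trans (fnormD _ _) _.
    have HKm : fnorm (H *m K ^t*) <= 32 * e * p * (32 * e * p).
      apply: le_trans (fnormM _ _) _; rewrite fnorm_ct.
      by apply: ler_pM; rewrite ?fnorm_ge0.
    have HKt' : fnorm (H *m Y ^t* + X *m K ^t*) <= 64 * (e * p) * (32 * (e * p)).
      have ep0 : 0 <= 4 * (e * p) by rewrite mulr_ge0.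
      have := ler_wpM2l ep0 HK; move: HKt; rewrite -![_ * e * p]mulrA.
      by move: {HK H_le K_le UH HKm} (fnorm (_ + _)) (_ * (_ + _)) => *; lra.
    have epp := ler_wpM2r (mulr_ge0 e_ge0 (sqr_ge0 p)) e_small.
    apply: le_trans (lerD HKt' HKm) _; move: epp; rewrite expr2.
    by move=> {UH HKt HKt' HKm HK H_le K_le K2t} epp; lra.
  move=> /(le_trans K2t) h; rewrite -(ler_pM2r p_gt0).
  move: h (mulr_ge0 e_ge0 (sqr_ge0 p)); rewrite expr2.
  by move: {UH HKt HK H_le K_le K2t} (fnorm K2) => *; lra.
have Y2E : Y2 - Y = K - K2.
  exact: subr_addKr.
have Y2Y : fnorm (Y2 - Y) <= 34 * e * p.
  rewrite Y2E; apply: le_trans (fnormB _ _) _.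
  by apply: le_trans (lerD K_le K2_le) _; apply: eq_ler; ring.
have Y2Y' (x : 'cV[C]_r) : fnorm (Y2 *m x - Y *m x) <= 100^-1 * p * fnorm x.
  rewrite -mulmxBl; apply: le_trans (fnormM _ _) _; apply: ler_wpM2r.
    exact: fnorm_ge0.
  by apply: le_trans Y2Y _; exact: perturbation_small.
have Y2_ge (x : 'cV[C]_r) : 6 / 10 * p * fnorm x <= fnorm (Y2 *m x).
  have := fnorm_ge_sub (Y *m x) (Y2 *m x); rewrite fnormBC; apply: le_trans.
  move: (Y_ge x) (Y2Y' x) (mulr_ge0 p0 (fnorm_ge0 x)).
  rewrite -![_ * p * _]mulrA; move: {UH HK HKt H_le K_le K2_le Y2Y} (p * _).
  by do 2 move: (fnorm _); move=> *; lra.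
have Y2_le (x : 'cV[C]_r) : fnorm (Y2 *m x) <= 3 * q * fnorm x.
  have := fnorm_subr (Y2 *m x) (Y *m x).
  move: (Y_le x) (Y2Y' x) (mulr_ge0 p0 (fnorm_ge0 x)) (ler_wpM2r (fnorm_ge0 x) p_le_q).
  rewrite -![_ * p * _]mulrA -![_ * q * _]mulrA.
  move: {UH HK HKt H_le K_le K2_le Y2Y} (p * _) (q * _).
  by do 3 move: (fnorm _); move=> *; lra.
(* The distance [2 * e * p] from the anchor to [(X, Y)] is increased by [32 * e * p] here, and by
   [34 * e * p] for the second factor; [36] covers both. *)
have X0X2 B : real_inner (X0 - U *m G2) B <= 36 * e * p * fnorm B.
  have -> : X0 - U *m G2 = X0 - X - (X2 - X) by exact: subr_chain.
  rewrite real_innerBl -real_innerNr.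
  have := real_inner_le (X2 - X) (- B); rewrite fnormN X2E [X + _ - X]addrAC subrr add0r.
  move=> h; apply: le_trans (lerD (X0X B) (le_trans h (ler_wpM2r (fnorm_ge0 B) UH))) _.
  rewrite -!mulrA; have := mulr_ge0 pe0 (fnorm_ge0 B); rewrite -mulrA.
  by move: {h UH HK HKt H_le K_le K2_le Y2Y} (e * _) => *; lra.
have Y0Y2 B : real_inner (Y0 - V *m (V ^t* *m Y2)) B <= 36 * e * p * fnorm B.
  rewrite VJ2 (subr_chain Y0 Y Y2).
  rewrite real_innerBl -real_innerNr.
  have := real_inner_le (Y2 - Y) (- B); rewrite fnormN.
  move=> h; apply: le_trans (lerD (Y0Y B) (le_trans h (ler_wpM2r (fnorm_ge0 B) Y2Y))) _.
  by apply: eq_ler; rewrite -!mulrA; move: (e * _) => ?; ring.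
have lX := gradient_le H2 UU covariance_a (ler0n R 3) X2_le X0X2.
have Y2_le' (x : 'cV[C]_r) : fnorm (V *m (V ^t* *m Y2) *m x) <= 3 * q * fnorm x.
  by rewrite VJ2.
have lY := gradient_le K2 VV covariance_b (ler0n R 3) Y2_le' Y0Y2.
have XHE : X + H = X2 + H2 by rewrite /H2 [RHS]addrC subrK.
have YKE : Y + K = Y2 + K2 by rewrite /K2 [RHS]addrC subrK.
have := est X2 Y2; rewrite XHE YKE -subr_ge0 => f0.
have h1 := le_trans f0 (objective_diff_linear _ _ _ _ H2 K2 XY2).
have h2 := tangent_modulus_ge G2 (V ^t* *m Y2) H2 K2; rewrite VJ2 in h2 lY.
have p60 : 0 <= 6 / 10 * p by rewrite mulr_ge0 ?divr_ge0.
have h3 := fnorm_tangent_ge K2 p60 XH2 X2_ge Y2_ge.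
have small : fnorm H2 + fnorm K2 <= 0.
  exact: (recovery_arith e_small p_gt0 (addr_ge0 (fnorm_ge0 H2) (fnorm_ge0 K2))
    lX lY h3 h2 h1).
have H20 : fnorm H2 = 0.
  by apply/eqP; rewrite eq_le fnorm_ge0 (le_trans _ small)// lerDl fnorm_ge0.
have K20 : fnorm K2 = 0.
  by apply/eqP; rewrite eq_le fnorm_ge0 (le_trans _ small)// lerDr fnorm_ge0.
by rewrite (fnorm_eq0 H20) (fnorm_eq0 K20) !addr0.
Qed.

End Factors.
End Localization.

(** * Continuity of the objective *)

Section MatrixContinuity.
Import numFieldNormedType.Exports.
Variables (R : realType) (T : topologicalType).
Local Notation C := R[i].

Lemma continuous_real_add (f g : T -> R) :
  continuous f -> continuous g -> continuous (fun x => f x + g x).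
Proof. by move=> fc gc x; apply: cvgD; [exact: fc | exact: gc]. Qed.

Lemma continuous_real_opp (f : T -> R) :
  continuous f -> continuous (fun x => - f x).
Proof. by move=> fc x; apply: cvgN; exact: fc. Qed.

Lemma continuous_real_mul (f g : T -> R) :
  continuous f -> continuous g -> continuous (fun x => f x * g x).
Proof. by move=> fc gc x; apply: cvgM; [exact: fc | exact: gc]. Qed.

Lemma continuous_real_sum (I : Type) (s : seq I) (f : I -> T -> R) :
  (forall i, continuous (f i)) -> continuous (fun x => \sum_(i <- s) f i x).
Proof.
move=> fc; elim: s => [|i s IHs].
  by under eq_fun do rewrite big_nil; exact: cst_continuous.
by under eq_fun do rewrite big_cons; exact: continuous_real_add.
Qed.

Lemma continuous_real_sqrt (f : T -> R) :
  continuous f -> continuous (fun x => Num.sqrt (f x)).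
Proof. by move=> fc x; apply: continuous_comp; [exact: fc | exact: sqrt_continuous]. Qed.

(** Expressed through real and imaginary parts, so that only the topology of the reals is
    involved. *)
Definition complex_continuous (f : T -> C) :=
  continuous (fun x => complex.Re (f x)) /\ continuous (fun x => complex.Im (f x)).

Lemma complex_continuous_cst (z : C) : complex_continuous (fun=> z).
Proof. by split; exact: cst_continuous. Qed.

Lemma complex_continuousD (f g : T -> C) : complex_continuous f ->
  complex_continuous g -> complex_continuous (fun x => f x + g x).
Proof.
move=> [fr fi] [gr gi]; split.
  by under eq_fun do rewrite cReD; exact: continuous_real_add.
by under eq_fun do rewrite cImD; exact: continuous_real_add.
Qed.

Lemma complex_continuous_conj (f : T -> C) : complex_continuous f ->
  complex_continuous (fun x => Num.conj (f x)).
Proof.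
move=> [fr fi]; split.
  by under eq_fun do rewrite cRe_conj.
by under eq_fun do rewrite cIm_conj; exact: continuous_real_opp.
Qed.

Lemma complex_continuousM (f g : T -> C) : complex_continuous f ->
  complex_continuous g -> complex_continuous (fun x => f x * g x).
Proof.
move=> [fr fi] [gr gi]; split.
  under eq_fun do rewrite cReM; apply: continuous_real_add.
    exact: continuous_real_mul.
  by apply: continuous_real_opp; exact: continuous_real_mul.
by under eq_fun do rewrite cImM; apply: continuous_real_add; exact: continuous_real_mul.
Qed.

Lemma complex_continuous_sum (I : Type) (s : seq I) (f : I -> T -> C) :
  (forall i, complex_continuous (f i)) ->
  complex_continuous (fun x => \sum_(i <- s) f i x).
Proof.
move=> fc; elim: s => [|i s IHs].
  by under eq_fun do rewrite big_nil; exact: complex_continuous_cst.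
by under eq_fun do rewrite big_cons; exact: complex_continuousD.
Qed.

Lemma continuous_cmod (f : T -> C) : complex_continuous f ->
  continuous (fun x => cmod (f x)).
Proof.
move=> [fr fi]; under eq_fun do rewrite cmodEsqrt.
by apply: continuous_real_sqrt; apply: continuous_real_add;
  under eq_fun do rewrite expr2; exact: continuous_real_mul.
Qed.

Definition mx_continuous m n (F : T -> 'M[C]_(m, n)) :=
  forall i j, complex_continuous (fun x => F x i j).

Lemma mx_continuous_cst m n (A : 'M[C]_(m, n)) : mx_continuous (fun=> A).
Proof. by move=> i j; exact: complex_continuous_cst. Qed.

Lemma mx_continuousD m n (F G : T -> 'M[C]_(m, n)) :
  mx_continuous F -> mx_continuous G -> mx_continuous (fun x => F x + G x).
Proof.
move=> Fc Gc i j; under eq_fun do rewrite mxE.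
by apply: complex_continuousD; [exact: Fc | exact: Gc].
Qed.

Lemma mx_continuousM m n k (F : T -> 'M[C]_(m, n)) (G : T -> 'M[C]_(n, k)) :
  mx_continuous F -> mx_continuous G -> mx_continuous (fun x => F x *m G x).
Proof.
move=> Fc Gc i j; under eq_fun do rewrite mxE.
by apply: complex_continuous_sum => l; exact: complex_continuousM.
Qed.

Lemma mx_continuous_ct m n (F : T -> 'M[C]_(m, n)) :
  mx_continuous F -> mx_continuous (fun x => (F x) ^t*).
Proof.
by move=> Fc i j; under eq_fun do rewrite 2!mxE; exact: complex_continuous_conj.
Qed.

Lemma continuous_real_inner m n (F G : T -> 'M[C]_(m, n)) :
  mx_continuous F -> mx_continuous G -> continuous (fun x => real_inner (F x) (G x)).
Proof.
move=> Fc Gc; rewrite /real_inner /mxtrace.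
have [] // : complex_continuous (fun x => \sum_i ((F x) ^t* *m G x) i i).
apply: complex_continuous_sum => i.
by apply: mx_continuousM => //; exact: mx_continuous_ct.
Qed.

Lemma continuous_objective (d1 d2 r n : nat) (X0 : 'M[C]_(d1, r))
    (Y0 : 'M[C]_(d2, r)) (a : 'I_n -> 'cV[C]_d1) (b : 'I_n -> 'cV[C]_d2)
    (m : 'I_n -> C) (F : T -> 'M[C]_(d1, r)) (G : T -> 'M[C]_(d2, r)) :
  mx_continuous F -> mx_continuous G ->
  continuous (fun x => anchored_objective X0 Y0 a b m (F x) (G x)).
Proof.
move=> Fc Gc; rewrite /anchored_objective.
apply: continuous_real_add.
  by apply: continuous_real_add; apply: continuous_real_inner => //;
    exact: mx_continuous_cst.
apply: continuous_real_opp; apply: continuous_real_mul; first exact: cst_continuous.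
apply: continuous_real_sum => i; rewrite /loss.
apply: continuous_real_add; first apply: continuous_real_add.
- apply: continuous_real_mul; first exact: cst_continuous.
  under eq_fun do rewrite vec_normE sqr_fnorm.
  by apply: continuous_real_inner; apply: mx_continuousM (mx_continuous_ct Fc) _;
    exact: mx_continuous_cst.
- apply: continuous_real_mul; first exact: cst_continuous.
  under eq_fun do rewrite vec_normE sqr_fnorm.
  by apply: continuous_real_inner; apply: mx_continuousM (mx_continuous_ct Gc) _;
    exact: mx_continuous_cst.
apply: continuous_cmod; apply: complex_continuousD; last exact: complex_continuous_cst.
rewrite /measurement; apply: mx_continuousM; last exact: mx_continuous_cst.
apply: mx_continuousM; first exact: mx_continuous_cst.
by apply: mx_continuousM => //; exact: mx_continuous_ct.
Qed.

End MatrixContinuity.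

(** * Existence of a maximizer *)

Section Existence.
Import numFieldNormedType.Exports.
Variables (R : realType) (d1 d2 r : nat).
Local Notation C := R[i].

(** Real coordinates of a pair of factors: the boolean selects the imaginary part, the sum selects
    the factor. A pair becomes one real row vector, to which the extreme value theorem on a compact
    box applies. *)
Let index : finType := (bool * ('I_d1 * 'I_r + 'I_d2 * 'I_r))%type.

Let left_factor (z : 'rV[R]_#|index|) : 'M[C]_(d1, r) :=
  \matrix_(i, k) (z 0 (enum_rank ((false, inl (i, k)) : index))
    +i* z 0 (enum_rank ((true, inl (i, k)) : index))).

Let right_factor (z : 'rV[R]_#|index|) : 'M[C]_(d2, r) :=
  \matrix_(i, k) (z 0 (enum_rank ((false, inr (i, k)) : index))
    +i* z 0 (enum_rank ((true, inr (i, k)) : index))).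

Let coordinates (X : 'M[C]_(d1, r)) (Y : 'M[C]_(d2, r)) : 'rV[R]_#|index| :=
  \row_l match (enum_val l : index) with
    | (false, inl (i, k)) => complex.Re (X i k)
    | (true, inl (i, k)) => complex.Im (X i k)
    | (false, inr (i, k)) => complex.Re (Y i k)
    | (true, inr (i, k)) => complex.Im (Y i k)
    end.

Let coordinatesK X Y : left_factor (coordinates X Y) = X /\
  right_factor (coordinates X Y) = Y.
Proof.
split; apply/matrixP => i k; rewrite !mxE !enum_rankK;
  by [case: (X i k) | case: (Y i k)].
Qed.

Lemma cmod_entry_le m n (A : 'M[C]_(m, n)) i j : cmod (A i j) <= fnorm A.
Proof.
apply: sqr_le; first exact: fnorm_ge0.
rewrite sqr_fnorm real_innerE (bigD1 i)//= (bigD1 j)//= sqr_cmod !expr2 -addrA.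
rewrite lerDl addr_ge0//; first by apply: sumr_ge0 => ? _; rewrite -!expr2 addr_ge0 ?sqr_ge0.
by do 2 (apply: sumr_ge0 => ? _); rewrite -!expr2 addr_ge0 ?sqr_ge0.
Qed.

Lemma Re_le_cmod (z : C) : `|complex.Re z| <= cmod z.
Proof. by rewrite cmodEsqrt -sqrtr_sqr ler_wsqrtr// lerDl sqr_ge0. Qed.

Lemma Im_le_cmod (z : C) : `|complex.Im z| <= cmod z.
Proof. by rewrite cmodEsqrt -sqrtr_sqr ler_wsqrtr// lerDr sqr_ge0. Qed.

Lemma anchored_estimate_exists (n : nat) (X0 : 'M[C]_(d1, r))
    (Y0 : 'M[C]_(d2, r)) (a : 'I_n -> 'cV[C]_d1) (b : 'I_n -> 'cV[C]_d2)
    (m : 'I_n -> C) (X : 'M[C]_(d1, r)) (Y : 'M[C]_(d2, r)) (rho : R) :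
  (forall H K, anchored_objective X0 Y0 a b m X Y <=
    anchored_objective X0 Y0 a b m (X + H) (Y + K) ->
    fnorm H + fnorm K <= rho) ->
  exists X' Y', anchored_estimate X0 Y0 a b m X' Y'.
Proof.
move=> bound.
set f := fun z => anchored_objective X0 Y0 a b m (X + left_factor z) (Y + right_factor z).
pose box : set 'rV[R]_#|index| := [set v | forall i, `[- rho, rho]%classic (v ord0 i)].
have boxc : compact box.
  by apply: (@rV_compact R _ (fun=> `[- rho, rho]%classic)) => i; exact: segment_compact.
have sup_box H K : anchored_objective X0 Y0 a b m X Y <=
    anchored_objective X0 Y0 a b m (X + H) (Y + K) -> box (coordinates H K).
  move=> /bound HK l; rewrite /= in_itv /= -ler_norml mxE.
  have HX i k : cmod (H i k) <= rho.
    by apply: le_trans (cmod_entry_le _ _ _) (le_trans _ HK); rewrite lerDl fnorm_ge0.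
  have KX i k : cmod (K i k) <= rho.
    by apply: le_trans (cmod_entry_le _ _ _) (le_trans _ HK); rewrite lerDr fnorm_ge0.
  case: (enum_val l) => [[] [[i k]|[i k]]].
  - exact: le_trans (Im_le_cmod _) (HX _ _).
  - exact: le_trans (Im_le_cmod _) (KX _ _).
  - exact: le_trans (Re_le_cmod _) (HX _ _).
  - exact: le_trans (Re_le_cmod _) (KX _ _).
have box0 : box (coordinates 0 0) by apply: sup_box; rewrite !addr0.
have coord_cont i : continuous (fun z : 'rV[R]_#|index| => z 0 i) by exact: coord_continuous.
have fc : continuous f.
  by apply: continuous_objective; apply: mx_continuousD;
    (try exact: mx_continuous_cst) => i k; split;
    under eq_fun do rewrite mxE; exact: coord_cont.
have [c cbox cmax] := EVT_max_rV (ex_intro _ _ box0) boxc (continuous_subspaceT fc).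
exists (X + left_factor c), (Y + right_factor c) => X' Y'.
have fE H K : f (coordinates H K) = anchored_objective X0 Y0 a b m (X + H) (Y + K).
  by rewrite /f; have [-> ->] := coordinatesK H K.
have X'E : X' = X + (X' - X) by rewrite addrC subrK.
have Y'E : Y' = Y + (Y' - Y) by rewrite addrC subrK.
(* The box contains the base point and the whole superlevel set, so its maximum also beats every
   point outside it. *)
have /orP[le_base|gt_base] := le_total (anchored_objective X0 Y0 a b m X' Y')
    (anchored_objective X0 Y0 a b m X Y).
  apply: le_trans le_base _; have := cmax _ (mem_set box0).
  by rewrite fE !addr0.
rewrite [in leLHS]X'E [in leLHS]Y'E -fE; apply/cmax/mem_set/sup_box.
by rewrite -X'E -Y'E.
Qed.

End Existence.

(** * Exact recovery on the good event *)

Section DeterministicRecovery.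
Variables (R : realType) (d1 d2 r n : nat).
Local Notation C := R[i].

#[local] Opaque real_inner cmod fnorm anchored_objective empirical_modulus
  empirical_covariance.

Lemma deterministic_recovery (M0 : 'M[C]_(d1, d2)) (U : 'M[C]_(d1, r))
    (V : 'M[C]_(d2, r)) (X0 : 'M[C]_(d1, r)) (Y0 : 'M[C]_(d2, r))
    (a : 'I_n -> 'cV[C]_d1) (b : 'I_n -> 'cV[C]_d2) (p q tau e : R) :
  0 <= e -> 64 * (64 * e) <= 1 -> 0 < p -> p <= q ->
  U ^t* *m U = 1%:M -> V ^t* *m V = 1%:M ->
  U *m (U ^t* *m M0) = M0 -> V *m (V ^t* *m M0 ^t*) = M0 ^t* ->
  (forall y : 'cV_r, p ^+ 2 * fnorm y <= fnorm (M0 *m (V *m y))) ->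
  (forall x : 'cV_d2, fnorm (M0 *m x) <= q ^+ 2 * fnorm x) ->
  X0 ^t* *m X0 = Y0 ^t* *m Y0 ->
  0 <= tau ->
  (forall x : 'cV_d2, fnorm ((X0 *m Y0 ^t* - M0) *m x) <= tau * fnorm x) ->
  tau * Num.sqrt r%:R * q ^+ 2 <= e * (p ^+ 2 * p ^+ 2) ->
  (0 < r)%N ->
  (forall (H : 'M[C]_(d1, r)) (K : 'M[C]_(d2, r)),
    16^-1 * fnorm (H *m V ^t* + U *m K ^t*) <=
    empirical_modulus a b (H *m V ^t* + U *m K ^t*)) ->
  fnorm (empirical_covariance a *m U - U) <= e * (p / q) ->
  fnorm (empirical_covariance b *m V - V) <= e * (p / q) ->
  exactly_recovers X0 Y0 a b (fun i => measurement M0 (a i) (b i)) M0.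
Proof.
move=> e0 e1 p0 pq UU VV UM VM M0_ge M0_le gram tau0 anchor tau_le r0 Z_ge cA cB.
have epq : 0 <= e * (p / q) by rewrite mulr_ge0// divr_ge0 ?(ltW (lt_le_trans p0 pq))// ltW.
have [G [J [XY X_ge Y_ge [X_le Y_le XX YY]]]] := anchored_factors e0 e1 p0 pq UU VV
  UM VM M0_ge M0_le gram tau0 anchor tau_le r0.
have ep : 0 <= 2 * e * p by rewrite mulr_ge0 ?(ltW p0)// mulr_ge0.
have XX' := (fnorm_dual _ ep).2 XX; have YY' := (fnorm_dual _ ep).2 YY.
have cA' := (fnorm_dual _ epq).2 cA; have cB' := (fnorm_dual _ epq).2 cB.
split=> [|X' Y'].
  apply: (anchored_estimate_exists (X := U *m G) (Y := V *m J)) => H K.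
  exact: (superlevel_bounded e0 e1 p0 pq UU VV Z_ge cA' cB' XY X_ge Y_ge X_le Y_le XX' YY').
have -> : X' = U *m G + (X' - U *m G) by rewrite [RHS]addrC subrK.
have -> : Y' = V *m J + (Y' - V *m J) by rewrite [RHS]addrC subrK.
exact: (maximizer_factors e0 e1 p0 pq UU VV UM VM Z_ge cA' cB' XY X_ge Y_ge X_le Y_le XX' YY').
Qed.

End DeterministicRecovery.

(** * Singular values *)

Section SingularValues.
Variable R : realType.
Local Notation C := R[i].

#[local] Opaque real_inner cmod fnorm.

(** Gram-Schmidt on a row basis of [A^*], conjugated back. The factorization [U = A B] is kept
    because, for [A = M0^*], it places the basis in the range of [M0^*], where [M0] is bounded
    below. *)
Lemma orthonormal_column_basis m n r (A : 'M[C]_(m, n)) : \rank A = r ->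
  exists U : 'M[C]_(m, r), [/\ U ^t* *m U = 1%:M, U *m (U ^t* *m A) = A &
    exists B : 'M[C]_(n, r), U = A *m B].
Proof.
have -> : \rank A = \rank (A ^t*) by rewrite mxrank_map mxrank_tr.
move=> <-; have aux k (W : 'M[C]_(k, m)) : W *m W ^t* = 1%:M -> (W :=: A ^t*)%MS ->
    exists U : 'M[C]_(m, k), [/\ U ^t* *m U = 1%:M, U *m (U ^t* *m A) = A &
      exists B : 'M[C]_(n, k), U = A *m B].
  move=> WW WA; exists (W ^t*); split.
  - by rewrite trmxCK.
  - have /submxP[D AD] : (A ^t* <= W)%MS by rewrite WA.
    have AE : A = W ^t* *m D ^t* by rewrite -ctmxM -AD trmxCK.
    by rewrite trmxCK AE [W *m (_ *m _)]mulmxA WW mul1mx.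
  have /submxP[D WD] : (W <= A ^t*)%MS by rewrite WA.
  by exists (D ^t*); rewrite WD ctmxM trmxCK.
apply: (aux _ (schmidt (row_base (A ^t*)))).
  by apply/unitarymxP; rewrite schmidt_unitarymx// rank_leq_col.
exact: eqmx_trans (eqmx_schmidt_free (row_base_free _)) (eq_row_base _).
Qed.

Lemma spectral_norm_bounded m n (A : 'M[C]_(m, n)) :
  ubound [set vec_norm (A *m x) | x in [set x | vec_norm x <= 1]] (fnorm A).
Proof.
move=> _ [x /= x1 <-]; rewrite vec_normE in x1; rewrite vec_normE.
apply: le_trans (fnormM _ _) _; rewrite -[leRHS]mulr1.
by apply: ler_wpM2l x1; exact: fnorm_ge0.
Qed.

Lemma spectral_norm_mul m n (A : 'M[C]_(m, n)) (x : 'cV[C]_n) :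
  fnorm (A *m x) <= spectral_norm A * fnorm x.
Proof.
have [/fnorm_eq0 ->|x0] := eqVneq (fnorm x) 0.
  by rewrite mulmx0 !fnorm0 mulr0.
have xp : 0 < fnorm x by rewrite lt_neqAle eq_sym x0 fnorm_ge0.
have inv0 : 0 <= (fnorm x)^-1 by rewrite invr_ge0 ltW.
rewrite -ler_pdivrMr// mulrC.
have -> : (fnorm x)^-1 * fnorm (A *m x) = fnorm (A *m (((fnorm x)^-1)%:C *: x)).
  by rewrite -scalemxAr fnormZ ger0_norm.
rewrite -vec_normE; apply: ub_le_sup; first by exists (fnorm A); exact: spectral_norm_bounded.
exists (((fnorm x)^-1)%:C *: x) => //=.
by rewrite vec_normE fnormZ ger0_norm// mulVf.
Qed.

Lemma spectral_norm_le m n (A : 'M[C]_(m, n)) (t : R) : 0 <= t ->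
  (forall x : 'cV_n, fnorm (A *m x) <= t * fnorm x) -> spectral_norm A <= t.
Proof.
move=> t0 At; apply: ge_sup => [|_ [x /= x1 <-]].
  by exists (vec_norm (A *m 0)), 0 => //=; rewrite vec_normE fnorm0.
rewrite vec_normE in x1; rewrite vec_normE; apply: le_trans (At x) _.
by rewrite -[leRHS]mulr1 ler_wpM2l.
Qed.

Lemma spectral_norm_ge0 m n (A : 'M[C]_(m, n)) : 0 <= spectral_norm A.
Proof.
apply: le_trans (_ : vec_norm (A *m 0) <= _); first by rewrite vec_normE fnorm_ge0.
apply: ub_le_sup; first by exists (fnorm A); exact: spectral_norm_bounded.
by exists 0 => //=; rewrite vec_normE fnorm0.
Qed.

Section Gram.
Variables (m n : nat) (A : 'M[C]_(m, n)).
Let P := spectralmx (A ^t* *m A).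
(** The singular values of [A], zeros included: in the eigenbasis of the Gram matrix the columns of
    [A P^*] are orthogonal, and their squared lengths are the eigenvalues. *)
Let ell k : R := fnorm (col k (A *m P ^t*)).

Let PP : P *m P ^t* = 1%:M.
Proof. by apply/unitarymxP; exact: spectral_unitarymx. Qed.

Let PPV : P ^t* *m P = 1%:M.
Proof. exact: mulmx1C PP. Qed.

Let gramE : P *m (A ^t* *m A) *m P ^t* = diag_mx (spectral_diag (A ^t* *m A)).
Proof.
have /orthomx_spectralP {1}-> : A ^t* *m A \is normalmx.
  apply/hermitian_normalmx/is_hermitianmxP.
  by rewrite expr0 scale1r ctmxM trmxCK.
rewrite -/P invmx_unitary ?spectral_unitarymx// -!mulmxA PP mulmx1.
by rewrite mulmxA PP mul1mx.
Qed.

Let diagE k : spectral_diag (A ^t* *m A) 0 k = (ell k ^+ 2)%:C.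
Proof.
have -> : spectral_diag (A ^t* *m A) 0 k =
    (P *m (A ^t* *m A) *m P ^t*) k k by rewrite gramE mxE eqxx mulr1n.
have -> : P *m (A ^t* *m A) *m P ^t* = (A *m P ^t*) ^t* *m (A *m P ^t*).
  by rewrite ctmxM trmxCK !mulmxA.
rewrite mxE /ell sqr_fnorm real_innerE rmorph_sum /=; apply: eq_bigr => i _.
rewrite big_ord1 !mxE -!expr2 -sqr_cmod sqr_cmodC mulrC; congr (_ * _).
Qed.

Let sum_sqr (x : 'cV[C]_n) :
  fnorm (A *m x) ^+ 2 = \sum_k ell k ^+ 2 * cmod ((P *m x) k 0) ^+ 2.
Proof.
have -> : A *m x = (A *m P ^t*) *m (P *m x).
  by rewrite -[RHS]mulmxA [P ^t* *m _]mulmxA PPV mul1mx.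
rewrite (sqr_fnorm (A *m P ^t* *m (P *m x))) (real_inner_mull (A *m P ^t*) (P *m x)).
have -> : (A *m P ^t*) ^t* *m (A *m P ^t* *m (P *m x)) =
    diag_mx (spectral_diag (A ^t* *m A)) *m (P *m x).
  by rewrite ctmxM trmxCK -gramE !mulmxA.
rewrite real_innerE; apply: eq_bigr => k _.
rewrite big_ord1 mul_diag_mx ![(\matrix_(_, _) _) _ _]mxE diagE cReM cImM.
by rewrite sqr_cmod /=; ring.
Qed.

Let sum_cmod (x : 'cV[C]_n) : fnorm x ^+ 2 = \sum_k cmod ((P *m x) k 0) ^+ 2.
Proof.
have -> : fnorm x = fnorm (P *m x).
  by rewrite -[in LHS](mul1mx x) -PPV -mulmxA (fnorm_isometry (P *m x))// trmxCK.
rewrite sqr_fnorm real_innerE; apply: eq_bigr => k _.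
by rewrite big_ord1 sqr_cmod !expr2.
Qed.

Let svalE s : nonzero_singular_values A s <-> 0 < s /\ exists k, s = ell k.
Proof.
split=> -[s0]; last first.
  move=> [k sk]; split=> //; apply/eigenvalueP; exists (row k P); last first.
    apply/eqP => /(congr1 (mulmx^~ (P ^t*))); rewrite mul0mx -row_mul PP => /rowP/(_ k).
    by rewrite !mxE eqxx => /eqP; rewrite oner_eq0.
  rewrite -row_mul; have -> : P *m (A ^t* *m A) =
      diag_mx (spectral_diag (A ^t* *m A)) *m P.
    by rewrite -gramE -[RHS]mulmxA PPV mulmx1.
  by rewrite row_mul row_diag_mx diagE -sk -scalemxAl -rowE.
move=> /eigenvalueP[v vA v0]; split=> //.
set u := v *m P ^t*.
have u0 : u != 0.
  apply: contra_neq v0 => u0; rewrite -[v]mulmx1 -PPV mulmxA.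
  by move: u0; rewrite /u => ->; rewrite mul0mx.
have [k uk] : exists k, u 0 k != 0.
  apply/existsP; apply: contra_neqT u0 => /existsPn u0; apply/rowP => k.
  by have /negbNE/eqP -> := u0 k; rewrite mxE.
exists k.
have uD : u *m diag_mx (spectral_diag (A ^t* *m A)) = (s ^+ 2)%:C *: u.
  rewrite -gramE /u !mulmxA -(mulmxA v) PPV mulmx1 -(mulmxA v) vA.
  by rewrite scalemxAl.
move/matrixP/(_ 0 k): uD; rewrite mul_mx_diag mxE [RHS]mxE diagE mulrC => /(mulIf uk).
move/complexI => sk; apply/eqP.
by rewrite -(eqrXn2 (n := 2))// ?fnorm_ge0 ?(ltW s0)// -sk.
Qed.

(** The range of [A^*] is orthogonal to the kernel of [A]. This removes the zero singular values
    from the lower bound. *)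
Let ell_kernel k (y : 'cV[C]_m) : ell k = 0 -> (P *m (A ^t* *m y)) k 0 = 0.
Proof.
move=> ek; have -> : P *m (A ^t* *m y) = (A *m P ^t*) ^t* *m y.
  by rewrite ctmxM trmxCK mulmxA.
rewrite mxE big1// => i _; rewrite 2!mxE.
have /fnorm_eq0/matrixP/(_ i 0) := ek; rewrite mxE [RHS]mxE => ->.
by rewrite conjC0 mul0r.
Qed.

Let ell_neq0 : A != 0 -> exists k, ell k != 0.
Proof.
move=> A0; apply/existsP; apply: contra_neqT A0 => /existsPn ell0.
have AP : A *m P ^t* = 0.
  apply/matrixP => i k; have /negbNE/eqP/fnorm_eq0/matrixP/(_ i 0) := ell0 k.
  by rewrite [LHS]mxE [X in _ = X -> _]mxE => ->; rewrite mxE.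
by rewrite -[A]mulmx1 -PPV mulmxA AP mul0mx.
Qed.

Lemma gram_spectral_decomposition : exists (Q : 'M[C]_n) (sv : 'I_n -> R),
  [/\ forall k, 0 <= sv k,
      forall x : 'cV_n, fnorm (A *m x) ^+ 2 = \sum_k sv k ^+ 2 * cmod ((Q *m x) k 0) ^+ 2,
      forall x : 'cV_n, fnorm x ^+ 2 = \sum_k cmod ((Q *m x) k 0) ^+ 2,
      forall s, nonzero_singular_values A s <-> 0 < s /\ exists k, s = sv k &
      (forall k (y : 'cV_m), sv k = 0 -> (Q *m (A ^t* *m y)) k 0 = 0) /\
      (A != 0 -> exists k, sv k != 0)].
Proof.
exists P, ell; split; [|exact: sum_sqr|exact: sum_cmod|exact: svalE|].
  by move=> k; exact: fnorm_ge0.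
by split; [exact: ell_kernel | exact: ell_neq0].
Qed.

(** Both bounds are read coordinatewise in the eigenbasis. The lower one is restricted to the range
    of [A^*], whose coordinates along zero singular values vanish; the infimum is positive since
    finitely many values occur. *)
Lemma singular_value_bounds : A != 0 ->
  [/\ 0 < inf (nonzero_singular_values A),
      inf (nonzero_singular_values A) <= sup (nonzero_singular_values A),
      forall x : 'cV_n, fnorm (A *m x) <= sup (nonzero_singular_values A) * fnorm x &
      forall y : 'cV_m, inf (nonzero_singular_values A) * fnorm (A ^t* *m y) <=
        fnorm (A *m (A ^t* *m y))].
Proof.
have [Q [sv [sv0 sqr_A sqr_x svP [sv_ker sv_neq0]]]] := gram_spectral_decomposition.
move=> /sv_neq0[k0 sk0]; have ek0 : 0 < sv k0 by rewrite lt_neqAle eq_sym sk0 sv0.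
case: (@arg_minP _ _ _ k0 (fun k => 0 < sv k) sv ek0) => k1 ek1 k1_min.
have ne : nonzero_singular_values A !=set0.
  by exists (sv k0); apply/svP; split=> //; exists k0.
have lb : lbound (nonzero_singular_values A) (sv k1).
  by move=> s /svP[s0 [k sk]]; rewrite sk; apply: k1_min; rewrite -sk.
have ub : has_ubound (nonzero_singular_values A).
  exists (\sum_k sv k) => s /svP[s0 [k ->]].
  by rewrite (bigD1 k)//= lerDl sumr_ge0.
have inf0 : 0 < inf (nonzero_singular_values A).
  exact: lt_le_trans ek1 (lb_le_inf ne lb).
have sv_le k : sv k <= sup (nonzero_singular_values A).
  have [ek|ek] := ltP 0 (sv k).
    by apply: (ub_le_sup ub); apply/svP; split=> //; exists k.
  apply: le_trans ek _; apply: le_trans (ltW ek0) _.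
  by apply: (ub_le_sup ub); apply/svP; split=> //; exists k0.
have sup0 : 0 <= sup (nonzero_singular_values A).
  exact: le_trans (ltW ek0) (sv_le k0).
split=> //.
- apply: le_trans (sv_le k0); apply: ge_inf; first by exists (sv k1).
  by apply/svP; split=> //; exists k0.
- move=> x; apply: sqr_le; first by rewrite mulr_ge0 ?fnorm_ge0.
  rewrite exprMn sqr_A sqr_x mulr_sumr; apply: ler_sum => k _.
  by apply: ler_wpM2r; [exact: sqr_ge0|apply: le_sqr; [exact: sv0|]].
move=> y; apply: sqr_le; first exact: fnorm_ge0.
rewrite exprMn sqr_A sqr_x mulr_sumr; apply: ler_sum => k _.
have [ek|ek] := ltP 0 (sv k).
  apply: ler_wpM2r; first exact: sqr_ge0.
  apply: le_sqr (ltW inf0) _; apply: ge_inf; first by exists (sv k1).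
  by apply/svP; split=> //; exists k.
have ek0' : sv k = 0 by apply/eqP; rewrite eq_le ek sv0.
by rewrite sv_ker// cmod0 expr0n !mulr0.
Qed.

End Gram.

End SingularValues.

(** * Concentration on finite product spaces *)

Section ProductWeights.
Variables (R : realType) (J : finType) (q : J -> R).
Hypotheses (q_ge0 : forall j, 0 <= q j) (q_sum : \sum_j q j = 1).

Definition product_weight n (f : {ffun 'I_n -> J}) : R := \prod_i q (f i).

Lemma product_weight_ge0 n (f : {ffun 'I_n -> J}) : 0 <= product_weight f.
Proof. exact: prodr_ge0. Qed.

(** Independence: the expectation of a product over the sample is the product of the
    expectations. *)
Lemma sum_product_weight n (g : J -> R) :
  \sum_(f : {ffun 'I_n -> J}) product_weight f * \prod_i g (f i) =
  (\sum_j q j * g j) ^+ n.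
Proof.
under eq_bigr do rewrite -big_split /=.
rewrite -(bigA_distr_bigA (fun (i : 'I_n) j => q j * g j)) /=.
by rewrite prodr_const card_ord.
Qed.

Lemma sum_product_weight1 n : \sum_(f : {ffun 'I_n -> J}) product_weight f = 1.
Proof.
transitivity ((\sum_j q j * 1) ^+ n).
  rewrite -(sum_product_weight n (fun=> 1)); apply: eq_bigr => f _.
  by rewrite big1 ?mulr1.
by rewrite -[X in X ^+ _]mulr_suml q_sum mulr1 expr1n.
Qed.

(** Prepends one sample point, for induction on the sample size with the first point averaged
    separately. *)
Definition ffun_cons n (j : J) (f : {ffun 'I_n -> J}) : {ffun 'I_n.+1 -> J} :=
  [ffun i => oapp f j (unlift ord0 i)].

Lemma ffun_cons0 n j (f : {ffun 'I_n -> J}) : ffun_cons j f ord0 = j.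
Proof. by rewrite ffunE unlift_none. Qed.

Lemma ffun_consS n j (f : {ffun 'I_n -> J}) i : ffun_cons j f (lift ord0 i) = f i.
Proof. by rewrite ffunE liftK. Qed.

Lemma sum_ffun_cons n (F : {ffun 'I_n.+1 -> J} -> R) :
  \sum_f F f = \sum_j \sum_(f : {ffun 'I_n -> J}) F (ffun_cons j f).
Proof.
rewrite pair_big /=.
rewrite (reindex (fun jf : J * {ffun 'I_n -> J} => ffun_cons jf.1 jf.2)) //=.
exists (fun f => (f ord0, [ffun i => f (lift ord0 i)])) => [[j f] _|f _] /=.
  rewrite ffun_cons0; congr pair; apply/ffunP => i; by rewrite ffunE ffun_consS.
apply/ffunP => i; case: (unliftP ord0 i) => [k ->|->].
  by rewrite ffun_consS ffunE.
by rewrite ffun_cons0.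
Qed.

Lemma product_weight_cons n j (f : {ffun 'I_n -> J}) :
  product_weight (ffun_cons j f) = q j * product_weight f.
Proof.
rewrite /product_weight big_ord_recl ffun_cons0; congr (_ * _).
by apply: eq_bigr => i _; rewrite ffun_consS.
Qed.

Lemma markov_product n (bad : pred {ffun 'I_n -> J}) (F : {ffun 'I_n -> J} -> R) :
  (forall f, 0 <= F f) -> (forall f, bad f -> 1 <= F f) ->
  \sum_(f | bad f) product_weight f <= \sum_f product_weight f * F f.
Proof.
move=> F0 F1; rewrite [leRHS](bigID bad) /= -[leLHS]addr0; apply: lerD.
  by apply: ler_sum => f /F1 Ff; rewrite ler_peMr// product_weight_ge0.
by apply: sumr_ge0 => f _; rewrite mulr_ge0// product_weight_ge0.
Qed.

Lemma expRN_le (y : R) : 0 <= y -> expR (- y) <= 1 - y + y ^+ 2.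
Proof.
move=> y0; rewrite expRN; apply: le_trans (_ : (1 + y)^-1 <= _).
  by rewrite lef_pV2 ?posrE ?expR_gt0 ?expR_ge1Dx//; lra.
rewrite -div1r ler_pdivrMr; last by lra.
have -> : (1 - y + y ^+ 2) * (1 + y) = 1 + y ^+ 3 by ring.
by rewrite lerDl exprn_ge0.
Qed.

Lemma expR_le_quadratic (y : R) : y <= 2^-1 -> expR y <= 1 + y + 2 * y ^+ 2.
Proof.
move=> y2; have h : 0 < 1 - y by lra.
have : 1 - y <= expR (- y) by exact: expR_ge1Dx.
rewrite expRN => h1; have : expR y <= (1 - y)^-1.
  by rewrite -[expR y]invrK lef_pV2// posrE ?invr_gt0 ?expR_gt0.
move/le_trans; apply; rewrite -div1r ler_pdivrMr//.
(* The product of [1 + y + 2 * y ^+ 2] and [1 - y] is [1 + y ^+ 2 * (1 - 2 * y)]. *)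
have := sqr_ge0 y; nra.
Qed.

(** A lower tail of nonnegative variables needs no exponential moments. The two moments give a mean
    of at least [3/4 - 4/16 = 1/2], so the Laplace transform at [-1/4] is at most
    [1 - 1/8 + 1/16 = 15/16], below [exp (- 1/16)]. The threshold [n / 8] gives back
    [exp (n / 32)]. *)
Lemma small_ball_tail n (xi : J -> R) :
  (forall j, 0 <= xi j) ->
  \sum_j q j * xi j ^+ 2 = 1 -> \sum_j q j * xi j ^+ 4 <= 4 ->
  \sum_(f : {ffun 'I_n -> J} | \sum_i xi (f i) <= 8^-1 * n%:R) product_weight f <=
  expR (- (32^-1 * n%:R)).
Proof.
move=> xi0 m2 m4.
have mgf : \sum_j q j * expR (- (4^-1 * xi j)) <= expR (- 16^-1).
  have -> : - 16^-1 = (15 / 16 - 1) :> R by field.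
  apply: le_trans (_ : 15 / 16 <= _); last first.
    by have := expR_ge1Dx (15 / 16 - 1 : R); rewrite addrC subrK.
  apply: le_trans (_ : \sum_j q j * (1 - 4^-1 * (3 / 4 * xi j ^+ 2 - 16^-1 * xi j ^+ 4)
      + 16^-1 * xi j ^+ 2) <= _).
    apply: ler_sum => j _; apply: ler_wpM2l => //.
    have y0 : 0 <= 4^-1 * xi j by rewrite mulr_ge0.
    apply: le_trans (expRN_le y0) _.
    (* [x - 3/4 x^2 + x^4/16 = x (x - 2)^2 (x + 4) / 16]: the first moment is
       controlled from below by the second and the fourth. *)
    have : 3 / 4 * xi j ^+ 2 - 16^-1 * xi j ^+ 4 <= xi j.
      rewrite -subr_ge0.
      have -> : xi j - (3 / 4 * xi j ^+ 2 - 16^-1 * xi j ^+ 4) =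
        16^-1 * (xi j * ((xi j - 2) ^+ 2 * (xi j + 4))) by field.
      by rewrite mulr_ge0// mulr_ge0// mulr_ge0 ?sqr_ge0// addr_ge0.
    by rewrite exprMn; move: (xi j ^+ 2) (xi j ^+ 4) => *; lra.
  under eq_bigr => j _.
    rewrite (_ : _ * _ = q j + (- (2 / 16) * (q j * xi j ^+ 2) +
      64^-1 * (q j * xi j ^+ 4))); last by field.
    over.
  rewrite !big_split /= -!mulr_sumr q_sum m2.
  by move: (\sum_j _) m4 => x; lra.
apply: le_trans (markov_product (F := fun f => expR (32^-1 * n%:R) *
    \prod_i expR (- (4^-1 * xi (f i)))) _ _) _ => [f|f fb|].
- by rewrite mulr_ge0 ?expR_ge0// prodr_ge0// => i _; exact: expR_ge0.
- rewrite -expR_sum -expRD -[leLHS]expR0 ler_expR sumrN -mulr_sumr.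
  by move: (\sum_i _) fb => x; lra.
under eq_bigr do rewrite mulrCA.
rewrite -mulr_sumr (sum_product_weight n (fun j => expR (- (4^-1 * xi j)))).
have -> : expR (- (32^-1 * n%:R)) = expR (32^-1 * n%:R) * expR (- 16^-1) ^+ n :> R.
  by rewrite -expRM_natr -expRD; congr expR; field.
apply: ler_wpM2l; first exact: expR_ge0.
apply: lerXn2r => //; rewrite nnegrE ?expR_ge0// sumr_ge0// => j _.
by rewrite mulr_ge0// expR_ge0.
Qed.

(** * A Bernstein inequality in the Frobenius norm *)

Section VectorBernstein.
Variables (m k : nat).
Local Notation C := R[i].
Variables (v : J -> 'M[C]_(m, k)) (V B : R).
Hypothesis v_mean : \sum_j (q j)%:C *: v j = 0.
Hypothesis v_var : \sum_j q j * fnorm (v j) ^+ 2 <= V.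
Hypothesis v_bound : forall j, fnorm (v j) <= B.
Variables (tau lam : R).
Hypotheses (tau_gt0 : 0 < tau) (lam_ge0 : 0 <= lam).
Hypotheses (B_tau : B <= 2 * tau) (lam_B : lam * B <= 4^-1).

(* A smooth substitute for the norm, whose exponential moment grows by a bounded
   factor with each summand. *)
Let phi (x : 'M[C]_(m, k)) : R := Num.sqrt (tau ^+ 2 + fnorm x ^+ 2).

(** Concavity of the square root: its graph lies below the tangent at [phi x ^+ 2]. *)
Lemma smoothed_norm_add (x y : 'M[C]_(m, k)) : 0 < phi x ->
  phi (x + y) <= phi x + (2 * real_inner x y + fnorm y ^+ 2) / (2 * phi x).
Proof.
have sq z : phi z ^+ 2 = tau ^+ 2 + fnorm z ^+ 2.
  by rewrite sqr_sqrtr// addr_ge0 ?sqr_ge0.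
have e2 : phi (x + y) ^+ 2 = phi x ^+ 2 + (2 * real_inner x y + fnorm y ^+ 2).
  rewrite !sq !sqr_fnorm real_innerDl !real_innerDr (real_innerC y x).
  by do 3 move: (real_inner _ _) => ?; ring.
have s0 : 0 <= phi (x + y) by exact: sqrtr_ge0.
move: {sq} (phi (x + y)) (phi x) (2 * _ + _) e2 s0 => s r w e2 s0 r0.
rewrite -(ler_pM2l (mulr_gt0 (ltr0n R 2) r0)).
have -> : 2 * r * (r + w / (2 * r)) = 2 * r ^+ 2 + w by field; rewrite gt_eqF.
by have := sqr_ge0 (r - s); rewrite sqrrB; lra.
Qed.

(** The first-order term averages to zero because the summands are centred. What remains is the
    curvature term, bounded with [phi x >= tau], and the second-order term of the exponential. *)
Lemma bernstein_step (x : 'M[C]_(m, k)) :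
  \sum_j q j * expR (lam * phi (x + v j)) <=
  expR (lam * phi x) * expR (lam * V / (2 * tau) + 8 * lam ^+ 2 * V).
Proof.
have tau2 : 0 < tau ^+ 2 by rewrite exprn_gt0.
have phi_tau : tau <= phi x.
  by rewrite -[leLHS]gtr0_norm// -sqrtr_sqr ler_wsqrtr// lerDl sqr_ge0.
have phi_x : fnorm x <= phi x.
  by rewrite -[leLHS]ger0_norm ?fnorm_ge0// -sqrtr_sqr ler_wsqrtr// lerDr ltW.
have phi0 : 0 < phi x := lt_le_trans tau_gt0 phi_tau.
pose y j := lam * ((2 * real_inner x (v j) + fnorm (v j) ^+ 2) / (2 * phi x)).
have y_abs j : `|y j| <= lam * (2 * fnorm (v j)).
  rewrite /y normrM (ger0_norm lam_ge0); apply: ler_wpM2l => //.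
  rewrite normrM [`|_^-1|]ger0_norm ?invr_ge0 ?mulr_ge0 ?(ltW phi0)//.
  rewrite ler_pdivrMr ?mulr_gt0//.
  apply: le_trans (ler_normD _ _) _.
  rewrite normrM (ger0_norm (ler0n R 2)) (ger0_norm (sqr_ge0 (fnorm _))).
  have h1 := real_inner_norm_le x (v j).
  have h2 := ler_wpM2r (fnorm_ge0 (v j)) phi_x.
  have h4 := le_trans (v_bound j) (le_trans B_tau (ler_wpM2l (ler0n R 2) phi_tau)).
  have h3 := ler_wpM2r (fnorm_ge0 (v j)) h4.
  rewrite expr2; move: (le_trans h1 h2) h3 => {h1 h2 h4 y}.
  move: `|real_inner x (v j)| (fnorm (v j)) (phi x) => a b c h1 h3.
  have -> : 2 * b * (2 * c) = 2 * (c * b) + 2 * c * b by ring.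
  by apply: lerD; [exact: (ler_wpM2l (ler0n R 2) h1) | exact: h3].
have y_half j : y j <= 2^-1.
  apply: le_trans (ler_norm _) (le_trans (y_abs j) _).
  have := ler_wpM2l lam_ge0 (v_bound j); move/le_trans/(_ lam_B).
  by rewrite mulrCA; move: (lam * _) => z; lra.
have y_sqr j : y j ^+ 2 <= 4 * lam ^+ 2 * fnorm (v j) ^+ 2.
  rewrite -real_normK ?num_real//.
  have := le_sqr (normr_ge0 _) (y_abs j); move/le_trans; apply.
  by apply: eq_ler; rewrite !exprMn; ring.
apply: le_trans (_ : \sum_j q j * (expR (lam * phi x) *
    (1 + y j + 8 * lam ^+ 2 * fnorm (v j) ^+ 2)) <= _).
  apply: ler_sum => j _; apply: ler_wpM2l => //.
  apply: le_trans (_ : expR (lam * phi x + y j) <= _).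
    rewrite ler_expR -mulrDr; apply: ler_wpM2l => //; exact: smoothed_norm_add.
  rewrite expRD; apply: ler_wpM2l; first exact: expR_ge0.
  apply: le_trans (expR_le_quadratic (y_half j)) _.
  by have := y_sqr j; rewrite -!mulrA; move: (_ * fnorm _ ^+ 2) (y j ^+ 2) => *; lra.
under eq_bigr do rewrite mulrCA.
rewrite -mulr_sumr; apply: ler_wpM2l; first exact: expR_ge0.
apply: le_trans (expR_ge1Dx _).
under eq_bigr do rewrite !mulrDr mulr1 [q _ * (8 * _ * _)]mulrCA.
rewrite !big_split /= q_sum -addrA lerD2l -mulr_sumr; apply: lerD; last first.
  by apply: ler_wpM2l => //; rewrite mulr_ge0// sqr_ge0.
have -> : \sum_j q j * y j =
    lam / (2 * phi x) * (2 * real_inner x (\sum_j (q j)%:C *: v j) +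
      \sum_j q j * fnorm (v j) ^+ 2).
  rewrite real_inner_sumr !mulr_sumr -big_split /= mulr_sumr.
  apply: eq_bigr => j _; rewrite real_innerZr /y.
  by move: (real_inner _ _) (fnorm _ ^+ 2) (_^-1) => *; ring.
rewrite v_mean real_inner0r mulr0 add0r.
have V0 : 0 <= V.
  by apply: le_trans v_var; apply: sumr_ge0 => j _; rewrite mulr_ge0 ?sqr_ge0.
apply: le_trans (ler_wpM2l _ v_var) _.
  by rewrite divr_ge0// mulr_ge0// ltW.
rewrite mulrAC; apply: ler_wpM2l; first exact: mulr_ge0.
by rewrite lef_pV2 ?posrE ?mulr_gt0// ler_pM2l.
Qed.

(** The starting point [x] is arbitrary so that the induction can absorb the first summand into
    it. *)
Lemma bernstein_product n (x : 'M[C]_(m, k)) :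
  \sum_(f : {ffun 'I_n -> J}) product_weight f *
    expR (lam * phi (x + \sum_i v (f i))) <=
  expR (lam * phi x) * expR (lam * V / (2 * tau) + 8 * lam ^+ 2 * V) ^+ n.
Proof.
elim: n x => [|n IHn] x.
  rewrite expr0 mulr1.
  under eq_bigr do rewrite big_ord0 addr0.
  by rewrite -mulr_suml sum_product_weight1 mul1r.
rewrite sum_ffun_cons.
apply: le_trans (_ : \sum_j q j * (expR (lam * phi (x + v j)) *
   expR (lam * V / (2 * tau) + 8 * lam ^+ 2 * V) ^+ n) <= _).
  apply: ler_sum => j _; apply: le_trans (ler_wpM2l (q_ge0 j) (IHn (x + v j))).
  rewrite mulr_sumr; apply: ler_sum => f _.
  rewrite product_weight_cons mulrA big_ord_recl ffun_cons0 addrA.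
  by under eq_bigr do rewrite ffun_consS.
under eq_bigr do rewrite mulrA.
rewrite -mulr_suml [_ ^+ n.+1]exprS [leRHS]mulrA.
apply: ler_wpM2r; first by rewrite exprn_ge0 ?expR_ge0.
exact: bernstein_step.
Qed.

End VectorBernstein.

Lemma vector_bernstein m k n (v : J -> 'M[R[i]]_(m, k)) (V B s : R) :
  \sum_j (q j)%:C *: v j = 0 ->
  \sum_j q j * fnorm (v j) ^+ 2 <= V -> (forall j, fnorm (v j) <= B) ->
  0 < V -> 0 < s -> s * B <= 8 * V ->
  8 * V <= n%:R * s ^+ 2 -> 2 * B <= n%:R * s ->
  \sum_(f : {ffun 'I_n -> J} | n%:R * s <= fnorm (\sum_i v (f i)))
    product_weight f <= expR (- (128^-1 * (n%:R * s ^+ 2 / V))).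
Proof.
move=> v0 vV vB V0 s0 sB nV nB.
have ns0 : 0 < n%:R * s.
  have : 0 < n%:R * s ^+ 2 by apply: lt_le_trans nV; rewrite mulr_gt0.
  by rewrite expr2 mulrA pmulr_lgt0.
(* With [x = lam * tau = n s^2 / (128 V)], the exponent is [-4x] from Markov, [x] from the start at
   zero, [x] from the second-order terms and [1/16] from the curvature. Since [x >= 1/16], the total
   is at most [-x]. *)
pose tau := n%:R * s / 4; pose lam := s / (32 * V).
have tau0 : 0 < tau by rewrite divr_gt0.
have lam0 : 0 <= lam by rewrite divr_ge0 ?mulr_ge0// ltW.
have B_tau : B <= 2 * tau by rewrite /tau; lra.
have lam_B : lam * B <= 4^-1.
  rewrite /lam mulrAC ler_pdivrMr ?mulr_gt0//; lra.
have := bernstein_product v0 vV vB tau0 lam0 B_tau lam_B n 0.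
under eq_bigr do rewrite add0r.
rewrite fnorm0 expr0n addr0 sqrtr_sqr (gtr0_norm tau0) => mgf.
apply: le_trans (markov_product (F := fun f => expR (- (lam * (n%:R * s))) *
    expR (lam * Num.sqrt (tau ^+ 2 + fnorm (\sum_i v (f i)) ^+ 2))) _ _) _.
- by move=> f; rewrite mulr_ge0 ?expR_ge0.
- move=> f fb; rewrite -expRD -[leLHS]expR0 ler_expR addrC subr_ge0.
  apply: ler_wpM2l => //; apply: le_trans fb _.
  by rewrite -[leLHS]ger0_norm ?fnorm_ge0// -sqrtr_sqr ler_wsqrtr// lerDr sqr_ge0.
under eq_bigr do rewrite mulrCA.
rewrite -mulr_sumr; apply: le_trans (ler_wpM2l (expR_ge0 _) mgf) _.
rewrite -expRM_natr -!expRD ler_expR.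
have n0 : 0 < n%:R :> R by rewrite -(pmulr_lgt0 _ s0).
have e1 : lam * V / (2 * tau) * n%:R = 16^-1.
  by rewrite /lam /tau; field; rewrite !gt_eqF.
have e2 : lam * tau = 128^-1 * (n%:R * s ^+ 2 / V).
  by rewrite /lam /tau; field; rewrite gt_eqF.
have e3 : lam * (n%:R * s) = 4 * (lam * tau) by rewrite /tau; field.
have e4 : 8 * lam ^+ 2 * V * n%:R = lam * tau.
  by rewrite /lam /tau; field; rewrite gt_eqF.
have e5 : 16^-1 <= lam * tau.
  rewrite e2 mulrA ler_pdivlMr//; lra.
by rewrite mulrDl e1 e3 e4 -e2; lra.
Qed.

End ProductWeights.

(** * Moments of projective designs *)

Section DesignMoments.
Variable R : realType.
Local Notation C := R[i].

Definition cdot m (x y : 'cV[C]_m) : C := (x ^t* *m y) 0 0.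

Lemma cdotE m (x y : 'cV[C]_m) : cdot x y = \sum_k Num.conj (x k 0) * y k 0.
Proof. by rewrite /cdot mxE; apply: eq_bigr => k _; rewrite !mxE. Qed.

Lemma cdotC m (x y : 'cV[C]_m) : cdot x y = Num.conj (cdot y x).
Proof.
rewrite !cdotE rmorph_sum /=; apply: eq_bigr => k _.
by rewrite rmorphM /= conjCK mulrC.
Qed.

Lemma cdot_deltar m (x : 'cV[C]_m) k : cdot x (delta_mx k 0) = Num.conj (x k 0).
Proof.
rewrite cdotE (bigD1 k)//= mxE !eqxx mulr1 big1 ?addr0// => i ik.
by rewrite mxE (negbTE ik) mulr0.
Qed.

Lemma cdot_deltal m (x : 'cV[C]_m) k : cdot (delta_mx k 0) x = x k 0.
Proof. by rewrite cdotC cdot_deltar conjCK. Qed.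

Lemma cdotDr m (x y z : 'cV[C]_m) (a : C) :
  cdot x (y + a *: z) = cdot x y + a * cdot x z.
Proof. by rewrite /cdot mulmxDr -scalemxAr !mxE. Qed.

Lemma cdotDl m (x y z : 'cV[C]_m) (a : C) :
  cdot (x + Num.conj a *: z) y = cdot x y + a * cdot z y.
Proof. by rewrite cdotC cdotDr rmorphD rmorphM /= conjCK -!cdotC. Qed.

Lemma cdot_self m (x : 'cV[C]_m) : cdot x x = (fnorm x ^+ 2)%:C.
Proof.
rewrite cdotE sqr_fnorm real_innerE rmorph_sum /=; apply: eq_bigr => k _.
by rewrite big_ord1 -!expr2 -sqr_cmod sqr_cmodC mulrC.
Qed.

Lemma conj_real (x : R) : Num.conj (x%:C) = x%:C.
Proof. exact: conjc_real. Qed.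

Definition tensor_vector d t (x : 'cV[C]_d) : 'cV[C]_#|multi_index d t| :=
  \col_i \prod_(s < t) x ((enum_val i : multi_index d t) s) 0.

Lemma tensor_vector_symmetric d t (x : 'cV[C]_d) :
  @symmetric_subspace R d t (tensor_vector t x).
Proof.
move=> s; apply/colP => i; rewrite !mxE enum_rankK.
rewrite [RHS](reindex_inj (@perm_inj _ s)) /=.
by apply: eq_bigr => k _; rewrite ffunE.
Qed.

Lemma cdot_tensor_vector d t (x y : 'cV[C]_d) :
  cdot (tensor_vector t x) (tensor_vector t y) = cdot x y ^+ t.
Proof.
rewrite !cdotE -[in RHS](card_ord t) -prodr_const.
rewrite (bigA_distr_bigA (fun (s : 'I_t) k => Num.conj (x k 0) * y k 0)) /=.
rewrite (reindex (fun f : multi_index d t => enum_rank f)) /=; last first.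
  by exists enum_val => f _; [exact: enum_rankK | exact: enum_valK].
apply: eq_bigr => f _; rewrite !mxE enum_rankK rmorph_prod -big_split /=.
by [].
Qed.

Lemma tensor_power_rank1 d t (w : 'cV[C]_d) :
  tensor_power t (w *m w ^t*) = tensor_vector t w *m (tensor_vector t w) ^t*.
Proof.
apply/matrixP => i j; rewrite !mxE big_ord1 !mxE rmorph_prod -big_split /=.
by apply: eq_bigr => s _; rewrite !mxE big_ord1 !mxE.
Qed.

(** The design identity of degree [s] tested on the tensor powers of [y] and [x]. The constant is
    left free, so that the degree can be lowered before it is computed. *)
Definition power_identity d N (w : 'I_N -> 'cV[C]_d) (p : 'I_N -> R) s (c : C) :=
  forall x y : 'cV[C]_d,
    \sum_j (p j)%:C * (cdot y (w j) ^+ s * cdot (w j) x ^+ s) = c * cdot y x ^+ s.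

(** Tensor powers are symmetric, hence fixed by the projector. *)
Lemma design_power_identity d N (w : 'I_N -> 'cV[C]_d) (p : 'I_N -> R) t :
  weighted_projective_design t w p -> exists c, power_identity w p t c.
Proof.
move=> [_ _ _ [P [[_ PP PS] design]]]; exists ('C(d + t - 1, t)%:R)^-1 => x y.
have Px : P *m tensor_vector t x = tensor_vector t x.
  have : range (fun x => P *m x) (tensor_vector t x).
    by rewrite PS; exact: tensor_vector_symmetric.
  by move=> [z _ <-]; rewrite mulmxA PP.
have <- : ((tensor_vector t y) ^t* *m (('C(d + t - 1, t)%:R)^-1 *: P)
    *m tensor_vector t x) 0 0 = ('C(d + t - 1, t)%:R)^-1 * cdot y x ^+ t.
  rewrite -scalemxAr -scalemxAl -mulmxA Px -cdot_tensor_vector.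
  by rewrite [LHS]mxE.
rewrite -design.
rewrite mulmx_sumr mulmx_suml summxE; apply: eq_bigr => j _.
rewrite -scalemxAr -scalemxAl mxE tensor_power_rank1; congr (_ * _).
rewrite -!cdot_tensor_vector /cdot mulmxA -[_ *m _ *m tensor_vector t x]mulmxA.
by rewrite [RHS]mxE big_ord1.
Qed.

(** Turns an identity valid for every complex parameter into one of polynomials, which can be
    differentiated formally. *)
Lemma poly_fun_eq (f g : {poly C}) : (forall z, f.[z] = g.[z]) -> f = g.
Proof.
move=> fg; apply/eqP; rewrite -subr_eq0; apply/eqP.
pose s := [seq (k%:R : C) | k <- iota 0 (size (f - g)).+1].
apply: (@roots_geq_poly_eq0 _ _ s).
- by apply/allP => z _; rewrite rootE hornerD hornerN fg subrr.
- rewrite map_inj_uniq ?iota_uniq// => i j /eqP.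
  by rewrite eqr_nat => /eqP.
by rewrite size_map size_iota.
Qed.

Lemma horner_affine_exp (a b z : C) n :
  ((a%:P + b *: 'X) ^+ n).[z] = (a + z * b) ^+ n.
Proof. by rewrite !hornerE mulrC. Qed.

Lemma deriv_affine_exp (a b : C) n :
  ((a%:P + b *: 'X) ^+ n)^`().[0] = n%:R * (a ^+ n.-1 * b).
Proof.
rewrite deriv_exp derivD derivC add0r derivZ derivX hornerMn hornerM.
rewrite horner_affine_exp mul0r addr0 !hornerE -mulr_natl.
by rewrite [b * _]mulrC mulrA.
Qed.

(* Differentiate the identity in [x] and in the conjugate of [y] in direction [e_k],
   then sum over [k]. *)
Lemma power_identity_descent d N (w : 'I_N -> 'cV[C]_d) (p : 'I_N -> R) s (c : C) :
  (forall j, cdot (w j) (w j) = 1) ->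
  power_identity w p s.+1 c -> power_identity w p s (c * (s + d)%:R / s.+1%:R).
Proof.
move=> w1 id_s.
have s0 : s.+1%:R != 0 :> C by rewrite pnatr_eq0.
have step1 x y k : \sum_j (p j)%:C * (cdot y (w j) ^+ s.+1 *
    (cdot (w j) x ^+ s * Num.conj (w j k 0))) =
    c * (cdot y x ^+ s * Num.conj (y k 0)).
  pose f : {poly C} := \sum_j ((p j)%:C * cdot y (w j) ^+ s.+1) *:
    ((cdot (w j) x)%:P + Num.conj (w j k 0) *: 'X) ^+ s.+1.
  pose g : {poly C} := c *: ((cdot y x)%:P + Num.conj (y k 0) *: 'X) ^+ s.+1.
  have fg : f = g.
    apply: poly_fun_eq => z; rewrite /f /g horner_sum hornerZ horner_affine_exp.
    have := id_s (x + z *: delta_mx k 0) y; rewrite cdotDr cdot_deltar => <-.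
    apply: eq_bigr => j _.
    by rewrite hornerZ horner_affine_exp cdotDr cdot_deltar mulrA.
  apply: (mulfI s0); have := congr1 (fun h => h^`().[0]) fg.
  rewrite /f /g derivZ hornerZ deriv_affine_exp raddf_sum horner_sum.
  rewrite /= => h; rewrite [RHS]mulrCA -h; rewrite mulr_sumr; apply: eq_bigr => j _.
  by rewrite derivZ hornerZ deriv_affine_exp [RHS]mulrCA !mulrA.
have step2 x y k : s.+1%:R * (\sum_j (p j)%:C * (cdot y (w j) ^+ s *
    cdot (w j) x ^+ s) * (w j k 0 * Num.conj (w j k 0))) =
    c * (s%:R * cdot y x ^+ s.-1 * (x k 0 * Num.conj (y k 0)) + cdot y x ^+ s).
  pose f : {poly C} := \sum_j ((p j)%:C * (cdot (w j) x ^+ s * Num.conj (w j k 0))) *: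
    ((cdot y (w j))%:P + w j k 0 *: 'X) ^+ s.+1.
  pose g : {poly C} := c *: (((cdot y x)%:P + x k 0 *: 'X) ^+ s *
    ((Num.conj (y k 0))%:P + 1 *: 'X) ^+ 1).
  have fg : f = g.
    apply: poly_fun_eq => z; rewrite /f /g horner_sum hornerZ hornerM !horner_affine_exp.
    have := step1 x (y + Num.conj z *: delta_mx k 0) k.
    have ek : (y + Num.conj z *: delta_mx k 0) k 0 = y k 0 + Num.conj z.
      by rewrite !mxE !eqxx mulr1.
    rewrite ek cdotDl cdot_deltal rmorphD /= conjCK.
    rewrite expr1 mulr1 => <-; apply: eq_bigr => j _.
    rewrite hornerZ horner_affine_exp cdotDl cdot_deltal.
    by rewrite -mulrA; congr (_ * _); rewrite mulrC.
  have := congr1 (fun h => h^`().[0]) fg.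
  rewrite /f /g derivZ hornerZ derivM hornerD !hornerM !deriv_affine_exp !horner_affine_exp.
  rewrite raddf_sum horner_sum !mul0r !addr0 !expr1 /= expr0 !mulr1 => h.
  have -> : s%:R * cdot y x ^+ s.-1 * (x k 0 * Num.conj (y k 0)) =
      s%:R * (cdot y x ^+ s.-1 * x k 0) * Num.conj (y k 0) by ring.
  rewrite -h mulr_sumr; apply: eq_bigr => j _.
  by rewrite derivZ hornerZ deriv_affine_exp /=; ring.
move=> x y; apply: (mulfI s0).
rewrite [RHS]mulrA [X in _ = X * _]mulrC divfK// -[RHS]mulrA.
(* Summed over [k], the products [x_k conj (y_k)] restore one factor [cdot y x] with coefficient
   [s], and the [d] remaining terms contribute [d]. *)
have -> : c * ((s + d)%:R * cdot y x ^+ s) = \sum_(k < d)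
   c * (s%:R * cdot y x ^+ s.-1 * (x k 0 * Num.conj (y k 0)) + cdot y x ^+ s).
  rewrite -mulr_sumr big_split /= sumr_const card_ord -mulr_sumr; congr (_ * _).
  have -> : \sum_(k < d) x k 0 * Num.conj (y k 0) = cdot y x.
    by rewrite cdotE; apply: eq_bigr => k _; rewrite mulrC.
  rewrite natrD mulrDl [d%:R * _]mulr_natl; congr (_ + _).
  (* For [s = 0] the exponent [s.-1] is truncated, but its term carries the factor [s%:R]. *)
  by case: (s) => [|s']; rewrite ?mul0r// -mulrA -exprSr.
under [RHS]eq_bigr do rewrite -step2.
rewrite -mulr_sumr exchange_big /=; congr (_ * _); apply: eq_bigr => j _.
rewrite -mulr_sumr.
have -> : \sum_(k < d) w j k 0 * Num.conj (w j k 0) = 1.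
  by rewrite -(w1 j) cdotE; apply: eq_bigr => k _; rewrite mulrC.
by rewrite mulr1.
Qed.

Lemma power_identity_le d N (w : 'I_N -> 'cV[C]_d) (p : 'I_N -> R) s k (c : C) :
  (forall j, cdot (w j) (w j) = 1) ->
  power_identity w p (k + s) c -> exists c', power_identity w p s c'.
Proof.
move=> w1; elim: k c => [|k IHk] c; first by exists c.
by rewrite addSn => /(power_identity_descent w1)/IHk.
Qed.

Section Moments.
Variables (d N t : nat) (w : 'I_N -> 'cV[C]_d) (p : 'I_N -> R).
Hypotheses (d_gt0 : (0 < d)%N) (t_ge2 : (2 <= t)%N).
Hypothesis design : weighted_projective_design t w p.

Lemma design_unit j : cdot (w j) (w j) = 1.
Proof. by case: design => w1 _ _ _; rewrite cdot_self -vec_normE w1 expr1n. Qed.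

(** The constant is not derived from the binomial coefficient of degree [t]: the degree is lowered
    to 2 with an unknown constant, then to 0, where the identity says that the weights sum to 1 and
    thereby determines it. *)
Lemma design_power2 : power_identity w p 2 (2%:R / (d%:R * d.+1%:R)).
Proof.
have d0 : d%:R != 0 :> C by rewrite pnatr_eq0 -lt0n.
have d1 : d.+1%:R != 0 :> C by rewrite pnatr_eq0.
have [c ct] := design_power_identity design.
rewrite -(subnK t_ge2) in ct.
have [c2 h2] := power_identity_le design_unit ct.
have h0 := power_identity_descent design_unit (power_identity_descent design_unit h2).
have /eqP := h0 0 0; under eq_bigr do rewrite !expr0 !mulr1.
have [_ _ psum _] := design.
rewrite -rmorph_sum /= psum rmorph1 expr0 mulr1 add0n invr1 mulr1 add1n eq_sym.
move=> /eqP c2E; have -> : 2%:R / (d%:R * d.+1%:R) = c2; last by [].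
apply: (mulIf (mulf_neq0 d0 d1)); rewrite divfK ?mulf_neq0//.
have := congr1 (fun z => 2%:R * z) c2E; rewrite mulr1 => <-.
by field.
Qed.

Lemma design_power1 : power_identity w p 1 (d%:R^-1).
Proof.
have d0 : d%:R != 0 :> C by rewrite pnatr_eq0 -lt0n.
have d1 : d.+1%:R != 0 :> C by rewrite pnatr_eq0.
have := power_identity_descent design_unit design_power2.
have -> : 2%:R / (d%:R * d.+1%:R) * (1 + d)%:R / 2%:R = d%:R^-1 :> C.
  rewrite add1n; move: (d.+1%:R : C) (d%:R : C) d1 d0 => D E D0 E0.
  by field; rewrite D0 E0.
by [].
Qed.

Definition scaled_design j : 'cV[C]_d := (Num.sqrt d%:R)%:C *: w j.

Lemma fnorm_scaled_design j : fnorm (scaled_design j) ^+ 2 = d%:R.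
Proof.
case: design => w1 _ _ _.
by rewrite fnormZ -vec_normE w1 mulr1 ger0_norm ?sqrtr_ge0// sqr_sqrtr// ler0n.
Qed.

Lemma design_covariance :
  \sum_j (p j)%:C *: (scaled_design j *m (scaled_design j) ^t*) = 1%:M.
Proof.
apply/matrixP => k l; rewrite summxE.
have := design_power1 (delta_mx l 0) (delta_mx k 0).
rewrite cdot_deltal [in RHS]mxE eqxx andbT => h.
have -> : (1%:M : 'M[C]_d) k l = d%:R * (d%:R^-1 * (k == l)%:R ^+ 1).
  by rewrite mulVKf ?pnatr_eq0 -?lt0n// expr1 mxE eq_sym.
rewrite -h mulr_sumr; apply: eq_bigr => j _.
have sd2 : (Num.sqrt d%:R)%:C * (Num.sqrt d%:R)%:C = d%:R :> C.
  by rewrite -rmorphM /= -expr2 sqr_sqrtr ?ler0n// rmorph_nat.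
rewrite cdot_deltal cdot_deltar !expr1 !mxE big_ord1 !mxE.
rewrite rmorphM /= conj_real -sd2.
by move: (_%:C) (_%:C) (w j k 0) (Num.conj _) => x y z u; ring.
Qed.

Lemma design_second_moment k (X : 'M[C]_(d, k)) :
  \sum_j p j * fnorm ((scaled_design j) ^t* *m X) ^+ 2 = fnorm X ^+ 2.
Proof.
rewrite sqr_fnorm -{3}[X]mul1mx -design_covariance mulmx_suml real_inner_sumr.
apply: eq_bigr => j _; rewrite -scalemxAl real_innerZr; congr (_ * _).
by rewrite sqr_fnorm real_inner_mull trmxCK mulmxA.
Qed.

Lemma cmod_cdot_scaled j (x : 'cV[C]_d) :
  cmod (cdot (scaled_design j) x) ^+ 2 = d%:R * cmod (cdot (w j) x) ^+ 2.
Proof.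
have -> : cdot (scaled_design j) x = (Num.sqrt d%:R)%:C * cdot (w j) x.
  rewrite !cdotE mulr_sumr; apply: eq_bigr => k _.
  by rewrite mxE rmorphM /= conj_real mulrA.
by rewrite cmodM exprMn cmod_real real_normK ?num_real// sqr_sqrtr// ler0n.
Qed.

(** The scaling contributes [d^2], and [d^2 * 2 / (d (d + 1))] is at most 2. *)
Lemma design_fourth_moment (x : 'cV[C]_d) :
  \sum_j p j * (cmod (cdot (scaled_design j) x) ^+ 2) ^+ 2 <= 2 * (fnorm x ^+ 2) ^+ 2.
Proof.
have d0 : 0 < d%:R :> R by rewrite ltr0n.
have e : \sum_j p j * (cmod (cdot (w j) x) ^+ 2) ^+ 2 =
    2 / (d%:R * d.+1%:R) * (fnorm x ^+ 2) ^+ 2.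
  apply: complexI; rewrite rmorph_sum /= [RHS]rmorphM /= [in RHS]rmorphXn /= -cdot_self.
  have -> : (2 / (d%:R * d.+1%:R))%:C = 2%:R / (d%:R * d.+1%:R) :> C.
    by rewrite fmorph_div rmorphM /= !rmorph_nat.
  rewrite -design_power2; apply: eq_bigr => j _.
  by rewrite rmorphM /= rmorphXn /= sqr_cmodC -exprMn -cdotC [X in X ^+ 2]mulrC.
under eq_bigr do rewrite cmod_cdot_scaled exprMn mulrCA.
rewrite -mulr_sumr e mulrA; apply: ler_wpM2r; first exact: sqr_ge0.
have d1 : 0 < d.+1%:R :> R by rewrite ltr0n.
rewrite mulrA ler_pdivrMr ?mulr_gt0// mulrC expr2 ler_pM2l// ler_pM2l//.
by rewrite ler_nat.
Qed.

End Moments.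

(** Minkowski's inequality in [L^2], expanded into pairwise Cauchy-Schwarz bounds. Pairs with a zero
    [u i] are treated apart, because the weighted inequality is divided by [u i * u l]. *)
Lemma second_moment_sum (N I : finType) (p : N -> R) (al : I -> N -> R) (u : I -> R) :
  (forall k, 0 <= p k) -> (forall i k, 0 <= al i k) -> (forall i, 0 <= u i) ->
  (forall i, \sum_k p k * al i k ^+ 2 <= 2 * u i ^+ 2) ->
  \sum_k p k * (\sum_i al i k) ^+ 2 <= 2 * (\sum_i u i) ^+ 2.
Proof.
move=> p0 al0 u0 alu.
have pair_le i l : \sum_k p k * (al i k * al l k) <= 2 * (u i * u l).
  have zero_case i' l' : u i' = 0 -> \sum_k p k * (al i' k * al l' k) = 0.
    move=> ui; apply: big1 => k _.
    have : \sum_k p k * al i' k ^+ 2 = 0.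
      apply/eqP; rewrite eq_le; apply/andP; split.
        by apply: le_trans (alu i') _; rewrite ui expr0n mulr0.
      by apply: sumr_ge0 => k' _; rewrite mulr_ge0 ?sqr_ge0.
    move/eqP; rewrite psumr_eq0 => [/allP/(_ k (mem_index_enum _))|k' _]; last first.
      by rewrite mulr_ge0 ?sqr_ge0.
    by rewrite mulf_eq0 sqrf_eq0 => /orP[|] /eqP ->; rewrite ?mul0r ?mulr0.
  have [ui|ui] := eqVneq (u i) 0; first by rewrite zero_case// ui mul0r mulr0.
  have [ul|ul] := eqVneq (u l) 0.
    under eq_bigr do rewrite [al i _ * _]mulrC.
    by rewrite zero_case// ul !mulr0.
  have uip : 0 < u i by rewrite lt_neqAle eq_sym ui u0.
  have ulp : 0 < u l by rewrite lt_neqAle eq_sym ul u0.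
  rewrite -(ler_pM2l (mulr_gt0 uip ulp)) -(ler_pM2l (ltr0n R 2)).
  apply: le_trans (_ : u l ^+ 2 * (\sum_k p k * al i k ^+ 2) +
      u i ^+ 2 * (\sum_k p k * al l k ^+ 2) <= _).
    rewrite !mulr_sumr -big_split /=; apply: ler_sum => k _.
    have := mulr_ge0 (p0 k) (sqr_ge0 (u l * al i k - u i * al l k)).
    by move: (p k) (u l) (u i) (al i k) (al l k) => *; lra.
  apply: le_trans (lerD (ler_wpM2l (sqr_ge0 _) (alu i)) (ler_wpM2l (sqr_ge0 _) (alu l))) _.
  by apply: eq_ler; ring.
under eq_bigr => k _.
  rewrite expr2 big_distrlr /= mulr_sumr.
  under eq_bigr do rewrite mulr_sumr.
  over.
rewrite exchange_big /= expr2 big_distrlr /= mulr_sumr; apply: ler_sum => i _.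
rewrite exchange_big /= mulr_sumr; apply: ler_sum => l _.
exact: pair_le.
Qed.

Section PairMoments.
Variables (d1 d2 N1 N2 t : nat).
Variables (w : 'I_N1 -> 'cV[C]_d1) (p : 'I_N1 -> R).
Variables (w' : 'I_N2 -> 'cV[C]_d2) (p' : 'I_N2 -> R).
Hypotheses (d1_gt0 : (0 < d1)%N) (d2_gt0 : (0 < d2)%N) (t_ge2 : (2 <= t)%N).
Hypotheses (design1 : weighted_projective_design t w p).
Hypotheses (design2 : weighted_projective_design t w' p').

Lemma pair_second_moment (Z : 'M[C]_(d1, d2)) :
  \sum_j \sum_k p j * p' k *
    cmod (measurement Z (scaled_design w j) (scaled_design w' k)) ^+ 2 = fnorm Z ^+ 2.
Proof.
rewrite exchange_big /=.
rewrite -(fnorm_ct Z) -(design_second_moment d2_gt0 t_ge2 design2 (Z ^t*)).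
apply: eq_bigr => k _.
rewrite -[fnorm (_ *m Z ^t*)]fnorm_ct ctmxM !trmxCK.
rewrite -(design_second_moment d1_gt0 t_ge2 design1 (Z *m _)) mulr_sumr.
apply: eq_bigr => j _; rewrite cmod_measurement mulmxA.
by rewrite [RHS]mulrCA [RHS]mulrA.
Qed.

(** For fixed [b], averaging over [a] gives [2 |Z b|^4]. Then [|Z b|^2] is a sum over the rows of
    [Z] of squared inner products with [b], and Minkowski brings the average over [b] back to single
    rows, with another factor 2. *)
Lemma pair_fourth_moment (Z : 'M[C]_(d1, d2)) :
  \sum_j \sum_k p j * p' k *
    cmod (measurement Z (scaled_design w j) (scaled_design w' k)) ^+ 4 <=
  4 * fnorm Z ^+ 4.
Proof.
have p0 j : 0 <= p j by case: design1.
have p'0 k : 0 <= p' k by case: design2.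
rewrite exchange_big /=.
apply: le_trans (_ : \sum_k p' k * (2 * (fnorm (Z *m scaled_design w' k) ^+ 2) ^+ 2) <= _).
  apply: ler_sum => k _.
  apply: le_trans (ler_wpM2l (p'0 k) (design_fourth_moment d1_gt0 t_ge2 design1 _)).
  rewrite mulr_sumr; apply: ler_sum => j _.
  by rewrite /measurement /cdot mulmxA [leRHS]mulrCA [leRHS]mulrA -exprM.
under eq_bigr do rewrite mulrCA.
rewrite -mulr_sumr; have -> : 4 * fnorm Z ^+ 4 = 2 * (2 * (fnorm Z ^+ 2) ^+ 2) by ring.
rewrite ler_pM2l//.
have rowE b : fnorm (Z *m b) ^+ 2 = \sum_i cmod (cdot b (col i (Z ^t*))) ^+ 2.
  rewrite -fnorm_ct ctmxM sqr_fnorm_col; apply: eq_bigr => i _.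
  by rewrite fnorm11 /cdot !colE mulmxA.
have -> : fnorm Z ^+ 2 = \sum_i fnorm (col i (Z ^t*)) ^+ 2.
  by rewrite -fnorm_ct sqr_fnorm_col.
under eq_bigr do rewrite rowE.
apply: second_moment_sum => // [i k|i|i]; rewrite ?sqr_ge0//.
exact: design_fourth_moment d2_gt0 t_ge2 design2 _.
Qed.

End PairMoments.

End DesignMoments.

Lemma product_weight_subset (R : realType) (J : finType) (q : J -> R) n
    (A B : pred {ffun 'I_n -> J}) : (forall j, 0 <= q j) ->
  (forall f, A f -> B f) ->
  \sum_(f | A f) product_weight q f <= \sum_(f | B f) product_weight q f.
Proof.
move=> q0 AB; rewrite big_mkcond [leRHS]big_mkcond; apply: ler_sum => f _.
have [/AB ->//|_] := boolP (A f).
by case: ifP => // _; exact: product_weight_ge0.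
Qed.

Lemma product_weight_union (R : realType) (J I : finType) (q : J -> R) n
    (A : pred {ffun 'I_n -> J}) (B : I -> pred {ffun 'I_n -> J}) :
  (forall j, 0 <= q j) -> (forall f, A f -> exists g, B g f) ->
  \sum_(f | A f) product_weight q f <=
  \sum_g \sum_(f | B g f) product_weight q f.
Proof.
move=> q0 AB; under [leRHS]eq_bigr do rewrite big_mkcond.
rewrite exchange_big big_mkcond; apply: ler_sum => f _.
have w0 : 0 <= product_weight q f by exact: product_weight_ge0.
have s0 (D : pred I) : 0 <= \sum_(g | D g) (if B g f then product_weight q f else 0).
  by apply: sumr_ge0 => g _; case: ifP.
case: ifP => [/AB[g Bg]|_]; last exact: s0.
by rewrite (bigD1 g)//= Bg lerDl s0.
Qed.

Lemma sqr_fnormB (R : realType) m n (A B : 'M[R[i]]_(m, n)) :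
  fnorm (A - B) ^+ 2 = fnorm A ^+ 2 - 2 * real_inner A B + fnorm B ^+ 2.
Proof.
rewrite (sqr_fnorm A) (sqr_fnorm B) sqr_fnorm real_innerBl !real_innerBr.
rewrite (real_innerC B A).
by move: (real_inner A A) (real_inner A B) (real_inner B B) => x y z; ring.
Qed.

(** * Probability of the good event *)

Section CovarianceConcentration.
Variables (R : realType) (J : finType) (q : J -> R).
Local Notation C := R[i].
#[local] Opaque real_inner cmod fnorm.
Hypotheses (q_ge0 : forall j, 0 <= q j) (q_sum : \sum_j q j = 1).
Variables (d r : nat) (a : J -> 'cV[C]_d) (U : 'M[C]_(d, r)).
Hypothesis a_norm : forall j, fnorm (a j) ^+ 2 = d%:R.
Hypothesis a_cov : \sum_j (q j)%:C *: (a j *m (a j) ^t*) = 1%:M.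
Hypothesis UU : U ^t* *m U = 1%:M.
Hypotheses (r_gt0 : (0 < r)%N) (r_le : (r <= d)%N).

Lemma sqr_fnorm_orthonormal : fnorm U ^+ 2 = r%:R.
Proof.
rewrite sqr_fnorm; have -> : real_inner U U = real_inner (1%:M : 'M[C]_r) 1%:M.
  by rewrite -{1}[U]mulmx1 real_inner_mull UU.
rewrite real_innerE; under eq_bigr => i _.
  rewrite (bigD1 i)//= !mxE eqxx big1 => [|k ki]; last first.
    by rewrite !mxE eq_sym (negbTE ki) !mul0r addr0.
  rewrite !addr0 mul0r mul1r addr0.
  over.
by rewrite sumr_const card_ord.
Qed.

Let v j : 'M[C]_(d, r) := a j *m ((a j) ^t* *m U) - U.

(** Only the action on the [r] orthonormal columns of [U] is controlled, so the variance is [d * r]: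
    the squared norm of [a a^* U] is at most [d] times that of [a^* U], which averages to [r].
    Controlling [a a^*] itself would cost [d^2]. *)
Lemma covariance_tail n (s : R) : 0 < s -> s <= 1 ->
  8 * (d%:R * r%:R) <= n%:R * s ^+ 2 ->
  4 * d%:R <= n%:R * s ->
  \sum_(f : {ffun 'I_n -> J} |
      s < fnorm (empirical_covariance (fun i => a (f i)) *m U - U))
    product_weight q f <= expR (- (128^-1 * (n%:R * s ^+ 2 / (d%:R * r%:R)))).
Proof.
move=> s0 s1 n1 n2.
have d0 : 0 < d%:R :> R by rewrite ltr0n (leq_trans r_gt0).
have r0 : 1 <= r%:R :> R by rewrite ler1n.
have rd : r%:R <= d%:R :> R by rewrite ler_nat.
have dr0 : 0 < d%:R * r%:R :> R by rewrite mulr_gt0// ltr0n.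
have v0 : \sum_j (q j)%:C *: v j = 0.
  under eq_bigr do rewrite /v scalerBr mulmxA scalemxAl.
  rewrite big_split /= -mulmx_suml a_cov mul1mx sumrN -scaler_suml -rmorph_sum /=.
  by rewrite q_sum rmorph1 scale1r subrr.
have aU2 : \sum_j q j * fnorm ((a j) ^t* *m U) ^+ 2 = r%:R.
  have -> : r%:R = real_inner U (1%:M *m U).
    by rewrite mul1mx -sqr_fnorm sqr_fnorm_orthonormal.
  rewrite -a_cov mulmx_suml real_inner_sumr; apply: eq_bigr => j _.
  by rewrite -scalemxAl real_innerZr sqr_fnorm real_inner_mull trmxCK mulmxA.
have aaU j : fnorm (a j *m ((a j) ^t* *m U)) ^+ 2 <= d%:R * fnorm ((a j) ^t* *m U) ^+ 2.
  rewrite -(a_norm j) -exprMn; apply: le_sqr; first exact: fnorm_ge0.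
  exact: fnormM.
have vV : \sum_j q j * fnorm (v j) ^+ 2 <= d%:R * r%:R.
  apply: le_trans (_ : \sum_j q j * (d%:R * fnorm ((a j) ^t* *m U) ^+ 2 -
     2 * fnorm ((a j) ^t* *m U) ^+ 2 + fnorm U ^+ 2) <= _).
    apply: ler_sum => j _; apply: ler_wpM2l => //.
    have -> : fnorm (v j) ^+ 2 = fnorm (a j *m ((a j) ^t* *m U)) ^+ 2 -
        2 * fnorm ((a j) ^t* *m U) ^+ 2 + fnorm U ^+ 2.
      have := sqr_fnormB (a j *m ((a j) ^t* *m U)) U.
      by rewrite (real_inner_mull (a j) ((a j) ^t* *m U) U) -(sqr_fnorm ((a j) ^t* *m U)).
    by rewrite !lerD2r.
  under eq_bigr do rewrite mulrDr mulrBr mulrCA [q _ * (2 * _)]mulrCA.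
  rewrite !big_split /= sumrN -!mulr_sumr -mulr_suml q_sum aU2 sqr_fnorm_orthonormal.
  by move: (d%:R * _) r0 => x r0; lra.
have vB j : fnorm (v j) <= 2 * d%:R.
  have d1 : d%:R <= d%:R * d%:R :> R by rewrite ler_peMl// ?ler1n ?(leq_trans r_gt0)// ltW.
  apply: le_trans (fnormB _ _) _; rewrite mulr_natl mulr2n; apply: lerD.
    apply: sqr_le; first exact: ltW.
    apply: le_trans (aaU j) _; rewrite expr2; apply: ler_wpM2l; first exact: ltW.
    rewrite -(a_norm j) -fnorm_ct ctmxM trmxCK; apply: le_sqr; first exact: fnorm_ge0.
    exact: fnorm_adj_isometry_le.
  apply: sqr_le; first exact: ltW.
  by rewrite sqr_fnorm_orthonormal expr2 (le_trans rd).
have sB : s * (2 * d%:R) <= 8 * (d%:R * r%:R).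
  apply: le_trans (_ : 2 * d%:R <= _); first by rewrite ler_piMl// mulr_ge0// ltW.
  have := ler_wpM2l (ltW d0) r0; rewrite mulr1; move: d0 => {rd dr0 n1 n2} d0.
  by move: (d%:R * r%:R) => x; lra.
have nB : 2 * (2 * d%:R) <= n%:R * s by rewrite mulrA -natrM.
apply: le_trans (vector_bernstein q_ge0 q_sum v0 vV vB dr0 s0 sB n1 nB).
have n0 : 0 < n%:R :> R.
  by rewrite -(pmulr_lgt0 _ s0) (lt_le_trans _ n2)// mulr_gt0.
apply: product_weight_subset => // f sf.
have -> : \sum_i v (f i) = n%:R%:C *:
    (empirical_covariance (fun i => a (f i)) *m U - U).
  rewrite /empirical_covariance scalerBr -scalemxAl scalerA -rmorphM /= divff ?gt_eqF//.
  rewrite scale1r mulmx_suml sumrB; congr (_ - _).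
    by apply: eq_bigr => i _; rewrite mulmxA.
  by rewrite sumr_const card_ord -scaler_nat rmorph_nat.
by rewrite fnormZ ger0_norm ?ler0n// ler_pM2l// ltW.
Qed.

End CovarianceConcentration.

(** * Uniform lower bound for the empirical modulus *)

Section ModulusConcentration.
Variables (R : realType) (J : finType) (q : J -> R).
Local Notation C := R[i].
#[local] Opaque real_inner cmod fnorm measurement.
Hypotheses (q_ge0 : forall j, 0 <= q j) (q_sum : \sum_j q j = 1).
Variables (d1 d2 r : nat) (a : J -> 'cV[C]_d1) (b : J -> 'cV[C]_d2).
Variables (U : 'M[C]_(d1, r)) (V : 'M[C]_(d2, r)).
Hypothesis a_norm : forall j, fnorm (a j) ^+ 2 = d1%:R.
Hypothesis b_norm : forall j, fnorm (b j) ^+ 2 = d2%:R.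
Hypothesis second : forall Z : 'M[C]_(d1, d2),
  \sum_j q j * cmod (measurement Z (a j) (b j)) ^+ 2 = fnorm Z ^+ 2.
Hypothesis fourth : forall Z : 'M[C]_(d1, d2),
  \sum_j q j * cmod (measurement Z (a j) (b j)) ^+ 4 <= 4 * fnorm Z ^+ 4.
Hypotheses (UU : U ^t* *m U = 1%:M) (VV : V ^t* *m V = 1%:M).
Hypotheses (r_gt0 : (0 < r)%N) (r_le1 : (r <= d1)%N) (r_le2 : (r <= d2)%N).

Local Notation modulus f Z :=
  (empirical_modulus (fun i => a (f i)) (fun i => b (f i)) Z).

Lemma modulus_tail n (Z : 'M[C]_(d1, d2)) : (0 < n)%N ->
  \sum_(f : {ffun 'I_n -> J} | modulus f Z < 8^-1 * fnorm Z) product_weight q f <=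
  expR (- (32^-1 * n%:R)).
Proof.
move=> n0; have [/fnorm_eq0 Z0|Z0] := eqVneq (fnorm Z) 0.
  rewrite big1 ?expR_ge0// => f; rewrite Z0 fnorm0 mulr0 ltNge.
  by rewrite empirical_modulus_ge0.
have Zp : 0 < fnorm Z by rewrite lt_neqAle eq_sym Z0 fnorm_ge0.
pose xi j := cmod (measurement Z (a j) (b j)) / fnorm Z.
have xi0 j : 0 <= xi j by rewrite divr_ge0 ?cmod_ge0 ?fnorm_ge0.
have m2 : \sum_j q j * xi j ^+ 2 = 1.
  under eq_bigr do rewrite expr_div_n mulrA.
  by rewrite -mulr_suml second divff// expf_neq0.
have m4 : \sum_j q j * xi j ^+ 4 <= 4.
  under eq_bigr do rewrite expr_div_n mulrA.
  by rewrite -mulr_suml ler_pdivrMr ?exprn_gt0// fourth.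
apply: le_trans (small_ball_tail q_ge0 q_sum n xi0 m2 m4).
apply: product_weight_subset => // f.
rewrite /xi -mulr_suml ler_pdivrMr// => /ltW.
rewrite /empirical_modulus mulrC ler_pdivrMr ?ltr0n//.
by rewrite mulrAC.
Qed.

Lemma cmod_measurement_design (Z : 'M[C]_(d1, d2)) j :
  cmod (measurement Z (a j) (b j)) <= (d1 + d2)%:R * fnorm Z.
Proof.
apply: le_trans (cmod_measurement_le _ _ _) _.
apply: ler_wpM2r; first exact: fnorm_ge0.
apply: sqr_le; first exact: ler0n.
rewrite exprMn a_norm b_norm -natrM -natrX ler_nat; nia.
Qed.

Lemma modulus_le n (f : {ffun 'I_n -> J}) (Z : 'M[C]_(d1, d2)) :
  modulus f Z <= (d1 + d2)%:R * fnorm Z.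
Proof.
rewrite /empirical_modulus.
(* For an empty sample the mean is zero, by the convention that zero is its own inverse. *)
have [n0|n0] := posnP n.
  have -> : n%:R^-1 = 0 :> R by rewrite n0 invr0.
  by rewrite mul0r mulr_ge0 ?ler0n ?fnorm_ge0.
rewrite mulrC ler_pdivrMr ?ltr0n//.
apply: le_trans (ler_sum _ (fun i _ => cmod_measurement_design Z (f i))) _.
by rewrite sumr_const card_ord mulr_natr.
Qed.

Variable m : nat.
Hypothesis m_large : (128 * (d1 + d2) ^ 2 <= m)%N.

(** A plain grid in each real coordinate, far from an optimal net. Its size matters only through a
    logarithm, which for [m] polynomial in [d1 + d2] is of order [ln (d1 + d2)]. *)
Definition grid_value (l : 'I_(2 * m).+1) : R := l%:R / m%:R - 1.

Definition grid_matrix k (g : {ffun 'I_k * 'I_r -> 'I_(2 * m).+1 * 'I_(2 * m).+1}) :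
    'M[C]_(k, r) :=
  \matrix_(i, l) (grid_value (g (i, l)).1 +i* grid_value (g (i, l)).2).

Lemma grid_value_approx (x : R) : (0 < m)%N -> -1 <= x -> x <= 1 ->
  exists l, `|x - grid_value l| <= m%:R^-1.
Proof.
move=> m0 x1 x2; have m0' : 0 < m%:R :> R by rewrite ltr0n.
have y0 : 0 <= (x + 1) * m%:R by rewrite mulr_ge0 ?ler0n//; lra.
have := truncn_itv y0; set l := Num.truncn _ => /andP[l1 l2].
have ll : (l < (2 * m).+1)%N.
  rewrite ltnS -(ler_nat R) natrM; apply: le_trans l1 _.
  by apply: ler_wpM2r; [exact: ler0n|lra].
exists (Ordinal ll); rewrite /grid_value /=.
have -> : x - (l%:R / m%:R - 1) = ((x + 1) * m%:R - l%:R) / m%:R.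
  by field; rewrite gt_eqF.
rewrite normrM [`|_^-1|]ger0_norm ?invr_ge0 ?ler0n// ler_piMl ?invr_ge0 ?ler0n//.
rewrite ger0_norm ?subr_ge0// lerBlDl -natr1 in l2 *.
exact: ltW.
Qed.

Lemma grid_matrix_approx k (A : 'M[C]_(k, r)) : (0 < m)%N -> (r <= k)%N ->
  fnorm A <= 1 -> exists g, fnorm (A - grid_matrix g) <= 2 * k%:R / m%:R.
Proof.
move=> m0 rk A1.
have ex i l : exists u : 'I_(2 * m).+1 * 'I_(2 * m).+1,
    `|complex.Re (A i l) - grid_value u.1| <= m%:R^-1 /\
    `|complex.Im (A i l) - grid_value u.2| <= m%:R^-1.
  have Ail := le_trans (cmod_entry_le A i l) A1.
  have /andP[r1 r2] : -1 <= complex.Re (A i l) <= 1.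
    by rewrite -ler_norml (le_trans (Re_le_cmod _)).
  have /andP[i1 i2] : -1 <= complex.Im (A i l) <= 1.
    by rewrite -ler_norml (le_trans (Im_le_cmod _)).
  have [u1 hu1] := grid_value_approx m0 r1 r2.
  have [u2 hu2] := grid_value_approx m0 i1 i2.
  by exists (u1, u2).
have [u hu] := choice (fun il : 'I_k * 'I_r => ex il.1 il.2).
exists [ffun il => u il].
apply: sqr_le.
  by rewrite divr_ge0 ?mulr_ge0 ?ler0n.
rewrite sqr_fnorm real_innerE.
apply: le_trans (_ : \sum_(i < k) \sum_(l < r) (2 * m%:R^-1 ^+ 2) <= _).
  apply: ler_sum => i _; apply: ler_sum => l _.
  rewrite !mxE ffunE; have [h1 h2] := hu (i, l).
  rewrite -!expr2 cReD cImD cReN cImN /= mulr_natl mulr2n; apply: lerD.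
    by rewrite -real_normK ?num_real// le_sqr.
  by rewrite -real_normK ?num_real// le_sqr.
rewrite !sumr_const !card_ord -mulrnA -[leLHS]mulr_natr natrM.
have rk' : r%:R <= k%:R :> R by rewrite ler_nat.
have -> : (2 * k%:R / m%:R) ^+ 2 = 2 * m%:R^-1 ^+ 2 * (2 * k%:R * k%:R) :> R by ring.
apply: ler_wpM2l; first by rewrite mulr_ge0 ?sqr_ge0.
apply: ler_wpM2r; first exact: ler0n.
by apply: le_trans rk' _; rewrite ler_peMl ?ler0n// ler1n.
Qed.

Lemma ctmxZ_real m1 n1 (x : R) (A : 'M[C]_(m1, n1)) :
  (x%:C *: A) ^t* = x%:C *: A ^t*.
Proof. by apply/matrixP => i j; rewrite !mxE rmorphM /= conj_real. Qed.

Lemma modulusZ n (f : {ffun 'I_n -> J}) (x : R) (Z : 'M[C]_(d1, d2)) :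
  modulus f (x%:C *: Z) = `|x| * modulus f Z.
Proof.
rewrite /empirical_modulus [RHS]mulrCA; congr (_ * _); rewrite mulr_sumr.
apply: eq_bigr => i _.
by rewrite !cmod_measurement -scalemxAr -scalemxAl fnormZ.
Qed.

(* A representation of a tangent vector by factors no larger than it. *)
Lemma tangent_decomposition (H : 'M[C]_(d1, r)) (K : 'M[C]_(d2, r)) :
  let Z := H *m V ^t* + U *m K ^t* in
  Z = (Z *m V) *m V ^t* +
      U *m (Z ^t* *m U - V *m (V ^t* *m (Z ^t* *m U))) ^t*.
Proof.
move=> Z; have ZV : Z *m V = H + U *m (K ^t* *m V).
  by rewrite /Z mulmxDl -!mulmxA VV mulmx1.
have ZU : Z ^t* *m U = V *m (H ^t* *m U) + K.
  by rewrite /Z ctmxD !ctmxM !trmxCK mulmxDl -!mulmxA UU mulmx1.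
rewrite ZV ZU mulmxDr [V ^t* *m (V *m _)]mulmxA VV mul1mx mulmxDr.
rewrite opprD addrACA subrr add0r mulmxDl ctmxB !ctmxM trmxCK mulmxBr /Z.
rewrite -!mulmxA -addrA; congr (_ + _).
by rewrite [RHS]addrC subrK.
Qed.

Lemma tangent_fnorm_le (H : 'M[C]_(d1, r)) (K : 'M[C]_(d2, r)) :
  fnorm (H *m V ^t* + U *m K ^t*) <= fnorm H + fnorm K.
Proof.
apply: le_trans (fnormD _ _) _; rewrite (fnorm_isometry _ UU) fnorm_ct.
by rewrite -[fnorm (_ *m _)]fnorm_ct ctmxM trmxCK (fnorm_isometry _ VV) fnorm_ct.
Qed.

Lemma net_modulus_ge n (f : {ffun 'I_n -> J}) :
  (forall g1 g2,
    8^-1 * fnorm (@grid_matrix d1 g1 *m V ^t* + U *m (@grid_matrix d2 g2) ^t*) <=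
    modulus f (grid_matrix g1 *m V ^t* + U *m (grid_matrix g2) ^t*)) ->
  forall (H : 'M[C]_(d1, r)) (K : 'M[C]_(d2, r)),
    16^-1 * fnorm (H *m V ^t* + U *m K ^t*) <= modulus f (H *m V ^t* + U *m K ^t*).
Proof.
move=> net H K.
have [/fnorm_eq0 ->|Z0] := eqVneq (fnorm (H *m V ^t* + U *m K ^t*)) 0.
  by rewrite fnorm0 mulr0 empirical_modulus_ge0.
have Zp : 0 < fnorm (H *m V ^t* + U *m K ^t*) by rewrite lt_neqAle eq_sym Z0 fnorm_ge0.
set x := (fnorm (H *m V ^t* + U *m K ^t*))^-1.
have x0 : 0 < x by rewrite invr_gt0.
have ZE : x%:C *: (H *m V ^t* + U *m K ^t*) =
    (x%:C *: H) *m V ^t* + U *m (x%:C *: K) ^t*.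
  by rewrite scalerDr ctmxZ_real -scalemxAl -scalemxAr.
rewrite -(ler_pM2l x0) mulrCA.
have -> : x * fnorm (H *m V ^t* + U *m K ^t*) = 1 by rewrite mulVf.
have -> : x * modulus f (H *m V ^t* + U *m K ^t*) =
    modulus f (x%:C *: (H *m V ^t* + U *m K ^t*)) by rewrite modulusZ gtr0_norm.
have Z1 : fnorm (x%:C *: (H *m V ^t* + U *m K ^t*)) = 1.
  by rewrite fnormZ gtr0_norm// mulVf.
rewrite mulr1; move: Z1; rewrite ZE.
move: (x%:C *: H) (x%:C *: K) => {Z0 Zp x0 ZE x}H {}K.
rewrite tangent_decomposition.
have := tangent_decomposition H K; set Z := H *m V ^t* + U *m K ^t* => ZE.
rewrite -ZE => Z1.
have d1_gt0 : (0 < d1)%N := leq_trans r_gt0 r_le1.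
have m0 : (0 < m)%N by apply: leq_trans m_large; rewrite muln_gt0 expn_gt0 addn_gt0 d1_gt0.
have H1 : fnorm (Z *m V) <= 1.
  by rewrite -Z1 -fnorm_ct ctmxM -(fnorm_ct Z) fnorm_adj_isometry_le.
have K1 : fnorm (Z ^t* *m U - V *m (V ^t* *m (Z ^t* *m U))) <= 1.
  apply: le_trans (fnorm_coproj_le _ VV) _.
  by rewrite -Z1 -fnorm_ct ctmxM trmxCK fnorm_adj_isometry_le.
have [g1 hg1] := grid_matrix_approx m0 r_le1 H1.
have [g2 hg2] := grid_matrix_approx m0 r_le2 K1.
have := net g1 g2; set Zg := grid_matrix g1 *m _ + _ => Zg_ge.
have W : fnorm (Z - Zg) <= 2 * (d1 + d2)%:R / m%:R.
  have -> : Z - Zg = (Z *m V - grid_matrix g1) *m V ^t* +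
      U *m (Z ^t* *m U - V *m (V ^t* *m (Z ^t* *m U)) - grid_matrix g2) ^t*.
    have gen A B : Z = A *m V ^t* + U *m B ^t* -> Z - Zg =
        (A - grid_matrix g1) *m V ^t* + U *m (B - grid_matrix g2) ^t*.
      by move=> ->; rewrite mulmxBl ctmxB mulmxBr opprD addrACA.
    exact: gen ZE.
  apply: le_trans (tangent_fnorm_le _ _) _; apply: le_trans (lerD hg1 hg2) _.
  by rewrite -mulrDl -mulrDr natrD.
have mR : 128 * (d1 + d2)%:R ^+ 2 <= m%:R :> R by rewrite -natrX -natrM ler_nat.
have mp : 0 < m%:R :> R by rewrite ltr0n.
have d_ge1 : 1 <= (d1 + d2)%:R :> R by rewrite ler1n addn_gt0 d1_gt0.
have W1 : (d1 + d2)%:R * fnorm (Z - Zg) <= 64^-1.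
  apply: le_trans (ler_wpM2l (ler0n _ _) W) _.
  rewrite mulrA ler_pdivrMr//; move: mR; rewrite expr2.
  move: {W Zg_ge hg1 hg2 H1 K1 Z1} (d1 + d2)%:R (m%:R) => x y *.
  lra.
have W2 : fnorm (Z - Zg) <= 64^-1.
  by apply: le_trans W1; rewrite ler_peMl ?fnorm_ge0.
have h1 := empirical_modulusD (fun i => a (f i)) (fun i => b (f i)) Z (Zg - Z).
rewrite addrC subrK in h1.
have h2 := modulus_le f (Zg - Z); rewrite fnormBC in h2.
have h3 := fnorm_ge_sub Z Zg; rewrite Z1 in h3.
move: (le_trans h2 W1) h1 h3 W2 Zg_ge.
move: {H1 K1 Z1 hg1 hg2 W W1 h2} (modulus f (Zg - Z)) (modulus f Z) (modulus f Zg).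
by move: (fnorm Zg) (fnorm (Z - Zg)) => *; lra.
Qed.

Lemma modulus_ge_tail n : (0 < n)%N ->
  \sum_(f : {ffun 'I_n -> J} | ~~ `[< forall (H : 'M[C]_(d1, r)) (K : 'M[C]_(d2, r)),
      16^-1 * fnorm (H *m V ^t* + U *m K ^t*) <=
      modulus f (H *m V ^t* + U *m K ^t*) >]) product_weight q f <=
  ((2 * m).+1 ^ (2 * (r * (d1 + d2))))%:R * expR (- (32^-1 * n%:R)).
Proof.
move=> n0; pose net := ({ffun 'I_d1 * 'I_r -> 'I_(2 * m).+1 * 'I_(2 * m).+1} *
  {ffun 'I_d2 * 'I_r -> 'I_(2 * m).+1 * 'I_(2 * m).+1})%type.
pose Zg (g : net) := grid_matrix g.1 *m V ^t* + U *m (grid_matrix g.2) ^t*.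
(* The exponent counts two real coordinates for each of the [r * (d1 + d2)] entries. *)
have cardnet : #|[the finType of net]| = ((2 * m).+1 ^ (2 * (r * (d1 + d2))))%N.
  rewrite card_prod !card_ffun !card_prod !card_ord.
  by rewrite -expnD -mulnDl mulnn -expnM [((_ + _) * r)%N]mulnC.
apply: le_trans (product_weight_union (B := fun g f =>
    modulus f (Zg g) < 8^-1 * fnorm (Zg g)) q_ge0 _) _ => [f|].
  apply: contraPP => /forallNP good; apply/negP; rewrite negbK; apply/asboolP.
  apply: net_modulus_ge => g1 g2.
  by rewrite leNgt; apply/negP; exact: (good (g1, g2)).
apply: le_trans (ler_sum _ (fun g _ => modulus_tail (Zg g) n0)) _.
rewrite sumr_const -[leLHS]mulr_natl; apply: ler_wpM2r; first exact: expR_ge0.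
by rewrite ler_nat -cardnet.
Qed.

End ModulusConcentration.

Lemma ln_ge_half (R : realType) (d : nat) : (2 <= d)%N -> 2^-1 <= ln (d%:R : R).
Proof.
move=> d2; rewrite -ler_expR lnK ?posrE ?ltr0n; last exact: leq_trans d2.
apply: le_trans (_ : 2 <= _); last by rewrite ler_nat.
have h := expR_ge1Dx (- 2^-1 : R).
rewrite -[expR _]invrK -expRN -[leRHS]invrK lef_pV2 ?posrE ?expR_gt0 ?invr_gt0//.
by apply: le_trans h; lra.
Qed.

(** One of the eight copies of [Lam] pays for [delta]; the other seven amount to at least [7/2], and
    [exp (7/2) >= 9/2] pays for the factor [1/4]. *)
Lemma expR_tail (R : realType) (delta Lam x : R) : 0 < delta ->
  ln (1 / delta) <= Lam -> 2^-1 <= Lam -> 8 * Lam <= x ->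
  expR (- x) <= 4^-1 * delta.
Proof.
move=> d0 ld L2 Lx.
apply: le_trans (_ : expR (- (7 / 2)) * expR (- Lam) <= _).
  by rewrite -expRD ler_expR; lra.
apply: ler_pM; rewrite ?expR_ge0//.
  have h := expR_ge1Dx (7 / 2 : R).
  by rewrite expRN lef_pV2 ?posrE ?expR_gt0//; apply: le_trans h; lra.
rewrite expRN -[leRHS]invrK lef_pV2 ?posrE ?expR_gt0 ?invr_gt0//.
rewrite -[leLHS]lnK ?posrE ?invr_gt0// ler_expR.
by apply: le_trans ld; rewrite div1r.
Qed.

(** Writes the number of grid values as a power of [d], so that the logarithm of the net size is a
    multiple of [ln d]. *)
Lemma net_size (d : nat) : (2 <= d)%N -> ((2 * (128 * d ^ 2)).+1 <= d ^ 11)%N.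
Proof.
move=> d2; have h : (512 <= d ^ 9)%N.
  by rewrite (_ : 512 = 2 ^ 9)%N// leq_exp2r.
have -> : (d ^ 11 = d ^ 9 * d ^ 2)%N by rewrite -expnD.
by have : (1 <= d ^ 2)%N; [rewrite expn_gt0; lia | nia].
Qed.

(** * The good event and its probability *)

Section FiniteGoodEvent.
Variables (R : realType) (J : finType) (q : J -> R).
Local Notation C := R[i].
#[local] Opaque real_inner cmod fnorm measurement.
Hypotheses (q_ge0 : forall j, 0 <= q j) (q_sum : \sum_j q j = 1).
Variables (d1 d2 r : nat) (a : J -> 'cV[C]_d1) (b : J -> 'cV[C]_d2).
Variables (U : 'M[C]_(d1, r)) (V : 'M[C]_(d2, r)).
Hypothesis a_norm : forall j, fnorm (a j) ^+ 2 = d1%:R.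
Hypothesis b_norm : forall j, fnorm (b j) ^+ 2 = d2%:R.
Hypothesis a_cov : \sum_j (q j)%:C *: (a j *m (a j) ^t*) = 1%:M.
Hypothesis b_cov : \sum_j (q j)%:C *: (b j *m (b j) ^t*) = 1%:M.
Hypothesis second : forall Z : 'M[C]_(d1, d2),
  \sum_j q j * cmod (measurement Z (a j) (b j)) ^+ 2 = fnorm Z ^+ 2.
Hypothesis fourth : forall Z : 'M[C]_(d1, d2),
  \sum_j q j * cmod (measurement Z (a j) (b j)) ^+ 4 <= 4 * fnorm Z ^+ 4.
Hypotheses (UU : U ^t* *m U = 1%:M) (VV : V ^t* *m V = 1%:M).
Hypotheses (r_gt0 : (0 < r)%N) (r_le1 : (r <= d1)%N) (r_le2 : (r <= d2)%N).

Definition good_sample (s : R) n (a' : 'I_n -> 'cV[C]_d1) (b' : 'I_n -> 'cV[C]_d2) :=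
  [/\ forall (H : 'M[C]_(d1, r)) (K : 'M[C]_(d2, r)),
        16^-1 * fnorm (H *m V ^t* + U *m K ^t*) <=
        empirical_modulus a' b' (H *m V ^t* + U *m K ^t*),
      fnorm (empirical_covariance a' *m U - U) <= s &
      fnorm (empirical_covariance b' *m V - V) <= s].

(** Each of the three failures has probability at most [delta / 4]. The covariances use the full
    bound on [n * s ^+ 2]; for the modulus the weaker bound on [n], which follows from [s <= 1],
    already beats the size of the net. *)
Lemma good_sample_tail n (s Lam delta : R) : 0 < s -> s <= 1 ->
  0 < delta -> ln (d1 + d2)%:R <= Lam -> ln (1 / delta) <= Lam ->
  64 * (64 * (r%:R * (d1 + d2)%:R * Lam)) <= n%:R * s ^+ 2 ->
  \sum_(f : {ffun 'I_n -> J} |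
      ~~ `[< good_sample s (fun i => a (f i)) (fun i => b (f i)) >])
    product_weight q f <= delta.
Proof.
move=> s0 s1 dl0 Ld Ldelta hn.
have dd2 : (2 <= d1 + d2)%N := leq_add (leq_trans r_gt0 r_le1) (leq_trans r_gt0 r_le2).
have dd0 : (0 < d1 + d2)%N := ltnW dd2.
have L2 : 2^-1 <= Lam := le_trans (ln_ge_half R dd2) Ld.
have Lam0 : 0 <= Lam by apply: le_trans L2; rewrite invr_ge0.
have r1 : 1 <= r%:R :> R by rewrite ler1n.
have dR : (d1 + d2)%:R = d1%:R + d2%:R :> R by rewrite natrD.
have rd1 : r%:R <= d1%:R :> R by rewrite ler_nat.
have rd2 : r%:R <= d2%:R :> R by rewrite ler_nat.
have rdL : r%:R * (d1 + d2)%:R <= 2 * (r%:R * (d1 + d2)%:R * Lam).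
  have rD0 : 0 <= r%:R * (d1 + d2)%:R :> R by rewrite mulr_ge0 ?ler0n.
  by have := ler_wpM2l rD0 L2; move: (r%:R * _) => ?; move: (_ * Lam) => *; lra.
have rD : (d1 + d2)%:R <= r%:R * (d1 + d2)%:R :> R by rewrite ler_peMl ?ler0n.
have D1 : 1 <= (d1 + d2)%:R :> R by rewrite ler1n.
have nn : n%:R * s ^+ 2 <= n%:R * s.
  by apply: ler_wpM2l; [exact: ler0n | rewrite expr2 ler_piMr// ltW].
have nn1 : n%:R * s <= n%:R by rewrite ler_piMr ?ler0n.
have n0 : (0 < n)%N.
  rewrite -(ltr0n R); apply: lt_le_trans nn1; apply: lt_le_trans nn.
  apply: lt_le_trans hn; by rewrite !mulr_gt0 ?ltr0n//; lra.
have cov (dk : nat) (c : J -> 'cV[C]_dk) (W : 'M[C]_(dk, r)) : (r <= dk)%N ->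
    dk%:R <= (d1 + d2)%:R :> R -> (forall j, fnorm (c j) ^+ 2 = dk%:R) ->
    \sum_j (q j)%:C *: (c j *m (c j) ^t*) = 1%:M -> W ^t* *m W = 1%:M ->
    \sum_(f : {ffun 'I_n -> J} |
      s < fnorm (empirical_covariance (fun i => c (f i)) *m W - W))
      product_weight q f <= 4^-1 * delta.
  move=> rdk dkd c_norm c_cov WW.
  apply: le_trans (covariance_tail q_ge0 q_sum c_norm c_cov WW r_gt0 rdk s0 s1 _ _) _.
  - apply: le_trans hn; apply: le_trans (_ : 8 * (2 * (r%:R * (d1 + d2)%:R * Lam)) <= _).
      rewrite ler_pM2l//; apply: le_trans rdL.
      by rewrite mulrC; apply: ler_wpM2l; [exact: ler0n|].
    have : 0 <= r%:R * (d1 + d2)%:R * Lam by rewrite mulr_ge0 ?mulr_ge0 ?ler0n.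
    by move: (_ * Lam) => *; lra.
  - apply: le_trans nn; apply: le_trans hn.
    apply: le_trans (_ : 4 * (2 * (r%:R * (d1 + d2)%:R * Lam)) <= _).
      by rewrite ler_pM2l//; apply: le_trans rdL; exact: le_trans rD.
    have : 0 <= r%:R * (d1 + d2)%:R * Lam by rewrite mulr_ge0 ?mulr_ge0 ?ler0n.
    by move: (_ * Lam) => *; lra.
  apply: expR_tail dl0 Ldelta L2 _.
  have dkr0 : 0 < dk%:R * r%:R :> R by rewrite mulr_gt0 ?ltr0n// (leq_trans r_gt0).
  rewrite mulrA ler_pdivlMr//.
  have : dk%:R * r%:R * Lam <= r%:R * (d1 + d2)%:R * Lam.
    apply: ler_wpM2r => //.
    by rewrite mulrC; apply: ler_wpM2l; [exact: ler0n|].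
  have : 0 <= r%:R * (d1 + d2)%:R * Lam by rewrite mulr_ge0 ?mulr_ge0 ?ler0n.
  have -> : 8 * Lam * (dk%:R * r%:R) = 8 * (dk%:R * r%:R * Lam) by ring.
  move: {rdL nn nn1} hn; move: (n%:R * _) (dk%:R * _ * _) (r%:R * _ * _) => x z y.
  by move=> *; lra.
have E1 := modulus_ge_tail q_ge0 q_sum a_norm b_norm second fourth UU VV r_gt0
  r_le1 r_le2 (leqnn (128 * (d1 + d2) ^ 2)) n0.
(* The constant [22] is the exponent [11] of [net_size] times the two real coordinates per entry. *)
have countE : ((2 * (128 * (d1 + d2) ^ 2)).+1 ^ (2 * (r * (d1 + d2))))%:R <=
    expR (22 * (r%:R * (d1 + d2)%:R * Lam)) :> R.
  apply: le_trans (_ : ((d1 + d2) ^ (22 * (r * (d1 + d2))))%:R <= _).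
    have -> : (22 * (r * (d1 + d2)) = 11 * (2 * (r * (d1 + d2))))%N by rewrite [RHS]mulnA.
    rewrite ler_nat (expnM _ 11) leq_exp2r; last by rewrite !muln_gt0 r_gt0.
    exact: net_size.
  have D0 : 0 < (d1 + d2)%:R :> R by lra.
  rewrite natrX -[X in X ^+ _](lnK D0) -expRM_natl ler_expR !natrM.
  rewrite -mulrA ler_pM2l// ler_wpM2l// mulr_ge0 ?ler0n//.
have E2 := cov d1 a U r_le1 _ a_norm a_cov UU.
have E3 := cov d2 b V r_le2 _ b_norm b_cov VV.
pose B (g : 'I_3) (f : {ffun 'I_n -> J}) := match val g with
  | 0%N => ~~ `[< forall (H : 'M[C]_(d1, r)) (K : 'M[C]_(d2, r)),
      16^-1 * fnorm (H *m V ^t* + U *m K ^t*) <=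
      empirical_modulus (fun i => a (f i)) (fun i => b (f i))
        (H *m V ^t* + U *m K ^t*) >]
  | 1%N => s < fnorm (empirical_covariance (fun i => a (f i)) *m U - U)
  | _ => s < fnorm (empirical_covariance (fun i => b (f i)) *m V - V)
  end.
apply: le_trans (product_weight_union (B := B) q_ge0 _) _ => [f|].
  move=> bad; apply: contrapT => /forallNP good; move/negP: bad; apply; apply/asboolP.
  split.
  - by apply/asboolP; apply/negPn/negP; exact: (good (@Ordinal 3 0 isT)).
  - by rewrite leNgt; apply/negP; exact: (good (@Ordinal 3 1 isT)).
  - by rewrite leNgt; apply/negP; exact: (good (@Ordinal 3 2 isT)).
rewrite !big_ord_recl big_ord0 /B /= addr0.
apply: le_trans (lerD E1 (lerD (E2 _) (E3 _))) _.
- by rewrite dR lerDl ler0n.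
- by rewrite dR lerDr ler0n.
apply: le_trans (_ : _ <= 4^-1 * delta + (4^-1 * delta + 4^-1 * delta)) _; last by lra.
  rewrite lerD2r; apply: le_trans (ler_wpM2r (expR_ge0 _) countE) _.
  rewrite -expRD.
  have -> : 22 * (r%:R * (d1 + d2)%:R * Lam) + - (32^-1 * n%:R) =
      - (32^-1 * n%:R - 22 * (r%:R * (d1 + d2)%:R * Lam)) by ring.
  apply: expR_tail dl0 Ldelta L2 _.
  have h1 := le_trans hn (le_trans nn nn1).
  have h2 : Lam <= r%:R * (d1 + d2)%:R * Lam.
    by rewrite ler_peMl//; apply: le_trans rD.
  move: {hn nn nn1 rdL E2 E3 countE} h1 h2 Lam0; move: (r%:R * _ * Lam) (n%:R) => X N h1 h2 Lam0.
  lra.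
Qed.

End FiniteGoodEvent.

(** * Transfer to the sample *)

Section Sampling.
Context {R : realType} {disp : measure_display} {T : measurableType disp}.
Variable P : probability T R.
Local Notation C := R[i].

Lemma borel_cvecC m (A : set 'cV[C]_m) : borel_cvec A -> borel_cvec (~` A).
Proof. by move=> hA; rewrite -setTD; exact: sigma_algebraCD. Qed.

Lemma borel_cvecU m (A B : set 'cV[C]_m) :
  borel_cvec A -> borel_cvec B -> borel_cvec (A `|` B).
Proof.
move=> hA hB; rewrite -bigcup2E; apply: sigma_algebra_bigcup => -[|[|k]] //=.
exact: sigma_algebra0.
Qed.

Lemma borel_cvecI m (A B : set 'cV[C]_m) :
  borel_cvec A -> borel_cvec B -> borel_cvec (A `&` B).
Proof.
move=> hA hB; rewrite -[A `&` B]setCK setCI.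
by apply: borel_cvecC; apply: borel_cvecU; exact: borel_cvecC.
Qed.

Lemma borel_cvec_set1 m (v : 'cV[C]_m) : borel_cvec [set v].
Proof.
pose F (i : 'I_m) : set 'cV[C]_m :=
  (fun u : 'cV[C]_m => complex.Re (u i 0)) @^-1` [set complex.Re (v i 0)] `&`
  (fun u : 'cV[C]_m => complex.Im (u i 0)) @^-1` [set complex.Im (v i 0)].
have -> : [set v] = \big[setI/setT]_(i < m) F i.
  apply/seteqP; split => [u ->|u].
    by elim/big_ind: _ => // A B hA hB; split.
  move=> Fu; apply/colP => i; move: Fu; rewrite (bigD1 i)//= => -[[/= re im] _].
  by move: re im; case: (u i 0) (v i 0) => ? ? [? ?] /= -> ->.
elim/big_ind: _ => [|A B|i _]; [|exact: borel_cvecI|].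
  by rewrite -setC0; apply: borel_cvecC; exact: sigma_algebra0.
by apply: borel_cvecI; apply: sub_sigma_algebra; exists i;
  [exists [set complex.Re (v i 0)] | exists [set complex.Im (v i 0)]];
  split=> //; [left | right].
Qed.

(** The event is the union, over good [f], of the sets where the sample equals [c] composed with
    [f]. Injectivity of [c] makes these sets disjoint, so that the probabilities add up exactly. *)
Lemma product_sample_event m n (J : finType) (q : J -> R)
    (Z : 'I_n -> T -> 'cV[C]_m) (c : J -> 'cV[C]_m) (good : pred {ffun 'I_n -> J}) :
  injective c -> (forall i, random_vector (Z i)) -> mutually_independent P Z ->
  (forall i j, P (Z i @^-1` [set c j]) = (q j)%:E) ->
  exists E : set T, [/\ measurable E,
    P E = (\sum_(f | good f) product_weight q f)%:E &
    forall o, E o -> exists2 f, good f & forall i, Z i o = c (f i)].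
Proof.
move=> c_inj Z_meas Z_ind Zq.
pose F (f : {ffun 'I_n -> J}) : set T :=
  \bigcap_(i in [set: 'I_n]) Z i @^-1` [set c (f i)].
have mF f : measurable (F f).
  apply: fin_bigcap_measurable => [|i _]; first exact: finite_finset.
  exact: (Z_meas i _ (borel_cvec_set1 _)).
have PF f : P (F f) = (product_weight q f)%:E.
  rewrite /F Z_ind => [|i]; last exact: borel_cvec_set1.
  by rewrite -prodEFin; apply: eq_bigr => i _; rewrite Zq.
exists (\bigcup_(f in [set f | good f]) F f); split.
- by apply: fin_bigcup_measurable => //; exact: finite_finset.
- rewrite measure_fin_bigcup//; [|exact: finite_finset|]; last first.
    apply/trivIsetP => f g _ _ fg; rewrite -subset0 => o [/= Ff Fg].
    move/eqP: fg; apply; apply/ffunP => i; apply: c_inj.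
    by rewrite -(Ff i)// -(Fg i).
  rewrite (fsbigE [seq f <- index_enum _ | good f]).
  + rewrite big_filter_cond -sumEFin; apply: eq_big => [f|f _]; last exact: PF.
    by case gf: (good f) => //=; apply/mem_set.
  + by rewrite filter_uniq// index_enum_uniq.
  + by move=> f /=; rewrite mem_filter => /andP[].
  + by move=> f /= gf; rewrite mem_filter gf mem_index_enum.
by move=> o [f /= gf Ff]; exists f => // i; exact: Ff.
Qed.

End Sampling.

Section DistinctValues.
Variables (R : realType) (J0 : finType) (m : nat).
Local Notation C := R[i].
Variables (point : J0 -> 'cV[C]_m) (mu : J0 -> R).

(* Points of the design may coincide, and only their values are observable. *)
Definition value := seq_sub (codom point).

Definition value_weight (v : value) : R := \sum_(j | point j == val v) mu j.

Lemma sum_over_values (W : nmodType) (X : J0 -> W) :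
  \sum_(v : value) \sum_(j | point j == val v) X j = \sum_j X j.
Proof.
pose h j : value := SeqSub (codom_f point j).
rewrite [RHS](partition_big h predT)//=; apply: eq_bigr => v _.
Qed.

Lemma sum_value_weight (F : 'cV[C]_m -> R) :
  \sum_v value_weight v * F (val v) = \sum_j mu j * F (point j).
Proof.
rewrite -(sum_over_values (fun j => mu j * F (point j))).
by apply: eq_bigr => v _; rewrite mulr_suml; apply: eq_bigr => j /eqP ->.
Qed.

Lemma sum_value_weightZ k l (F : 'cV[C]_m -> 'M[C]_(k, l)) :
  \sum_v (value_weight v)%:C *: F (val v) = \sum_j (mu j)%:C *: F (point j).
Proof.
rewrite -(sum_over_values (fun j => (mu j)%:C *: F (point j))).
apply: eq_bigr => v _; rewrite rmorph_sum /= scaler_suml.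
by apply: eq_bigr => j /eqP ->.
Qed.

End DistinctValues.

(** Here [s] and [L] are the extreme nonzero singular values and [M] is the spectral norm. The
    conclusion is the anchor condition cleared of denominators, as the factor estimates use it. *)
Lemma anchor_arith (R : realType) (e s L M tau : R) (r : nat) :
  0 <= e -> 0 < s -> s <= L -> M <= L -> (0 < r)%N ->
  tau <= e * (Num.sqrt r%:R)^-1 * (L / s) ^- 2 * M ->
  tau * Num.sqrt r%:R * L <= e * (s * s).
Proof.
move=> e0 s0 sL ML r0 tau_le.
have L0 : 0 < L := lt_le_trans s0 sL.
have sr0 : 0 < Num.sqrt r%:R :> R by rewrite sqrtr_gt0 ltr0n.
have k0 : 0 <= e * (Num.sqrt r%:R)^-1 * (L / s) ^- 2.
  apply: mulr_ge0; first by rewrite mulr_ge0// invr_ge0 ltW.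
  by rewrite invr_ge0 exprn_ge0// divr_ge0 ?ltW.
have h := le_trans tau_le (ler_wpM2l k0 ML).
have srL : 0 <= Num.sqrt r%:R * L by rewrite mulr_ge0 ?ltW.
rewrite -mulrA; apply: le_trans (ler_wpM2r srL h) _.
rewrite le_eqVlt; apply/orP; left; apply/eqP; field.
by rewrite !gt_eqF.
Qed.

(** Origin of [64 ^+ 6]: a factor [64 ^+ 2] comes from the tail bounds and [(64 * 64) ^+ 2] from the
    squared accuracy. The remaining part of that square, [(ps / qs) ^+ 2], is the inverse condition
    number. *)
Lemma sample_size_arith (R : realType) (ps qs x n : R) : 0 < ps -> 0 < qs ->
  64 ^+ 6 * (qs ^+ 2 / ps ^+ 2) * x <= n ->
  64 * (64 * x) <= n * ((64 * 64)^-1 * (ps / qs)) ^+ 2.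
Proof.
move=> ps0 qs0 h.
have -> : 64 * (64 * x) =
    64 ^+ 6 * (qs ^+ 2 / ps ^+ 2) * x * ((64 * 64)^-1 * (ps / qs)) ^+ 2.
  by field; rewrite !gt_eqF.
by apply: ler_wpM2r h; rewrite sqr_ge0.
Qed.

Section PairLaw.
Context {R : realType} {disp : measure_display} {T : measurableType disp}.
Variables (P : probability T R) (d1 d2 N1 N2 : nat).
Variables (w : 'I_N1 -> 'cV[R[i]]_d1) (p : 'I_N1 -> R).
Variables (w' : 'I_N2 -> 'cV[R[i]]_d2) (p' : 'I_N2 -> R).

Definition design_pair (jk : 'I_N1 * 'I_N2) :=
  col_mx (scaled_design w jk.1) (scaled_design w' jk.2).
Definition pair_weight (jk : 'I_N1 * 'I_N2) := p jk.1 * p' jk.2.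

Lemma pair_law (a : T -> 'cV[R[i]]_d1) (b : T -> 'cV[R[i]]_d2) v :
  drawn_from_design P w p a -> drawn_from_design P w' p' b -> independent P a b ->
  P ((fun o => col_mx (a o) (b o)) @^-1` [set v]) =
  (\sum_(jk | design_pair jk == v) pair_weight jk)%:E.
Proof.
move=> [_ a_law] [_ b_law] indep.
have -> : (fun o => col_mx (a o) (b o)) @^-1` [set v] =
    a @^-1` [set usubmx v] `&` b @^-1` [set dsubmx v].
  apply/seteqP; split => o /=.
    by move=> <-; rewrite col_mxKu col_mxKd.
  by move=> [-> ->]; rewrite vsubmxK.
rewrite indep ?a_law ?b_law; try exact: borel_cvec_set1.
rewrite -EFinM big_distrlr /= pair_big /=; congr (_%:E).
apply: eq_bigl => -[j k] /=.
apply/andP/eqP => [[/eqP hj /eqP hk]|<-]; last by rewrite col_mxKu col_mxKd.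
by rewrite /design_pair /scaled_design /= hj hk vsubmxK.
Qed.

End PairLaw.

Theorem theorem2 (R : realType) :
  exists c C : R, 0 < c /\ 0 < C /\
  forall (d1 d2 r : nat) (M0 : 'M[R[i]]_(d1, d2)) (delta : R) (t : nat)
    (N1 N2 : nat)
    (w : 'I_N1 -> 'cV[R[i]]_d1) (p : 'I_N1 -> R)
    (w' : 'I_N2 -> 'cV[R[i]]_d2) (p' : 'I_N2 -> R)
    (disp : measure_display) (T : measurableType disp) (P : probability T R)
    (a : T -> 'cV[R[i]]_d1) (b : T -> 'cV[R[i]]_d2)
    (n : nat)
    (as_ : 'I_n -> T -> 'cV[R[i]]_d1) (bs : 'I_n -> T -> 'cV[R[i]]_d2)
    (X0 : 'M[R[i]]_(d1, r)) (Y0 : 'M[R[i]]_(d2, r)),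
  \rank M0 = r -> (1 <= r)%N ->
  0 < delta -> delta < 1 ->
  (2 <= t)%N ->
  weighted_projective_design t w p ->
  weighted_projective_design t w' p' ->
  drawn_from_design P w p a ->
  drawn_from_design P w' p' b ->
  independent P a b ->
  independent_copies P (fun o => col_mx (a o) (b o))
    (fun i o => col_mx (as_ i o) (bs i o)) ->
  X0 ^t* *m X0 = Y0 ^t* *m Y0 ->
  spectral_norm (X0 *m Y0 ^t* - M0) <=
    c * (Num.sqrt r%:R)^-1 * low_rank_cond M0 ^- 2 * spectral_norm M0 ->
  C * low_rank_cond M0 * r%:R * (d1 + d2)%:R
    * Num.max (ln (d1 + d2)%:R) (ln (1 / delta)) <= n%:R ->
  exists E : set T, measurable E /\ ((1 - delta)%:E <= P E)%E /\
    forall o, E o ->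
      exactly_recovers X0 Y0 (fun i => as_ i o) (fun i => bs i o)
        (fun i => measurement M0 (as_ i o) (bs i o)) M0.
Proof.
(* One constant serves as [c] and as the relative accuracy of the covariances; its value makes the
   error terms of the localization and of the final comparison small enough. *)
pose e : R := (64 * 64)^-1.
have e0 : 0 < e by rewrite invr_gt0 mulr_gt0.
have e1 : 64 * (64 * e) <= 1 by rewrite mulrA mulfV// mulf_neq0.
have e_le1 : e <= 1 by move: e0 e1; clearbody e; lra.
exists e, (64 ^+ 6); split=> //; split; first by rewrite exprn_gt0.
move=> d1 d2 r M0 delta t N1 N2 w p w' p' disp T P a b n as_ bs X0 Y0.
move=> rankM r_gt0 delta0 delta1 t2 design1 design2 draw_a draw_b indep copies.
move=> gram anchor n_large.
have r_le1 : (r <= d1)%N by rewrite -rankM rank_leq_row.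
have r_le2 : (r <= d2)%N by rewrite -rankM rank_leq_col.
have d1_gt0 := leq_trans r_gt0 r_le1; have d2_gt0 := leq_trans r_gt0 r_le2.
have M0_neq0 : M0 != 0 by rewrite -mxrank_eq0 rankM -lt0n.
have [s0 sL M0_le M0_ge] := singular_value_bounds M0_neq0.
move: anchor n_large; rewrite /low_rank_cond.
set s := inf _ in s0 sL M0_ge *; set L := sup _ in sL M0_le *.
have L0 : 0 < L := lt_le_trans s0 sL.
set Lam := Num.max _ _ => anchor n_large.
have [U [UU UM _]] := orthonormal_column_basis rankM.
have rankMt : \rank (M0 ^t*) = r by rewrite mxrank_map mxrank_tr.
have [V [VV VM [B VB]]] := orthonormal_column_basis rankMt.
(* Balanced factors share the singular values of the product equally, hence the square roots. *)
pose ps := Num.sqrt s; pose qs := Num.sqrt L.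
have ps0 : 0 < ps by rewrite sqrtr_gt0.
have qs0 : 0 < qs by rewrite sqrtr_gt0.
have ps2 : ps ^+ 2 = s by rewrite sqr_sqrtr// ltW.
have qs2 : qs ^+ 2 = L by rewrite sqr_sqrtr// ltW.
have pqs : ps <= qs by rewrite ler_wsqrtr.
pose sc := e * (ps / qs).
have sc0 : 0 < sc by rewrite mulr_gt0// divr_gt0.
have sc1 : sc <= 1.
  have h : ps / qs <= 1 by rewrite ler_pdivrMr// mul1r.
  apply: le_trans (ler_wpM2l (ltW e0) h) _; rewrite mulr1.
  exact: e_le1.
pose point := design_pair w w'; pose mu := pair_weight p p'.
pose q := @value_weight R _ _ point mu.
pose av (v : value point) := usubmx (val v).
pose bv (v : value point) := dsubmx (val v).
have [_ p0 psum _] := design1; have [_ p'0 p'sum _] := design2.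
have q_ge0 v : 0 <= q v by apply: sumr_ge0 => jk _; rewrite mulr_ge0.
have pair_sum (F : 'cV[R[i]]_(d1 + d2) -> R) :
    \sum_v q v * F (val v) = \sum_j \sum_k p j * p' k *
      F (col_mx (scaled_design w j) (scaled_design w' k)).
  by rewrite sum_value_weight pair_big.
have pair_sumZ k l (F : 'cV[R[i]]_(d1 + d2) -> 'M[R[i]]_(k, l)) :
    \sum_v (q v)%:C *: F (val v) = \sum_j \sum_k (p j * p' k)%:C *:
      F (col_mx (scaled_design w j) (scaled_design w' k)).
  by rewrite sum_value_weightZ pair_big.
have q_sum : \sum_v q v = 1.
  have := pair_sum (fun=> 1); under eq_bigr do rewrite mulr1.
  move=> ->; under eq_bigr do under eq_bigr do rewrite mulr1.
  by under eq_bigr do rewrite -mulr_sumr p'sum mulr1.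
have av_norm v : fnorm (av v) ^+ 2 = d1%:R.
  rewrite /av /bv; have /codomP [jk ->] := valP v.
  by rewrite col_mxKu (fnorm_scaled_design design1).
have bv_norm v : fnorm (bv v) ^+ 2 = d2%:R.
  rewrite /av /bv; have /codomP [jk ->] := valP v.
  by rewrite col_mxKd (fnorm_scaled_design design2).
have av_cov : \sum_v (q v)%:C *: (av v *m (av v) ^t*) = 1%:M.
  rewrite (pair_sumZ _ _ (fun z => usubmx z *m (usubmx z) ^t*)).
  rewrite -(design_covariance d1_gt0 t2 design1); apply: eq_bigr => j _.
  under eq_bigr do rewrite col_mxKu.
  by rewrite -scaler_suml -rmorph_sum /= -mulr_sumr p'sum mulr1.
have bv_cov : \sum_v (q v)%:C *: (bv v *m (bv v) ^t*) = 1%:M.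
  rewrite (pair_sumZ _ _ (fun z => dsubmx z *m (dsubmx z) ^t*)) exchange_big /=.
  rewrite -(design_covariance d2_gt0 t2 design2); apply: eq_bigr => k _.
  under eq_bigr do rewrite col_mxKd.
  by rewrite -scaler_suml -rmorph_sum /= -mulr_suml psum mul1r.
have second (Z : 'M[R[i]]_(d1, d2)) :
    \sum_v q v * cmod (measurement Z (av v) (bv v)) ^+ 2 = fnorm Z ^+ 2.
  rewrite (pair_sum (fun z => cmod (measurement Z (usubmx z) (dsubmx z)) ^+ 2)).
  rewrite -(pair_second_moment d1_gt0 d2_gt0 t2 design1 design2).
  by apply: eq_bigr => j _; apply: eq_bigr => k _; rewrite col_mxKu col_mxKd.
have fourth (Z : 'M[R[i]]_(d1, d2)) :
    \sum_v q v * cmod (measurement Z (av v) (bv v)) ^+ 4 <= 4 * fnorm Z ^+ 4.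
  rewrite (pair_sum (fun z => cmod (measurement Z (usubmx z) (dsubmx z)) ^+ 4)).
  apply: le_trans (pair_fourth_moment d1_gt0 d2_gt0 t2 design1 design2 Z).
  rewrite le_eqVlt; apply/orP; left; apply/eqP.
  by apply: eq_bigr => j _; apply: eq_bigr => k _; rewrite col_mxKu col_mxKd.
pose good (f : {ffun 'I_n -> value point}) : bool :=
  `[< good_sample U V sc (fun i => av (f i)) (fun i => bv (f i)) >].
have bad_le : \sum_(f | ~~ good f) product_weight q f <= delta.
  apply: (good_sample_tail q_ge0 q_sum av_norm bv_norm av_cov bv_cov second fourth
    UU VV r_gt0 r_le1 r_le2 sc0 sc1 delta0 (Lam := Lam)).
  - by rewrite le_max lexx.
  - by rewrite le_max lexx orbT.
  - apply: sample_size_arith => //; rewrite ps2 qs2; apply: le_trans n_large.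
    by rewrite !mulrA.
have [Z_meas Z_law Z_ind] := copies.
have [|E [mE PE goodE]] := product_sample_event (q := q) (c := val) good val_inj Z_meas Z_ind.
  move=> i v; rewrite Z_law; last exact: borel_cvec_set1.
  exact: pair_law.
exists E; split=> //; split.
  rewrite PE lee_fin lerBlDr -(sum_product_weight1 q_sum n) (bigID good) /=.
  by rewrite lerD2l.
move=> o /goodE [f /asboolP [E1 E2 E3] fZ].
have -> : as_^~ o = fun i => av (f i).
  by apply/funext => i; rewrite /av -fZ col_mxKu.
have -> : bs^~ o = fun i => bv (f i).
  by apply/funext => i; rewrite /bv -fZ col_mxKd.
have -> : (fun i => measurement M0 (as_ i o) (bs i o)) =
    fun i => measurement M0 (av (f i)) (bv (f i)).
  by apply/funext => i; rewrite /av /bv -fZ col_mxKu col_mxKd.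
apply: (deterministic_recovery (ltW e0) e1 ps0 pqs UU VV UM VM _ _ gram
  (spectral_norm_ge0 (X0 *m Y0 ^t* - M0)) _ _ r_gt0 E1 E2 E3).
(* [V = M0^* B] puts [V y] in the range of [M0^*], where the smallest nonzero singular value is a
   lower bound. *)
- move=> y; rewrite ps2 -(fnorm_isometry y VV) VB -mulmxA.
  exact: M0_ge.
- by move=> x; rewrite qs2.
- by move=> x; exact: spectral_norm_mul.
- rewrite ps2 qs2; apply: anchor_arith anchor => //; first exact: ltW.
  exact: spectral_norm_le (ltW L0) M0_le.
Qed.
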